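(* Let $p\in\mathbb{C}[z_1^{\pm},\ldots,z_n^{\pm}]$ be a regular essentially Lee--Yang polynomial. Then there exists a proper cone $C\subset\mathbb{R}^n$ such that $p$ is essentially Lee--Yang with respect to the open cone $K=\mathrm{int}(C^* )$ and such that, for every $\ell\in K$, the pair $(m_\ell,C)$ is a lighthouse, where $m_\ell$ is the $\ell$-directed measure on $\Sigma(p)=\{x\in\mathbb{R}^n\mid p(e^{2\pi i x_1},\ldots,e^{2\pi i x_n})=0\}$.
   Context: A cone is a set $C\subset\mathbb{R}^n$ with $x\in C\iff\lambda x\in C$ for all $\lambda\in(0,\infty)$. A proper cone is a closed convex cone with non-empty interior for which there is $\ell\in\mathbb{R}^n$ with $\langle\ell,x\rangle>0$ for all $x\in C\setminus\{0\}$. Its dual cone is $C^*=\{\ell\in\mathbb{R}^n\mid\langle\ell,x\rangle\ge0\ \forall x\in C\}$, and $\mathrm{int}(C^* )=\{\ell\in\mathbb{R}^n\mid\langle\ell,x\rangle>0\ \forall x\in C\setminus\{0\}\}$ is the set of positive directions on $C$. A Laurent polynomial $p$ is essentially Lee--Yang with respect to a nonempty open cone $K\subset\mathbb{R}^n$ if $p(\exp(z))\neq0$ for all $z\in\mathbb{C}^n$ with $\mathrm{Re}(z)\in K\cup(-K)$, where $\exp(z)=(e^{z_1},\ldots,e^{z_n})$ and $\mathrm{Re}(z)=(\mathrm{Re}(z_1),\ldots,\mathrm{Re}(z_n))$; it is essentially Lee--Yang if this holds for some such $K$. $p$ is regular if $p$ and $\nabla p$ do not vanish simultaneously at any point of $\mathbb{T}^n$,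 where $\mathbb{T}\subset\mathbb{C}$ is the unit circle. For regular essentially Lee--Yang $p$, $\Sigma(p)$ is a smooth $\mathbb{Z}^n$-periodic hypersurface in $\mathbb{R}^n$. For a $\mathbb{Z}^n$-periodic hypersurface $\Sigma\subset\mathbb{R}^n$ with unit normal $\mathbf n(x)$ (defined up to sign) and surface measure $\sigma$ (the $(n-1)$-dimensional measure induced by Lebesgue measure on $\mathbb{R}^n$), the $\ell$-directed measure is $dm_\ell(x)=|\langle\mathbf n(x),\ell\rangle|\,d\sigma(x)$, regarded as a Radon measure on $\mathbb{R}^n$ supported on $\Sigma$. For a $\mathbb{Z}^n$-periodic Radon measure $m$ on $\mathbb{R}^n$, $\widehat m(k)=\int_{\mathbb{R}^n/\mathbb{Z}^n}e^{-2\pi i\langle k,x\rangle}dm(x)$ for $k\in\mathbb{Z}^n$, and $\mathrm{supp}(\widehat m)=\{k\in\mathbb Z^n\mid\widehat m(k)\ne0\}$. A pair $(\mu,C)$ of a non-negative $\mathbb{Z}^n$-periodic Radon measure $\mu$ and a proper cone $C$ is a lighthouse if (1) $\mu$ is supported on a closed set of Lebesgue measure zero, and (2) $\mathrm{supp}(\widehat\mu)\subset\mathbb{Z}^n\cap(-C\cup C)$. *)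

(* Defs.v *)
From HB Require Import structures.
From mathcomp Require Import all_boot all_order all_algebra finmap.
From mathcomp Require Import all_classical all_reals all_analysis.
From mathcomp Require Import measurable_realfun complex.

Set Implicit Arguments.
Unset Strict Implicit.
Unset Printing Implicit Defensive.

Import Order.TTheory GRing.Theory Num.Theory numFieldNormedType.Exports.

Local Open Scope classical_set_scope.
Local Open Scope ring_scope.
Local Open Scope complex_scope.

(* R^n as a measurable space: the sigma-algebra generated by the coordinates,
   which is the Borel sigma-algebra (rV_measurableE below). *)

Definition rV_display : measure_display. Proof. exact: default_measure_display. Qed.

Section rV_measurable.
Context {R : realType} {n : nat}.

Definition rV_coord (i : 'I_n) (x : 'rV[R]_n) : measurableTypeR R := x 0 i.

Let rV_set0 : g_sigma_preimage rV_coord set0.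
Proof. exact: sigma_algebra0. Qed.

Let rV_setC A : g_sigma_preimage rV_coord A -> g_sigma_preimage rV_coord (~` A).
Proof. exact: sigma_algebraC. Qed.

Let rV_bigcup (F : (set 'rV[R]_n)^nat) :
  (forall i, g_sigma_preimage rV_coord (F i)) ->
  g_sigma_preimage rV_coord (\bigcup_i (F i)).
Proof. exact: sigma_algebra_bigcup. Qed.

HB.instance Definition _ := @isMeasurable.Build rV_display
  'rV[R]_n (g_sigma_preimage rV_coord) rV_set0 rV_setC rV_bigcup.

Lemma measurable_rV_coord (i : 'I_n) : measurable_fun setT (rV_coord i).
Proof.
move=> _ Y mY; rewrite setTI; apply: sub_sigma_algebra => /=.
rewrite -bigcup_seq/=; exists i => /=; first by rewrite mem_index_enum.
by exists Y => //; rewrite setTI.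
Qed.

Lemma measurable_fun_rV d (T : measurableType d) (f : T -> 'rV[R]_n) :
  (forall i, measurable_fun setT (rV_coord i \o f)) -> measurable_fun setT f.
Proof.
move=> mf _ A mA; rewrite setTI; move: A mA; apply: smallest_sub.
  split=> [|A|F] /=; first by rewrite preimage_set0.
    by rewrite setTD -preimage_setC => /measurableC.
  by move=> mF; rewrite preimage_bigcup; exact: bigcupT_measurable.
rewrite -bigcup_seq => A [i _ [B mB]] <-; rewrite setTI -comp_preimage.
by have := mf i measurableT _ mB; rewrite setTI.
Qed.

Lemma measurable_rV_ball (x : 'rV[R]_n) (e : R) :
  0 < e -> measurable (ball x e).
Proof.
move=> e0; rewrite [X in measurable X](_ : _ =
    \big[setI/setT]_(i < n) (rV_coord i @^-1` ball (x 0 i : R) e)).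
  apply: bigsetI_measurable => i _; rewrite -[X in measurable X]setTI.
  by apply: measurable_rV_coord => //; apply: open_measurable; exact: ball_open.
rewrite -bigcap_seq; apply/seteqP; split => [y [_ xy] i _|y xy].
  exact: xy.
split=> // i j; rewrite ord1; apply: (xy j).
by rewrite /= mem_index_enum.
Qed.

Lemma measurable_rV_open (A : set 'rV[R]_n) : open A -> measurable A.
Proof.
move=> oA.
pose c (q : 'rV[rat]_n * nat) : set 'rV[R]_n :=
  ball (map_mx (ratr : rat -> R) q.1) (q.2.+1%:R^-1).
have -> : A = \bigcup_(q in [set q | c q `<=` A]) c q.
  apply/seteqP; split => [x Ax|x [q /= + cx]]; last exact.
  have /nbhs_ballP[e /= e0 xeA] : nbhs x A by exact: open_nbhs_nbhs.
  have [k ke] : exists k : nat, (k.+1%:R^-1 : R) < e / 2.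
    have /ltr_add_invr[k] : 0 < e / 2 by rewrite divr_gt0.
    by rewrite add0r => ?; exists k.
  have k0 : (0 : R) < k.+1%:R^-1 by rewrite invr_gt0.
  have /choice[q xq] (j : 'I_n) : exists q : rat, `|x 0 j - ratr q| < k.+1%:R^-1.
    have /rat_in_itvoo[q] : x 0 j - k.+1%:R^-1 < x 0 j + k.+1%:R^-1.
      by rewrite ltrBlDr -addrA ltrDl addr_gt0.
    rewrite in_itv/= => /andP[q1 q2]; exists q.
    by rewrite ltr_distlC q1 q2.
  have cx : c (\row_j q j, k) x.
    by split=> // i j; rewrite ord1 !mxE -ball_normE /= distrC xq.
  exists (\row_j q j, k) => // y /= cy.
  apply: xeA; rewrite [e]splitr.
  apply: (@le_ball _ _ _ (k.+1%:R^-1 + k.+1%:R^-1)); first by rewrite lerD// ltW.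
  by apply: ball_triangle cy; exact: ball_sym.
rewrite bigcup_mkcond; apply: countable_bigcupT_measurable => // q.
by case: ifPn => // _; apply: measurable_rV_ball; rewrite invr_gt0 ltr0n.
Qed.

Lemma rV_measurableE :
  (@measurable rV_display 'rV[R]_n) = <<s @open 'rV[R]_n >>.
Proof.
apply/seteqP; split; last first.
  apply: smallest_sub; first exact: sigma_algebra_measurable.
  exact: measurable_rV_open.
apply: smallest_sub; first exact: smallest_sigma_algebra.
rewrite -bigcup_seq => A [i _ [B mB]] <-.
rewrite setTI.
have: measurable `<=` [set B : set R | <<s @open 'rV[R]_n >> (rV_coord i @^-1` B)].
  rewrite [X in X `<=` _]RGenOpens.measurableE; apply: smallest_sub.
    split=> [|E|F] /=; first by rewrite preimage_set0; exact: sigma_algebra0.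
      by rewrite setTD -preimage_setC -setTD; exact: sigma_algebraCD.
    by move=> mF; rewrite preimage_bigcup; exact: sigma_algebra_bigcup.
  move=> _ [a [b ->]]; apply: sub_sigma_algebra.
  by apply: open_comp; [move=> x _; exact: coord_continuous|exact: interval_open].
exact.
Qed.

End rV_measurable.

Section lebesgue_rV.
Context {R : realType}.

(* Inserts the coordinate t at position i. *)
Definition rV_insert n (i : 'I_n) (t : R) (y : 'rV[R]_n.-1) : 'rV[R]_n :=
  \row_j (if unlift i j is Some k then y 0 k else t).

Definition rV_cons n (p : measurableTypeR R * 'rV[R]_n) : 'rV[R]_n.+1 :=
  @rV_insert n.+1 ord0 p.1 p.2.

Lemma measurable_rV_cons n : measurable_fun setT (@rV_cons n).
Proof.
apply: measurable_fun_rV => i.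
have [k ik|i0] := unliftP ord0 i.
  rewrite (_ : _ \o _ = rV_coord k \o snd); last first.
    by apply/funext => p; rewrite /= /rV_coord mxE ik liftK.
  by apply: measurableT_comp => //; exact: measurable_rV_coord.
rewrite (_ : _ \o _ = fst)//.
by apply/funext => p; rewrite /= /rV_coord mxE i0 unlift_none.
Qed.

Definition rV_uncons n (x : 'rV[R]_n.+1) : measurableTypeR R * 'rV[R]_n :=
  (x 0 ord0, \row_j x 0 (lift ord0 j)).

Lemma rV_consK n : cancel (@rV_cons n) (@rV_uncons n).
Proof.
case=> t y; rewrite /rV_uncons mxE unlift_none /=; congr pair.
by apply/rowP => j; rewrite !mxE liftK.
Qed.

Lemma measurable_rV_uncons n : measurable_fun setT (@rV_uncons n).
Proof.
apply: measurable_fun_pair; first exact: (@measurable_rV_coord R n.+1 ord0).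
apply: measurable_fun_rV => i.
rewrite (_ : _ \o _ = rV_coord (lift ord0 i)); first exact: measurable_rV_coord.
by apply/funext => x; rewrite /= /rV_coord mxE.
Qed.

Section step.
Variables (n : nat) (mu : {sigma_finite_measure set 'rV[R]_n -> \bar R}).

Definition lebesgue_rV_step : set 'rV[R]_n.+1 -> \bar R :=
  pushforward (lebesgue_measure \x mu)%E (@rV_cons n).

HB.instance Definition _ := Measure.copy lebesgue_rV_step
  (measure_function_pushforward__canonical__measure_function_Measure
    (lebesgue_measure \x mu)%E (@measurable_rV_cons n)).

Let lebesgue_rV_step_sigma_finite : sigma_finite setT lebesgue_rV_step.
Proof.
have /sigma_finiteP[F [TF ndF Foo]] := sigma_finiteT (@lebesgue_measure R).
have /sigma_finiteP[G [TG ndG Goo]] := sigma_finiteT mu.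
exists (fun k => @rV_uncons n @^-1` (F k `*` G k)).
  rewrite -preimage_bigcup; apply/seteqP; split => // x _ /=.
  have [i _ Fi] : (\bigcup_i F i) (rV_uncons x).1 by rewrite -TF.
  have [j _ Gj] : (\bigcup_i G i) (rV_uncons x).2 by rewrite -TG.
  exists (maxn i j) => //; split.
    by move: Fi; exact/subsetPset/ndF/leq_maxl.
  by move: Gj; exact/subsetPset/ndG/leq_maxr.
move=> k; have [mFk Fk] := Foo k; have [mGk Gk] := Goo k; split.
  rewrite -[X in measurable X]setTI; apply: measurable_rV_uncons => //.
  exact: measurableX.
rewrite /lebesgue_rV_step /pushforward -comp_preimage.
rewrite (_ : _ \o _ = id); last by apply/funext => p; exact: rV_consK.
by rewrite preimage_id product_measure1E// lte_mul_pinfty// ge0_fin_numE.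
Qed.

HB.instance Definition _ := Measure_isSigmaFinite.Build _ _ _
  lebesgue_rV_step lebesgue_rV_step_sigma_finite.

End step.

(* Lebesgue measure on R^n, as the n-fold product of the one on R. *)
Fixpoint lebesgue_rV n : {sigma_finite_measure set 'rV[R]_n -> \bar R} :=
  if n is m.+1 then lebesgue_rV_step (lebesgue_rV m) else \d_(0 : 'rV[R]_0).

End lebesgue_rV.

Section cones.
Context {R : realType} {n : nat}.
Implicit Types (x l : 'rV[R]_n) (C K : set 'rV[R]_n).

Definition dot x l : R := \sum_(j < n) x 0 j * l 0 j.

Definition cone C := forall x (a : R), 0 < a -> (C x <-> C (a *: x)).

Definition proper_cone C :=
  [/\ cone C, @convex_set R 'rV[R]_n C, closed C, interior C !=set0 &
      exists l, forall x, C x -> x != 0 -> 0 < dot l x].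

Definition dual_cone C : set 'rV[R]_n := [set l | forall x, C x -> 0 <= dot l x].

End cones.

Section laurent_polynomials.
Context {R : realType} {n : nat}.

Definition laurent := {fsfun 'rV[int]_n -> R[i] with 0}.

Implicit Types (p : laurent) (z : 'rV[R[i]]_n) (a : 'rV[int]_n).

Definition monomial a z : R[i] := \prod_(j < n) z 0 j ^ a 0 j.

Definition laurent_eval p z : R[i] := \sum_(a <- finsupp p) p a * monomial a z.

Definition laurent_deriv (j : 'I_n) p z : R[i] :=
  \sum_(a <- finsupp p) (p a *~ a 0 j) * monomial (a - delta_mx 0 j) z.

End laurent_polynomials.
Arguments laurent : clear implicits.

Section lee_yang.
Context {R : realType} {n : nat}.
Implicit Types (p : laurent R n) (K : set 'rV[R]_n).

Definition cexp (z : R[i]) : R[i] :=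
  (expR (complex.Re z))%:C * (cos (complex.Im z) +i* sin (complex.Im z)).

Definition essentially_lee_yang_wrt p K :=
  [/\ cone K, open K, K !=set0 &
      forall z : 'rV[R[i]]_n,
        K (map_mx (@complex.Re R) z) \/ K (- map_mx (@complex.Re R) z) ->
        laurent_eval p (map_mx cexp z) != 0].

Definition essentially_lee_yang p := exists K, essentially_lee_yang_wrt p K.

Definition regular p :=
  forall u : 'rV[R[i]]_n, (forall j, `|u 0 j| = 1) ->
    ~ (laurent_eval p u = 0 /\ forall j, laurent_deriv j p u = 0).

Definition Sigma p : set 'rV[R]_n :=
  [set x | laurent_eval p (\row_j cexp (0 +i* (2 * pi * x 0 j))) = 0].

End lee_yang.

Section directed_measures.
Context {R : realType} {n : nat}.
Implicit Types (S : set 'rV[R]_n) (x v l : 'rV[R]_n).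

Definition C1_on m (U : set 'rV[R]_m) (g : 'rV[R]_m -> R) :=
  forall y, U y -> differentiable g y /\
    forall k, {for y, continuous (fun y' => 'D_(delta_mx 0 k) g y')}.

(* S is, inside the open set V, the graph x_i = g(y) over the open set U, where
   y collects the coordinates of x other than x_i. *)
Definition graph_chart S (i : 'I_n) (V : set 'rV[R]_n) (U : set 'rV[R]_n.-1)
    (g : 'rV[R]_n.-1 -> R) :=
  [/\ open V, open U, C1_on U g & S `&` V = [set rV_insert i (g y) y | y in U]].

(* The (n-1)-dimensional measure on a hypersurface S, viewed as a measure on
   R^n: its area element on a graph chart is sqrt (1 + |grad g|^2) dy. *)
Definition surface_measure S (sigma : {measure set 'rV[R]_n -> \bar R}) :=
  sigma (~` S) = 0%E /\
  forall i V U g, graph_chart S i V U g ->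
    forall A, measurable A -> A `<=` V ->
      sigma A = (\int[lebesgue_rV n.-1]_(y in
                   U `&` [set y | A (rV_insert i (g y) y)])
                 (Num.sqrt (1 + \sum_k ('D_(delta_mx 0 k) g y) ^+ 2))%:E)%E.

Definition tangent S x v :=
  exists gamma : R -> 'rV[R]_n, [/\ gamma 0 = x,
    (\forall t \near (0 : R), S (gamma t)) & is_derive (0 : R) 1 gamma v].

Definition unit_normal S x v :=
  dot v v = 1 /\ forall w, tangent S x w -> dot v w = 0.

Definition directed_measure S l (m : {measure set 'rV[R]_n -> \bar R}) :=
  exists (sigma : {measure set 'rV[R]_n -> \bar R}) (N : 'rV[R]_n -> 'rV[R]_n),
    [/\ surface_measure S sigma, (forall x, S x -> unit_normal S x (N x)) &
        forall A, measurable A ->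
          m A = (\int[sigma]_(x in A `&` S) `|dot (N x) l|%:E)%E].

End directed_measures.

Section lighthouses.
Context {R : realType} {n : nat}.
Implicit Types (m : {measure set 'rV[R]_n -> \bar R}) (C : set 'rV[R]_n).

Definition rV_int (k : 'rV[int]_n) : 'rV[R]_n := map_mx intr k.

(* A Borel measure on R^n is Radon as soon as it is finite on compact sets. *)
Definition radon m := forall A, compact A -> (m A < +oo)%E.

Definition periodic_measure m :=
  forall (k : 'rV[int]_n) (A : set 'rV[R]_n), measurable A ->
    m [set x + rV_int k | x in A] = m A.

(* A fundamental domain for R^n / Z^n: the integral over the torus of a
   Z^n-periodic measure is computed on it. *)
Definition unit_cube : set 'rV[R]_n := [set x | forall j, 0 <= x 0 j < 1].

Definition fourier_coef m (k : 'rV[int]_n) : R[i] :=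
  let e (x : 'rV[R]_n) := cexp (0 +i* (- (2 * pi * dot (rV_int k) x))) in
  (\int[m]_(x in unit_cube) complex.Re (e x)) +i*
  (\int[m]_(x in unit_cube) complex.Im (e x)).

Definition lighthouse m C :=
  [/\ radon m, periodic_measure m, proper_cone C,
      (exists S, [/\ closed S, lebesgue_rV n S = 0%E & m (~` S) = 0%E]) &
      forall k, fourier_coef m k != 0 -> C (rV_int k) \/ C (- rV_int k)].

End lighthouses.

(* Main.v *)
Require Import Defs.
From HB Require Import structures.
From mathcomp Require Import all_boot all_order all_algebra finmap.
From mathcomp Require Import all_classical all_reals all_analysis.
From mathcomp Require Import measurable_realfun complex.
From mathcomp Require Import ring lra zify.

(** Restricted to a line with integer direction [b] deep in the cone [K], a Lee-Yang
    polynomial becomes a polynomial [P] in [e^(2 i pi t)] whose roots all lie on the unit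
    circle. The product of the roots then shows that [p], multiplied by a unimodular
    exponential with half-integer frequency, is a real function [f] on [R^n]; regularity
    makes the roots simple, so every line [x + t b] meets [Sigma] in the same number [D] of
    points per period. Averaging a Poisson approximation of [|grad f| delta(f)] along [b]
    or along a coordinate axis identifies the surface measure with the push-forward of
    Lebesgue measure under these [D] intersection maps, with density
    [|grad f| / |<grad f, b>|]; hence [m_l] has density [|<grad f, l>| / |<grad f, b>|].

    For [l] in the open cone spanned by directions [b_i] as above, [<grad f, l>] and
    [<grad f, b_j>] have the same sign, so the absolute values disappear and the Fourier
    coefficient of [m_l] at [k] becomes the integral over the unit cube of
    [\sum_z z^N q(z) / P'(z)], the sum being over the roots [z] of [P]. When [<k, b_j> < 0],
    [N] is non-negative, and Lagrange interpolation turns this into a trigonometric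
    polynomial with frequencies in [-k - C], where [C] is the dual of the cone spanned by
    the [b_i]. If [k] is in neither [C] nor [-C], some [<k, b_j>] is negative and [0] is not
    a frequency, so the coefficient vanishes. *)

Set Implicit Arguments.
Unset Strict Implicit.
Unset Printing Implicit Defensive.

Import Order.TTheory GRing.Theory Num.Theory numFieldNormedType.Exports.

Local Open Scope classical_set_scope.
Local Open Scope ring_scope.

(** * Lebesgue measure on row vectors *)

(** The hypothesis says nothing at Re z = 0, where the zeros in question lie, so transversality is a
    boundary statement. It comes from comparing two directions [b] and [b'] of [K]: were the
    derivatives along them of opposite signs at a zero, going to depth y along [b] while correcting
    along [b'] would give one-variable polynomials with no root in the punctured unit disc but a
    value o(y) at distance of order y from the circle, which the bound on the logarithmic derivative
    forbids. Applied to [b + e_j] and [b - e_j], this also converts regularity into simplicity of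
    the roots.

    Sums of directions occur throughout and [K] need not be convex: it is replaced by the cone over
    a ball around an integer vector [b0]. The directions [N b0 + e_i] span R^n and share the extreme
    exponents [ap] and [am], so that a single real function serves them all.

    The surface measure is specified only through its values on graph charts. The density formula
    must therefore be checked on every chart, and the implicit function theorem must supply enough
    charts for these values to determine the measure. *)

Section lebesgue_rV_fubini.
Context {R : realType}.
Local Open Scope ereal_scope.

Lemma lebesgue_measure_shift (c : R) (A : set R) : measurable A ->
  pushforward (@lebesgue_measure R)
    ((fun t => t + c)%R : measurableTypeR R -> measurableTypeR R) A =
  lebesgue_measure A.
Proof.
have mc : measurable_fun setT
    ((fun t => t + c)%R : measurableTypeR R -> measurableTypeR R).
  exact: measurable_funD.
move=> mA; apply/esym/lebesgue_measure_unique => //= _ [[a b]] _ <-.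
rewrite /pushforward /=.
rewrite (_ : _ @^-1` _ = `](a - c)%R, (b - c)%R]%classic); last first.
  by apply/seteqP; split => x /=; rewrite !in_itv/= ltrBlDr lerBrDr.
rewrite !lebesgue_measure_itv/= !lte_fin ltrD2r.
by case: ifP => // _; congr EFin; lra.
Qed.

Lemma ge0_integral_shift (c : R) (f : measurableTypeR R -> \bar R) :
  measurable_fun setT f -> (forall t, 0 <= f t) ->
  \int[lebesgue_measure]_t f (t + c)%R = \int[lebesgue_measure]_t f t.
Proof.
move=> mf f0.
have mc : measurable_fun setT
    ((fun t => t + c)%R : measurableTypeR R -> measurableTypeR R).
  exact: measurable_funD.
rewrite [RHS](@eq_measure_integral _ _ _ _ (pushforward lebesgue_measure
    ((fun t => t + c)%R : measurableTypeR R -> measurableTypeR R)))/=.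
  by rewrite ge0_integral_pushforward// preimage_setT.
by move=> A mA _; exact/esym/lebesgue_measure_shift.
Qed.

Lemma ge0_integral_lebesgue_rVS n (f : 'rV[R]_n.+1 -> \bar R) :
  measurable_fun setT f -> (forall x, 0 <= f x) ->
  \int[lebesgue_rV n.+1]_x f x =
  \int[lebesgue_rV n]_y \int[lebesgue_measure]_t f (rV_cons (t, y)).
Proof.
move=> mf f0 /=.
rewrite ge0_integral_pushforward//=; last exact: measurable_rV_cons.
rewrite preimage_setT.
rewrite -[LHS]/(\int[lebesgue_measure \x lebesgue_rV n]_x ((f \o @rV_cons R n) x)).
rewrite fubini_tonelli2//=.
by apply: measurableT_comp => //; exact: measurable_rV_cons.
Qed.

Local Opaque lebesgue_rV.

Lemma rV_consD n (t s : R) (y z : 'rV[R]_n) :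
  (rV_cons (t, y) + rV_cons (s, z) = rV_cons ((t + s)%R, (y + z)%R))%R.
Proof. by apply/rowP => j; rewrite !mxE; case: unliftP => [k|] _; rewrite ?mxE. Qed.

Lemma measurable_rV_shift n (v : 'rV[R]_n) :
  measurable_fun setT (fun x : 'rV[R]_n => x + v)%R.
Proof.
apply: measurable_fun_rV => i.
rewrite (_ : _ \o _ = (fun x => rV_coord i x + v 0%R i)%R); last first.
  by apply/funext => x; rewrite /= /rV_coord mxE.
by apply: measurable_funD => //; exact: measurable_rV_coord.
Qed.

Lemma ge0_integral_rV_shift n (v : 'rV[R]_n) (f : 'rV[R]_n -> \bar R) :
  measurable_fun setT f -> (forall x, 0 <= f x) ->
  \int[lebesgue_rV n]_x f (x + v)%R = \int[lebesgue_rV n]_x f x.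
Proof.
elim: n v f => [|n IH] v f mf f0.
  by apply: eq_integral => x _; congr f; rewrite [LHS]thinmx0 [RHS]thinmx0.
have mfc : measurable_fun setT (f \o @rV_cons R n).
  by apply: measurableT_comp => //; exact: measurable_rV_cons.
rewrite (ge0_integral_lebesgue_rVS mf f0).
rewrite (ge0_integral_lebesgue_rVS
  (measurableT_comp mf (measurable_rV_shift v)) (fun x => f0 _)).
have -> : v = rV_cons ((rV_uncons v).1, (rV_uncons v).2).
  apply/rowP => j; rewrite !mxE.
  by case: unliftP => [k ->|->]; rewrite ?mxE.
move: (rV_uncons v) => [s w] /=.
rewrite -(IH w (fun y => \int[lebesgue_measure]_t f (rV_cons (t, y)))).
- apply: eq_integral => y _.
  rewrite -(@ge0_integral_shift s (fun t => f (rV_cons (t, y + w)%R)))//.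
    by apply: eq_integral => t _; rewrite rV_consD.
  exact: (measurableT_comp mfc (pair2_measurable _)).
- exact: (@measurable_fun_fubini_tonelli_G _ _ _ _ R lebesgue_measure (f \o @rV_cons R n) mfc (fun x => f0 _)).
- by move=> y; exact: integral_ge0.
Qed.

Lemma measurable_rV_insert n (i : 'I_n.+1) :
  measurable_fun setT (fun p : 'rV[R]_n * measurableTypeR R =>
     @rV_insert R n.+1 i p.2 p.1).
Proof.
apply: measurable_fun_rV => j.
case: (unliftP i j) => [k jk|ji].
  rewrite (_ : _ \o _ = rV_coord k \o fst).
    by apply: measurableT_comp => //; exact: measurable_rV_coord.
  by apply/funext => p; rewrite /= /rV_coord mxE jk liftK.
rewrite (_ : _ \o _ = snd)//.
by apply/funext => p; rewrite /= /rV_coord mxE ji unlift_none.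
Qed.

Lemma rV_insert_cons n (k : 'I_n.+1) (s t : R) (z : 'rV[R]_n) :
  @rV_insert R n.+2 (lift ord0 k) s (rV_cons (t, z)) =
  rV_cons (t, @rV_insert R n.+1 k s z).
Proof.
apply/rowP => j; rewrite !mxE.
case: (unliftP ord0 j) => [j' ->|->].
  rewrite mxE; case: (unliftP k j') => [m ->|->]; last by rewrite unlift_none.
  rewrite (_ : lift ord0 (lift k m) = lift (lift ord0 k) (lift ord0 m)).
    by rewrite liftK mxE liftK.
  by apply: val_inj; rewrite /= /bump /=; lia.
rewrite (_ : ord0 = lift (lift ord0 k) ord0) ?liftK ?mxE ?unlift_none//.
by apply: val_inj.
Qed.

(** [lebesgue_rV] peels off coordinate 0, so an inner coordinate is reached by induction: Tonelli
    moves the first variable outside, the induction hypothesis isolates the [k]-th of the others,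
    and Tonelli moves the first variable back. *)
Lemma ge0_integral_rV_insert n (i : 'I_n.+1) (f : 'rV[R]_n.+1 -> \bar R) :
  measurable_fun setT f -> (forall x, 0 <= f x) ->
  \int[lebesgue_rV n.+1]_x f x =
  \int[lebesgue_rV n]_y \int[lebesgue_measure]_t f (@rV_insert R n.+1 i t y).
Proof.
elim: n i f => [|n IH] i f mf f0.
  by rewrite (ge0_integral_lebesgue_rVS mf f0) (ord1 i).
case: (unliftP ord0 i) => [k ->|->]; last exact: (ge0_integral_lebesgue_rVS mf f0).
have mfc : measurable_fun setT (f \o @rV_cons R n.+1).
  by apply: measurableT_comp => //; exact: measurable_rV_cons.
have mfi : measurable_fun setT
    (fun p : 'rV[R]_n.+1 * measurableTypeR R => f (@rV_insert R n.+2 (lift ord0 k) p.2 p.1)).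
  by apply: measurableT_comp => //; exact: measurable_rV_insert.
rewrite (ge0_integral_lebesgue_rVS mf f0).
rewrite -(@fubini_tonelli _ _ _ _ R lebesgue_measure (lebesgue_rV n.+1) (f \o @rV_cons R n.+1) mfc (fun x => f0 _)).
rewrite [RHS]ge0_integral_lebesgue_rVS//; last 2 first.
- exact: (@measurable_fun_fubini_tonelli_F _ _ _ _ R lebesgue_measure _ mfi (fun x => f0 _)).
- by move=> x; exact: integral_ge0.
rewrite -(@fubini_tonelli _ _ _ _ R lebesgue_measure (lebesgue_rV n) (fun p =>
   \int[lebesgue_measure]_s f (@rV_insert R n.+2 (lift ord0 k) s (rV_cons p))))//; last 2 first.
- rewrite (_ : (fun _ => _) = fubini_F lebesgue_measure
    (fun q : (measurableTypeR R * 'rV[R]_n) * measurableTypeR R =>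
      f (@rV_insert R n.+2 (lift ord0 k) q.2 (rV_cons q.1))))//.
  apply: measurable_fun_fubini_tonelli_F; last by move=> x; exact: f0.
  apply: (measurableT_comp (g := fun q => (@rV_cons R n q.1, q.2)) mfi).
  apply: measurable_fun_pair => //.
  by apply: measurableT_comp => //; exact: measurable_rV_cons.
- by move=> x; exact: integral_ge0.
apply: eq_integral => t _ /=.
rewrite (IH k (fun z => f (rV_cons (t, z)))
  (measurableT_comp mfc (pair1_measurable _)) (fun x => f0 _)).
by apply: eq_integral => z _; apply: eq_integral => s _; rewrite rV_insert_cons.
Qed.
End lebesgue_rV_fubini.

Section lebesgue_rV_sets.
Context {R : realType}.
Local Open Scope ereal_scope.
Local Notation mu := lebesgue_measure.

Lemma continuous_measurable_rV n (f : 'rV[R]_n -> R) :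
  continuous f -> measurable_fun setT f.
Proof.
move=> cf; apply: (measurability _ (RGenOpens.measurableE R)) => //.
move=> _ [_ [a [b ->] <-]]; rewrite setTI.
apply: measurable_rV_open; apply: open_comp; last exact: interval_open.
by move=> x _; exact: cf.
Qed.

Definition rV_box n (I : set R) : set 'rV[R]_n := [set x | forall j, I (x 0%R j)].

Lemma measurable_rV_box n (I : set R) : measurable I -> measurable (@rV_box n I).
Proof.
move=> mI; rewrite [X in measurable X](_ : _ =
    \big[setI/setT]_(i < n) (rV_coord i @^-1` I)).
  apply: bigsetI_measurable => i _; rewrite -[X in measurable X]setTI.
  exact: measurable_rV_coord.
rewrite -bigcap_seq; apply/seteqP; split => [y Iy i _|y Iy j]; first exact: Iy.
by apply: (Iy j); rewrite /= mem_index_enum.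
Qed.

Lemma lebesgue_rV_box n (I : set R) : measurable I ->
  lebesgue_rV n (@rV_box n I) = iter n (fun y => y * mu I) 1.
Proof.
move=> mI; elim: n => [|n IH].
  rewrite /= diracE mem_set//; by case.
have mb k : measurable_fun setT (fun x : 'rV[R]_k => (\1_(rV_box I) x : R)%:E).
  by apply/measurable_EFinP; apply: measurable_indic; exact: measurable_rV_box.
rewrite -[in LHS](setIT (rV_box I)) -integral_indic//; last exact: measurable_rV_box.
rewrite (ge0_integral_lebesgue_rVS (mb _))//.
transitivity (\int[lebesgue_rV n]_y ((\1_(@rV_box n I) y)%:E * mu I)).
  apply: eq_integral => y _.
  rewrite (_ : mu I = \int[mu]_t (\1_I t)%:E); last by rewrite integral_indic ?setIT.
  rewrite -ge0_integralZl//; last first.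
    by apply/measurable_EFinP; exact: measurable_indic.
  apply: eq_integral => t _; rewrite -EFinM; congr EFin.
  rewrite !indicE -natrM mulnb; congr ((nat_of_bool _)%:R)%R.
  apply/idP/idP => [/set_mem Ix|/andP[/set_mem Iy /set_mem It]].
    apply/andP; split; apply/mem_set.
      by move=> j; have := Ix (lift ord0 j); rewrite mxE liftK.
    by have := Ix ord0; rewrite mxE unlift_none.
  by apply/mem_set => j; rewrite mxE; case: unliftP => [k|] _ //=.
rewrite (ge0_integralZr _ _ (mb n))//.
rewrite integral_indic//; last exact: measurable_rV_box.
by rewrite setIT /= -IH.
Qed.

Lemma unit_cubeE n : @unit_cube R n = rV_box `[0%R, 1%R[%classic.
Proof. by apply/seteqP; split => x /= + j => /(_ j); rewrite /= in_itv. Qed.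

Lemma measurable_unit_cube n : measurable (@unit_cube R n).
Proof. by rewrite unit_cubeE; exact: measurable_rV_box. Qed.

Lemma lebesgue_rV_cube n : lebesgue_rV n (@unit_cube R n) = 1.
Proof.
rewrite unit_cubeE lebesgue_rV_box//; elim: n => //= n ->.
by rewrite lebesgue_measure_itv/= lte01 sube0 mul1e.
Qed.

Lemma ler_coord_norm n (x : 'rV[R]_n) (j : 'I_n) : (`|x 0 j| <= `|x|)%R.
Proof.
rewrite [leRHS]/Num.norm /= mx_normrE.
exact: (le_bigmax _ (fun ij : 'I_1 * 'I_n => `|x ij.1 ij.2|)%R (0%R, j)).
Qed.

Lemma lebesgue_rV_ball n (x : 'rV[R]_n) (r : R) :
  lebesgue_rV n (ball x r) < +oo.
Proof.
have [r0|r0] := ltP 0%R r; first last.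
  rewrite (_ : ball x r = set0) ?measure0//; apply/seteqP; split=> // y.
  by rewrite -ball_normE /= => /(le_lt_trans (normr_ge0 _)); rewrite ltNge r0.
apply: (@le_lt_trans _ _ (lebesgue_rV n (rV_box `](- (`|x| + r))%R, (`|x| + r)%R[%classic))).
  apply: le_measure; rewrite ?inE.
  - exact: measurable_rV_ball.
  - exact: measurable_rV_box.
  - move=> y; rewrite -ball_normE /= => xy j /=.
    rewrite in_itv /= -ltr_norml.
    apply: (le_lt_trans (ler_coord_norm y j)).
    have := ler_normB x (x - y)%R; rewrite subKr => /le_lt_trans; apply.
    by rewrite ltrD2l.
rewrite lebesgue_rV_box//.
have : mu `](- (`|x| + r))%R, (`|x| + r)%R[%classic < +oo.
  by rewrite lebesgue_measure_itv/=; case: ifP => // _; rewrite -EFinB ltry.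
have : 0 <= mu `](- (`|x| + r))%R, (`|x| + r)%R[%classic by [].
move: (mu _) => c c0 coo.
suff [] : 0 <= iter n (fun y => y * c) 1 /\ iter n (fun y => y * c) 1 < +oo by [].
elim: n {x} => [|n [IH0 IH]] /=; first by rewrite ltry.
by rewrite mule_ge0// lte_mul_pinfty// ge0_fin_numE.
Qed.

(** An indicator replaces the domain [0, 1], so that Tonelli applies on the whole product space. *)
Let averaging_kernel n (v : 'rV[R]_n) (f : 'rV[R]_n -> \bar R)
    (q : 'rV[R]_n * measurableTypeR R) : \bar R :=
  f (q.1 + q.2 *: v)%R * (\1_(`[0%R, 1%R]%classic) q.2 : R)%:E.

Let measurable_averaging_kernel n (v : 'rV[R]_n) (f : 'rV[R]_n -> \bar R) :
  measurable_fun setT f -> measurable_fun setT (averaging_kernel v f).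
Proof.
move=> mf; apply: emeasurable_funM.
  apply: measurableT_comp => //; apply: measurable_fun_rV => i.
  rewrite (_ : _ \o _ = (fun q => rV_coord i q.1 + q.2 * v 0%R i)%R); last first.
    by apply/funext => q; rewrite /= /rV_coord !mxE.
  apply: measurable_funD.
    by apply: measurableT_comp => //; exact: measurable_rV_coord.
  exact: measurable_funM.
apply/measurable_EFinP.
by apply: (measurableT_comp (f := (\1_(`[0%R, 1%R]%classic) : measurableTypeR R -> R)) _
  measurable_snd); exact: measurable_indic.
Qed.

Let averaging_kernelE n (v : 'rV[R]_n) (f : 'rV[R]_n -> \bar R) x :
  \int[mu]_(t in `[0%R, 1%R]) f (x + t *: v)%R =
  \int[mu]_t averaging_kernel v f (x, t).
Proof. by rewrite integral_mkcond epatch_indic. Qed.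

Lemma measurable_averaging n (v : 'rV[R]_n) (f : 'rV[R]_n -> \bar R) :
  measurable_fun setT f -> (forall x, 0 <= f x) ->
  measurable_fun setT
    (fun x : 'rV[R]_n => \int[mu]_(t in `[0%R, 1%R]) f (x + t *: v)%R).
Proof.
move=> mf f0; under eq_fun do rewrite averaging_kernelE.
apply: (measurable_fun_fubini_tonelli_F (averaging_kernel v f)).
  exact: measurable_averaging_kernel.
by move=> q; rewrite mule_ge0// lee_fin.
Qed.

(** For each fixed [t] the translation by [t *: v] preserves the integral. Averaging over [t]
    reduces questions on R^n to one-dimensional integrals along a direction that can be chosen
    freely. *)
Lemma ge0_integral_averaging n (v : 'rV[R]_n) (f : 'rV[R]_n -> \bar R) :
  measurable_fun setT f -> (forall x, 0 <= f x) ->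
  \int[lebesgue_rV n]_x f x =
  \int[lebesgue_rV n]_x \int[mu]_(t in `[0%R, 1%R]) f (x + t *: v)%R.
Proof.
move=> mf f0.
have g0 q : 0 <= averaging_kernel v f q by rewrite mule_ge0// lee_fin.
under [RHS]eq_integral do rewrite averaging_kernelE.
rewrite [RHS](fubini_tonelli (m1 := lebesgue_rV n) (m2 := mu) _
  (measurable_averaging_kernel v mf) g0).
transitivity (\int[mu]_t ((\1_(`[0%R, 1%R]%classic) t)%:E * \int[lebesgue_rV n]_x f x)).
  rewrite ge0_integralZr//; last 2 first.
  - by apply/measurable_EFinP; exact: measurable_indic.
  - exact: integral_ge0.
  rewrite integral_indic// setIT [X in X * _](_ : _ = 1) ?mul1e//.
  by apply: etrans (lebesgue_measure_itv `[0%R, 1%R]) _; rewrite /= lte01 sube0.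
apply: eq_integral => t _; rewrite /averaging_kernel /= indicE.
case: (boolP (t \in `[0%R, 1%R]%classic)) => tI.
  rewrite mul1e -(ge0_integral_rV_shift (t *: v) mf f0).
  by apply: eq_integral => x _; rewrite mule1.
rewrite mul0e; apply/esym/integral0_eq => x _.
by rewrite mule0.
Qed.

End lebesgue_rV_sets.

Section real_line.
Context {R : realType}.
Local Notation mu := lebesgue_measure.

Lemma integral_is_derive (f F : R -> R) (a b : R) : a <= b ->
  (forall x, is_derive x (1 : R) F (f x)) -> continuous f ->
  (\int[mu]_(x in `[a, b]) (f x)%:E = (F b - F a)%:E)%E.
Proof.
rewrite le_eqVlt => /orP[/eqP <- _ _|ab dF cf].
  by rewrite set_itv1 integral_set1 subrr.
have cF : continuous F.
  move=> x; apply/differentiable_continuous/derivable1_diffP.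
  by have [] := dF x.
rewrite EFinB; apply: continuous_FTC2 => //.
- exact: continuous_subspaceT.
- split; first by move=> x _; have [] := dF x.
  + exact/cvg_at_right_filter/cF.
  + exact/cvg_at_left_filter/cF.
- by move=> x _; rewrite derive1E; have [] := dF x.
Qed.

Lemma sin2piZ (k : int) (x : R) : sin (x + 2 * pi * k%:~R) = sin x.
Proof.
elim/int_ind: k x => [|k IH|k IH] x; first by rewrite mulr0 addr0.
  rewrite -[in RHS](IH x) -[RHS]sinD2pi intS rmorphD /= mulr2n.
  by congr sin; ring.
rewrite -[in RHS](IH x) -[LHS]sinD2pi intS opprD rmorphD /= mulr2n.
by congr sin; ring.
Qed.

Lemma cos2piZ (k : int) (x : R) : cos (x + 2 * pi * k%:~R) = cos x.
Proof. by rewrite -!sinDpihalf addrAC sin2piZ. Qed.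

(** The constant 1 keeps the integrand non-negative, as Tonelli requires in
    [integral_unit_cube_cos]; there the phase [c] absorbs the other coordinates. *)
Lemma integral_cos_period (k : int) (c : R) : k != 0 ->
  (\int[mu]_(t in `[0%R, 1%R[) (1 + cos (2 * pi * k%:~R * t + c))%:E = 1)%E.
Proof.
move=> k0; have pik : 2 * pi * k%:~R != 0 :> R.
  by rewrite !mulf_neq0// ?intr_eq0// gt_eqF// pi_gt0.
pose a : R := 2 * pi * k%:~R.
have cc : continuous (fun t : R => 1 + cos (a * t + c)).
  move=> t; apply: cvgD; first exact: cvg_cst.
  apply: (@continuous_comp _ _ _ (fun t => a * t + c) cos); last exact: continuous_cos.
  by apply: cvgD; [exact: mulrl_continuous|exact: cvg_cst].
rewrite integral_itv_bndo_bndc; last first.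
  apply/measurable_EFinP; apply: measurable_funS (continuous_measurable_fun cc) => //.
have dF (x : R) : is_derive x (1 : R) (fun t => t + a^-1 * sin (a * t + c))
    (1 + cos (a * x + c)).
  have -> : (1 + cos (a * x + c)) = 1 + a^-1 * (cos (a * x + c) * a).
    by congr (_ + _); rewrite mulrCA mulVf// mulr1.
  apply: is_deriveD.
  apply: is_deriveZ.
  apply: (@is_derive1_comp _ sin (fun t => a * t + c)).
  rewrite -[a in is_derive _ _ _ a]addr0; apply: is_deriveD.
  rewrite -[a in is_derive _ _ _ a]mulr1; exact: is_deriveZ.
rewrite (integral_is_derive ler01 dF cc).
by rewrite mulr1 mulr0 !add0r (addrC a) sin2piZ; congr EFin; ring.
Qed.

End real_line.

(** * The unit cube as a fundamental domain *)

Section unit_cube_tiling.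
Context {R : realType} {n : nat}.
Implicit Types (x y : 'rV[R]_n) (q : 'rV[int]_n).
Local Open Scope ereal_scope.

Lemma unit_cube_floor x : exists q, unit_cube (x - @rV_int R n q)%R.
Proof.
exists (\row_j Num.floor (x 0%R j)) => j; rewrite !mxE subr_ge0 ltrBlDr addrC.
by rewrite floor_le_tmp -intrD1 floorD1_gt.
Qed.

Lemma unit_cube_inj x q q' : unit_cube (x - @rV_int R n q)%R ->
  unit_cube (x - @rV_int R n q')%R -> q = q'.
Proof.
move=> xq xq'; apply/rowP => j.
have := xq j; have := xq' j; rewrite !mxE.
move=> /andP[a1 a2] /andP[b1 b2].
have h1 : (q 0%R j < q' 0%R j + 1)%R by rewrite -(ltr_int R) rmorphD /=; lra.
have h2 : (q' 0%R j < q 0%R j + 1)%R by rewrite -(ltr_int R) rmorphD /=; lra.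
by apply/eqP; rewrite eq_le -!ltzD1 h1 h2.
Qed.

(** Both domains are cut by integer translates of the cube. The piece where [tau x] and [x - q] lie
    in the cube and the piece where [x] and [tau x + q] do are exchanged by the translation by [q],
    to which [h] is insensitive. *)
Lemma integral_cube_unfold (tau : 'rV[R]_n -> 'rV[R]_n) (h : 'rV[R]_n -> \bar R) :
  measurable_fun setT tau ->
  (forall x q, tau (x + rV_int q) = tau x + rV_int q)%R ->
  measurable_fun setT h -> (forall x, 0 <= h x) ->
  (forall x q, h (x + rV_int q)%R = h x) ->
  \int[lebesgue_rV n]_(x in tau @^-1` unit_cube) h (tau x) =
  \int[lebesgue_rV n]_(x in unit_cube) h (tau x).
Proof.
move=> mtau tauD mh h0 hD.
have mcube := @measurable_unit_cube R n.
have mshift (s : 'rV[R]_n) (f : 'rV[R]_n -> 'rV[R]_n) : measurable_fun setT f ->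
    measurable [set x | unit_cube (f x + s)%R].
  move=> mf; have mfs : measurable_fun setT (fun x => f x + s)%R.
    exact: (measurableT_comp (measurable_rV_shift s) mf).
  by rewrite -[X in measurable X]setTI; exact: mfs.
(* [e] is the identity for the left domain and the opposite for the right one, so that equally
   numbered pieces are translates of each other. *)
pose C (e : 'rV[int]_n -> 'rV[int]_n) (f : 'rV[R]_n -> 'rV[R]_n)
    (B : set 'rV[R]_n) k : set 'rV[R]_n :=
  B `&` (if pickle_inv k is Some q then [set x | unit_cube (f x - rV_int (e q))%R]
  else set0).
have mC e f B k : measurable_fun setT f -> measurable B -> measurable (C e f B k).
  move=> mf mB; apply: measurableI => //; case: pickle_inv => [q|//].
  exact: mshift.
have trivC e f B : injective e -> trivIset setT (C e f B).
  move=> inje; apply/trivIsetP => i j _ _ ij; apply/seteqP; split => // x [[_ +] [_ +]].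
  have := @pickle_invK 'rV[int]_n i; have := @pickle_invK 'rV[int]_n j.
  case: (pickle_inv j) => [qj|//] /= qjj; case: (pickle_inv i) => [qi|//] /= qii.
  move=> xi xj; move: ij; rewrite -qii -qjj (inje _ _ (unit_cube_inj xi xj)).
  by rewrite eqxx.
have covC e f B : involutive e -> B = \bigcup_k C e f B k.
  move=> ee; apply/seteqP; split => [x Bx|x [k _ []]//].
  have [q fq] := unit_cube_floor (f x).
  by exists (choice.pickle (e q)) => //; split => //; rewrite pickleK_inv ee.
have mhtau : measurable_fun setT (h \o tau) by exact: measurableT_comp.
have mtc : measurable (tau @^-1` unit_cube).
  by rewrite -[X in measurable X]setTI; exact: mtau.
have covE e f B : involutive e -> measurable_fun setT f -> measurable B ->
    \int[lebesgue_rV n]_(x in B) h (tau x) =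
    \sum_(0 <= k <oo) \int[lebesgue_rV n]_(x in C e f B k) h (tau x).
  move=> ee mf mB; rewrite {1}(covC e f B ee) ge0_integral_bigcup//.
  - by move=> k; exact: mC.
  - by apply: measurable_funS mhtau.
  - by apply: trivC; exact: inv_inj.
rewrite (covE id id _ (fun=> erefl) (@measurable_id _ _ setT) mtc).
rewrite (covE -%R tau _ opprK mtau mcube).
apply: eq_eseriesr => k _.
have mset e f B := mC e f B k.
rewrite integral_mkcond [RHS]integral_mkcond.
case E : (pickle_inv k) => [q|]; last first.
  by apply: eq_integral => x _; rewrite /C E !setI0 !patch_set0.
rewrite -(@ge0_integral_rV_shift _ _ (rV_int q) (_ \_ (C id id _ k))); last 2 first.
- apply/(measurable_restrictT _ _).1 => //; first exact: mset.
  exact: measurable_funS mhtau.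
- by move=> x; rewrite patchE; case: ifP.
apply: eq_integral => x _; rewrite !patchE tauD hD /C E.
congr (if _ then _ else _); apply/idP/idP => /set_mem[/= a b]; apply/mem_set.
  split => /=; first by rewrite addrK in b.
  by move: a; rewrite tauD /rV_int map_mxN opprK.
split => /=; last by rewrite addrK.
by move: b; rewrite tauD /rV_int map_mxN opprK.
Qed.

End unit_cube_tiling.

Section integral_cube_cos.
Context {R : realType}.
Local Open Scope ereal_scope.

Lemma dot_insert n (i : 'I_n.+1) (w : 'rV[R]_n.+1) (t : R) (y : 'rV[R]_n) :
  dot w (@rV_insert R n.+1 i t y) =
  (w 0%R i * t + \sum_k w 0%R (lift i k) * y 0%R k)%R.
Proof.
rewrite /dot (bigD1_ord i)//= mxE unlift_none; congr (_ + _)%R.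
by apply: eq_bigr => k _; rewrite mxE liftK.
Qed.

Lemma continuous_sumr (T : topologicalType) (I : Type) (r : seq I) (f : I -> T -> R) :
  (forall i, continuous (f i)) -> continuous (fun x => \sum_(i <- r) f i x)%R.
Proof.
move=> cf x; elim: r => [|i r IH].
  by under eq_fun do rewrite big_nil; exact: cvg_cst.
under eq_fun do rewrite big_cons.
by apply: cvgD => //; exact: cf.
Qed.

Lemma dot_continuous n (w : 'rV[R]_n) : continuous (dot w).
Proof.
apply: (@continuous_sumr _ _ _ (fun j (x : 'rV[R]_n) => w 0 j * x 0 j)%R) => j x.
by apply: continuousM; [exact: cst_continuous|exact: coord_continuous].
Qed.

Lemma integral_unit_cube_cos n (q : 'rV[int]_n) (c : R) : q != 0%R ->
  \int[lebesgue_rV n]_(x in unit_cube)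
     (1 + cos (2 * pi * dot (rV_int q) x + c))%:E%R = 1.
Proof.
case: n q => [|n] q q0; first by rewrite thinmx0 eqxx in q0.
(* Integrating first along a coordinate where [q] is nonzero gives 1 whatever the other coordinates
   are. *)
have [i qi] : exists i, q 0%R i != 0%R.
  apply/existsP; apply: contraNT q0; rewrite negb_exists => /forallP h.
  by apply/eqP/rowP => i; rewrite mxE; apply/eqP; have := h i; rewrite negbK.
set f := fun x : 'rV[R]_n.+1 => (1 + cos (2 * pi * dot (rV_int q) x + c))%:E%R.
have mf : measurable_fun setT f.
  apply/measurable_EFinP; apply: continuous_measurable_rV => x.
  apply: continuousD; first exact: cst_continuous.
  apply: (@continuous_comp _ _ _ (fun x => 2 * pi * dot (rV_int q) x + c)%R cos); last exact: continuous_cos.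
  apply: continuousD; last exact: cst_continuous.
  by apply: continuousM; [exact: cst_continuous|exact: dot_continuous].
have f0 x : 0 <= f x by rewrite lee_fin -lerBlDl sub0r cos_geN1.
rewrite integral_mkcond.
rewrite (@ge0_integral_rV_insert _ _ i); last 2 first.
- apply/(measurable_restrictT _ _).1; first exact: measurable_unit_cube.
  exact: measurable_funS mf.
- by move=> x; rewrite patchE; case: ifP.
transitivity (\int[lebesgue_rV n]_y (\1_(@unit_cube R n) y : R)%:E); last first.
  rewrite integral_indic//; last exact: measurable_unit_cube.
  by rewrite setIT; exact: lebesgue_rV_cube.
apply: eq_integral => y _; rewrite indicE.
have cubeE t : (rV_insert i t y \in @unit_cube R n.+1) =
    (t \in `[0%R, 1%R[%classic) && (y \in unit_cube).
  apply/idP/andP => [/set_mem Ix|[/set_mem It /set_mem Iy]].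
    split; apply/mem_set.
      by have := Ix i; rewrite mxE unlift_none /= in_itv.
    by move=> j; have := Ix (lift i j); rewrite mxE liftK.
  by apply/mem_set => j; rewrite mxE; case: unliftP => [k|] _ //=; move: It; rewrite /= in_itv.
have [yc|yc] := boolP (y \in unit_cube); last first.
  by apply: integral0_eq => t _; rewrite patchE cubeE (negbTE yc) andbF.
rewrite -(@integral_cos_period _ (q 0%R i) (2 * pi * (\sum_k (rV_int q) 0%R (lift i k) * y 0%R k) + c)%R)//.
rewrite [RHS]integral_mkcond; apply: eq_integral => t _.
rewrite !patchE cubeE yc andbT; case: ifP => // _.
by rewrite /f dot_insert mxE; congr EFin; congr (_ + cos _)%R; ring.
Qed.
End integral_cube_cos.

(** * Measures determined by continuous test functions *)

Section test_functions.
Context {R : realType} {n : nat}.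
Local Notation V := 'rV[R]_n.

(** The functions are min(1, m d), with d the distance to the complement of [O]; a point outside [O]
    makes d a genuine infimum. *)
Lemma open_bump (O : set V) : open O -> ~` O !=set0 ->
  exists phi : nat -> V -> R,
   [/\ forall m, continuous (phi m), forall m x, 0 <= phi m x <= 1,
       forall m x, ~ O x -> phi m x = 0,
       forall x, {homo phi ^~ x : i j / (i <= j)%N >-> i <= j} &
       forall x, O x -> phi ^~ x @ \oo --> (1 : R)].
Proof.
move=> oO [z Oz].
pose D x : set R := [set `|x - y| | y in ~` O].
have D0 x : has_inf (D x).
  split; first by exists `|x - z|, z.
  by exists 0 => _ [y _ <-].
pose d x := inf (D x).
have d0 x : 0 <= d x by apply: lb_le_inf; [exact: (D0 x).1|move=> _ [y _ <-]].
have dlip x x' : d x <= `|x - x'| + d x'.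
  rewrite -lerBlDl; apply: lb_le_inf; first exact: (D0 x').1.
  move=> _ [y Oy <-]; rewrite lerBlDl.
  apply: (@le_trans _ _ `|x - y|); last exact: ler_distD.
  by apply: ge_inf; [exact: (D0 x).2|exists y].
have cd : continuous d.
  move=> x; apply/(@cvgrPdist_le R R V (nbhs x) (nbhs_filter x)) => e e0.
  near=> y; rewrite ler_norml; apply/andP; split.
    rewrite lerBrDr addrC lerBlDr (le_trans (dlip _ x))// addrC lerD2l distrC.
    by near: y; apply: (@cvgr_dist_le R V V (nbhs x) (nbhs_filter x) id x) => //.
  rewrite lerBlDr (le_trans (dlip _ y))// lerD2r.
  by near: y; apply: (@cvgr_dist_le R V V (nbhs x) (nbhs_filter x) id x) => //.
exists (fun m x => Num.min 1 (m%:R * d x)); split.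
- move=> m x; apply: (@continuous_min R V (fun=> 1) (fun x => m%:R * d x)); first exact: cst_continuous.
  by apply: continuousM; [exact: cst_continuous|exact: cd].
- by move=> m x; rewrite le_min ler01 mulr_ge0// ge_min lexx.
- move=> m x Ox; suff -> : d x = 0 by rewrite mulr0 min_r.
  apply/eqP; rewrite eq_le d0 andbT.
  by apply: ge_inf; [exact: (D0 x).2|exists x => //; rewrite subrr normr0].
- move=> x i j ij; rewrite le_min ge_min lexx /= ge_min.
  by rewrite ler_wpM2r ?ler_nat// orbT.
- move=> x Ox.
  have dx : 0 < d x.
    have /nbhs_ballP[e /= e0 eO] : nbhs x O by exact: open_nbhs_nbhs.
    apply: (lt_le_trans e0); apply: lb_le_inf; first exact: (D0 x).1.
    move=> _ [y Oy <-]; rewrite leNgt; apply/negP => xy; apply: Oy; apply: eO.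
    by rewrite -ball_normE.
  apply: cvg_near_cst; near=> m.
  apply/min_idPl; rewrite -ler_pdivrMr// ?mul1r.
  by near: m; exact: nbhs_infty_ger.
Unshelve. all: by end_near. Qed.

Lemma measure_eq_open (nu1 nu2 : {measure set V -> \bar R}) (O : set V) :
  open O -> ~` O !=set0 ->
  (forall phi : V -> R, continuous phi -> (forall x, 0 <= phi x <= 1)%R ->
    (forall x, ~ O x -> phi x = 0%R) ->
    \int[nu1]_x (phi x)%:E = \int[nu2]_x (phi x)%:E)%E ->
  nu1 O = nu2 O.
Proof.
move=> oO /(open_bump oO)[phi [cphi phi0 phiO ndphi phi1]] H.
have mO := measurable_rV_open oO.
suff E (nu : {measure set V -> \bar R}) :
    nu O = limn (fun m => \int[nu]_x (phi m x)%:E)%E.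
  by rewrite !E; congr (limn _); apply/funext => m; apply: H => //; exact: phiO.
rewrite -[in LHS](setIT O) -integral_indic//.
rewrite -monotone_convergence//.
- apply: eq_integral => x _; apply/esym/cvg_lim => //; apply: cvg_EFin.
    by apply: nearW => m.
  rewrite indicE; have [/set_mem Ox|Ox] := boolP (x \in O); first exact: phi1.
  rewrite (_ : _ \o _ = cst 0); first exact: cvg_cst.
  by apply/funext => m; rewrite /= phiO// => Ox'; move: Ox; rewrite mem_set.
- move=> m; apply/measurable_EFinP; exact: continuous_measurable_rV.
- by move=> m x _; rewrite lee_fin; case/andP: (phi0 m x).
- by move=> x _ i j ij; rewrite lee_fin; exact: ndphi.
Qed.

(** The test functions give equality on the open subsets of [W], a family stable under intersection
    that generates the measurable ones; finiteness of [nu1 W] makes the uniqueness theorem for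
    measures applicable. *)
Lemma measure_eq_sub (nu1 nu2 : {measure set V -> \bar R}) (W : set V) :
  open W -> ~` W !=set0 -> (nu1 W < +oo)%E ->
  (forall phi : V -> R, continuous phi -> (forall x, 0 <= phi x <= 1)%R ->
    (forall x, ~ W x -> phi x = 0%R) ->
    \int[nu1]_x (phi x)%:E = \int[nu2]_x (phi x)%:E)%E ->
  forall A, measurable A -> A `<=` W -> nu1 A = nu2 A.
Proof.
move=> oW W0 nuW H A mA AW.
have mW := measurable_rV_open oW.
rewrite -(setIidl AW) -[LHS]/(mrestr nu1 mW A) -[RHS]/(mrestr nu2 mW A).
apply: (measure_unique (@open V) (fun=> setT)) => //.
- exact: rV_measurableE.
- by move=> B B'; exact: openI.
- by move=> _; exact: openT.
- by rewrite bigcup_const.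
- move=> B oB; rewrite /mrestr/=; apply: (@measure_eq_open nu1 nu2 (B `&` W)).
  + apply: (@openI V) => //.
  + by case: W0 => x Wx; exists x => -[_].
  + move=> phi cphi phi0 phiBW; apply: H => // x Wx; apply: phiBW => -[_]; exact: Wx.
- by move=> _; move: nuW; rewrite -{1}(setTI W).
Qed.

(** Local equality propagates by countable additivity: the part of [S] in [A] is covered by those of
    the countably many balls with rational centre and radius 1 / (k + 1) on which the measures
    agree, made disjoint by [seqDU]. *)
Lemma measure_eq_local (nu1 nu2 : {measure set V -> \bar R}) (S U : set V) :
  measurable S -> nu1 (~` S) = 0%E -> nu2 (~` S) = 0%E ->
  (forall x, S x -> U x -> exists2 e : R, 0 < e & forall A, measurable A ->
     A `<=` ball x e -> A `<=` U -> nu1 A = nu2 A) ->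
  forall A, measurable A -> A `<=` U -> nu1 A = nu2 A.
Proof.
move=> mS nu1S nu2S H A mA AU.
pose c (q : 'rV[rat]_n * nat) : set V :=
  ball (map_mx (ratr : rat -> R) q.1) (q.2.+1%:R^-1).
pose good q := forall B, measurable B -> B `<=` c q -> B `<=` U -> nu1 B = nu2 B.
pose F k := if pickle_inv k is Some q then if `[< good q >] then c q else set0 else set0.
have mc q : measurable (c q) by apply: measurable_rV_ball; rewrite invr_gt0.
have mF k : measurable (F k).
  by rewrite /F; case: pickle_inv => [q|//]; case: ifP.
have cover : A `&` S `<=` \bigcup_k F k.
  move=> x [Ax Sx]; have [e e0 eH] := H x Sx (AU _ Ax).
  have [k ke] : exists k : nat, (k.+1%:R^-1 : R) < e / 2.
    have /ltr_add_invr[k] : 0 < e / 2 by rewrite divr_gt0.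
    by rewrite add0r => ?; exists k.
  have k0 : (0 : R) < k.+1%:R^-1 by rewrite invr_gt0 ltr0n.
  have /choice[q xq] (j : 'I_n) : exists q : rat, `|x 0 j - ratr q| < k.+1%:R^-1.
    have /rat_in_itvoo[q] : x 0 j - k.+1%:R^-1 < x 0 j + k.+1%:R^-1.
      by rewrite ltrBlDr -addrA ltrDl addr_gt0.
    rewrite in_itv/= => /andP[q1 q2]; exists q.
    by rewrite ltr_distlC q1 q2.
  have cx : c (\row_j q j, k) x.
    by split=> // i j; rewrite ord1 !mxE -ball_normE /= distrC xq.
  exists (choice.pickle (\row_j q j, k)) => //; rewrite /F pickleK_inv.
  suff -> : `[< good (\row_j q j, k) >] by [].
  apply/asboolP => B mB Bc BU; apply: eH => // y /Bc cy.
  rewrite [e]splitr.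
  apply: (@le_ball _ _ _ (k.+1%:R^-1 + k.+1%:R^-1)); first by rewrite lerD// ltW.
  by apply: ball_triangle cy; exact: ball_sym.
have AE (nu : {measure set V -> \bar R}) : nu (~` S) = 0%E ->
    nu A = (\sum_(0 <= k <oo) nu (A `&` S `&` seqDU F k))%E.
  move=> nuS.
  have -> : nu A = nu (A `&` S).
    rewrite -[in LHS](setUIDK A S) measureU0//; first exact: measurableI.
      exact: measurableD.
    by apply: (subset_measure0 _ (measurableC mS) _ nuS);
      [exact: measurableD|move=> x []].
  rewrite -[in LHS](setIidl cover) (seqDU_bigcup_eq F) setI_bigcupr.
  rewrite measure_bigcup//=.
    by apply: eq_eseriesl => k; rewrite mem_set.
  - by move=> k _; apply: measurableI; [exact: measurableI|exact: seqDU_measurable].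
  - by apply: trivIset_setIl; exact: trivIset_seqDU.
rewrite (AE nu1 nu1S) (AE nu2 nu2S); apply: eq_eseriesr => k _.
have mASF : measurable (A `&` S `&` seqDU F k).
  by apply: measurableI; [exact: measurableI|exact: seqDU_measurable].
have := @subset_seqDU _ F k; rewrite {2}/F.
case: pickle_inv => [q|] sF; last first.
  by move: sF; rewrite subset0 => ->; rewrite setI0 !measure0.
move: sF; case: asboolP => [gq|_] sF.
  apply: gq => //; first by move=> x [_ /sF].
  by move=> x [[/AU]].
by move: sF; rewrite subset0 => ->; rewrite setI0 !measure0.
Qed.
End test_functions.

(** * Poisson approximation of level sets *)

Section poisson_kernel.
Context {R : realType}.
Local Notation mu := lebesgue_measure.
Implicit Types d u : R.

(** An approximate Dirac mass whose primitive is an arctangent, so that its mass along an interval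
    is explicit. *)
Definition poisson d u : R := d / (pi * (d ^+ 2 + u ^+ 2)).

Lemma poisson_den_gt0 d u : 0 < d -> 0 < pi * (d ^+ 2 + u ^+ 2).
Proof. by move=> d0; rewrite mulr_gt0 ?pi_gt0// ltr_wpDr ?sqr_ge0 ?exprn_gt0. Qed.

Lemma poisson_ge0 d u : 0 < d -> 0 <= poisson d u.
Proof. by move=> d0; rewrite divr_ge0// ltW// poisson_den_gt0. Qed.

(** The kernel is not compactly supported, but any error of order [u ^+ 2] is killed as [d] tends to
    0. *)
Lemma poisson_sqr d u : 0 < d -> u ^+ 2 * poisson d u <= d / pi.
Proof.
move=> d0; rewrite /poisson mulrA ler_pdivrMr ?poisson_den_gt0//.
rewrite mulrA divfK ?gt_eqF ?pi_gt0// [X in X <= _]mulrC ler_pM2l// lerDr.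
exact: sqr_ge0.
Qed.

Lemma continuous_poisson d : 0 < d -> continuous (poisson d).
Proof.
move=> d0 u; apply: (@continuousM R R (fun=> d) (fun u => (pi * (d ^+ 2 + u ^+ 2))^-1)).
  exact: cst_continuous.
apply: (@continuousV R R (fun u => pi * (d ^+ 2 + u ^+ 2))).
  by rewrite gt_eqF ?poisson_den_gt0.
apply: (@continuousM R R (fun=> pi) (fun u => d ^+ 2 + u ^+ 2)); first exact: cst_continuous.
apply: (@continuousD _ R R (fun=> d ^+ 2) (fun u => u ^+ 2)); first exact: cst_continuous.
exact: exprn_continuous.
Qed.

Variables (r r' : R -> R).
Hypothesis dr : forall t, is_derive t (1 : R) r (r' t).
Hypothesis cr' : continuous r'.

Lemma is_derive_continuous : continuous r.
Proof.
move=> t; apply/differentiable_continuous/derivable1_diffP.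
by have [] := dr t.
Qed.

Lemma is_derive_poisson d t : 0 < d ->
  is_derive t (1 : R) (fun t => pi^-1 * atan (d^-1 * r t)) (r' t * poisson d (r t)).
Proof.
move=> d0.
have -> : r' t * poisson d (r t) =
    pi^-1 * ((1 + (d^-1 * r t) ^+ 2)^-1 * (d^-1 * r' t)).
  rewrite /poisson exprMn; have : (pi : R) != 0 by rewrite gt_eqF// pi_gt0.
  move: (pi : R) => P P0; field; rewrite P0 andbT gt_eqF//= gt_eqF//.
  by rewrite ltr_wpDr ?sqr_ge0 ?exprn_gt0.
by apply: is_deriveZ.
Qed.

Definition poisson_mass d a b : R := pi^-1 * (atan (d^-1 * r b) - atan (d^-1 * r a)).

Lemma integral_poisson d a b : 0 < d -> a <= b ->
  (\int[mu]_(t in `[a, b]) (r' t * poisson d (r t))%:E = (poisson_mass d a b)%:E)%E.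
Proof.
move=> d0 ab; rewrite /poisson_mass mulrBr.
apply: (@integral_is_derive _ _ (fun t => pi^-1 * atan (d^-1 * r t))) => //.
  by move=> t; exact: is_derive_poisson.
move=> t; apply: (@continuousM R R r' (poisson d \o r)); first exact: cr'.
by apply: continuous_comp; [exact: is_derive_continuous|exact: continuous_poisson].
Qed.

Lemma poisson_mass_le1 d a b : poisson_mass d a b <= 1.
Proof.
rewrite /poisson_mass mulrC ler_pdivrMr ?pi_gt0// mul1r.
have := atan_ltpi2 (d^-1 * r b); have := atan_gtNpi2 (d^-1 * r a); lra.
Qed.

Lemma poisson_mass_ge0 d a b : 0 < d -> r a <= r b -> 0 <= poisson_mass d a b.
Proof.
move=> d0 rab; rewrite mulr_ge0 ?invr_ge0 ?pi_ge0// subr_ge0.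
by apply: (ltW_homo (@lt_atan R)); rewrite ler_wpM2l// invr_ge0 ltW.
Qed.

Lemma poisson_mass_cvg a b : r a < 0 -> 0 < r b ->
  poisson_mass k.+1%:R^-1 a b @[k --> \oo] --> (1 : R).
Proof.
move=> ra rb.
have cvginv (c : R) : 0 < c -> (k.+1%:R^-1)^-1 * c @[k --> \oo] --> +oo.
  move=> c0; apply/cvgryPge => A; near=> k; rewrite invrK -ler_pdivrMr//.
  apply: (@le_trans _ _ (k%:R)); last by rewrite ler_nat.
  by near: k; exact: nbhs_infty_ger.
have h1 : atan (k.+1%:R^-1^-1 * r b) @[k --> \oo] --> pi / 2.
  by apply: cvg_comp (cvginv _ rb) _; exact: cvgy_atan.
have h2 : atan (k.+1%:R^-1^-1 * r a) @[k --> \oo] --> - (pi / 2).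
  have /cvginv ra' : 0 < - r a by rewrite oppr_gt0.
  rewrite (_ : (fun k => _) = (fun k => - atan (k.+1%:R^-1^-1 * - r a))); last first.
    by apply/funext => k; rewrite mulrN atanN opprK.
  by apply: cvgN; apply: cvg_comp ra' _; exact: cvgy_atan.
rewrite [X in _ --> X](_ : 1 = pi^-1 * (pi / 2 - - (pi / 2))); last first.
  by rewrite opprK -splitr mulVf// gt_eqF// pi_gt0.
by apply: cvgM; [exact: cvg_cst|exact: cvgB].
Unshelve. all: by end_near. Qed.

Variables (a b : R).
Hypothesis ab : a <= b.
Hypothesis r'0 : forall t, a <= t <= b -> 0 < r' t.

Lemma is_derive_gt0_lt s t : a <= s -> s < t -> t <= b -> r s < r t.
Proof.
move=> as_ st tb.
have [c /[!in_itv]/= /andP[sc ct] E] : exists2 c, c \in `]s, t[%R & r t - r s = r' c * (t - s).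
  apply: (@MVT R r r') => //.
  by apply: continuous_subspaceT; exact: is_derive_continuous.
rewrite -subr_gt0 E mulr_gt0 ?subr_gt0// r'0//.
by rewrite (le_trans as_ (ltW sc)) (le_trans (ltW ct) tb).
Qed.

Lemma r_ab : r a <= r b.
Proof.
have := ab; rewrite le_eqVlt => /orP[/eqP->//|lab].
by rewrite ltW// is_derive_gt0_lt.
Qed.

Variables (q : R -> R).
Hypothesis q0 : forall t, a <= t <= b -> 0 <= q t.
Hypothesis cq : forall t, a <= t <= b -> {for t, continuous q}.

Let rp d t := r' t * poisson d (r t).

Let crp d : 0 < d -> continuous (rp d).
Proof.
move=> d0 t; apply: (@continuousM R R r' (poisson d \o r)); first exact: cr'.
by apply: continuous_comp; [exact: is_derive_continuous|exact: continuous_poisson].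
Qed.

Let mrp d : 0 < d -> measurable_fun `[a, b] (rp d).
Proof.
by move=> d0; apply: measurable_funS (continuous_measurable_fun (crp d0)).
Qed.

Let rp0 d t : 0 < d -> a <= t <= b -> 0 <= rp d t.
Proof. by move=> d0 tab; rewrite mulr_ge0 ?poisson_ge0// ltW// r'0. Qed.

Let mq : measurable_fun `[a, b] q.
Proof.
apply: subspace_continuous_measurable_fun => //.
apply: continuous_in_subspaceT => t; rewrite inE /= in_itv /= => tab.
exact: cq.
Qed.

Lemma integral_poisson_le (B d : R) : 0 < d -> (forall t, a <= t <= b -> q t <= B) ->
  (\int[mu]_(t in `[a, b]) (q t * rp d t)%:E <= B%:E)%E.
Proof.
move=> d0 qB.
have B0 : 0 <= B by rewrite (le_trans (q0 _) (qB a _))// lexx ab.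
apply: (@le_trans _ _ (\int[mu]_(t in `[a, b]) (B * rp d t)%:E)%E).
  apply: ge0_le_integral => //.
  - by move=> t; rewrite /= in_itv /= => tab; rewrite lee_fin mulr_ge0 ?q0 ?rp0.
  - by apply/measurable_EFinP/measurable_funM => //; exact: mrp.
  - by apply/measurable_EFinP/measurable_funM => //; exact: mrp.
  - by move=> t; rewrite /= in_itv /= => tab; rewrite lee_fin ler_wpM2r ?rp0 ?qB.
under eq_integral do rewrite EFinM.
rewrite ge0_integralZl//; last 2 first.
- by apply/measurable_EFinP; exact: mrp.
- by move=> t; rewrite /= in_itv /= => tab; rewrite lee_fin rp0.
rewrite integral_poisson// -EFinM lee_fin -[leRHS]mulr1 ler_wpM2l//.
exact: poisson_mass_le1.
Qed.

(** The excess of [|q - L|] over [e] vanishes near every zero of [r], so its quotient by the square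
    of [r] is continuous, with 0 / 0 = 0 at the zeros, and [M] is its maximum on the compact
    interval. *)
Lemma continuous_near_levelset (L e : R) : 0 < e ->
  (forall t, a <= t <= b -> r t = 0 -> q t = L) ->
  exists2 M, 0 <= M & forall t, a <= t <= b -> `|q t - L| <= e + M * (r t) ^+ 2.
Proof.
move=> e0 qL.
pose h t := Num.max 0 (`|q t - L| - e) / (r t) ^+ 2.
have ch : {within `[a, b], continuous h}.
  apply: continuous_in_subspaceT => t; rewrite inE /= in_itv /= => tab.
  have cmax : {for t, continuous (fun t => Num.max 0 (`|q t - L| - e))}.
    apply: (@continuous_max R R (fun=> 0) (fun t => `|q t - L| - e)).
      exact: cst_continuous.
    apply: (@continuousB _ R R (fun t => `|q t - L|) (fun=> e)).
      apply: (@continuous_comp _ _ _ (fun t => q t - L) Num.norm).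
        by apply: continuousB; [exact: cq|exact: cst_continuous].
      exact: norm_continuous.
    exact: cst_continuous.
  have [rt0|rt0] := eqVneq (r t) 0.
    have h0 : h t = 0 by rewrite /h (qL _ tab rt0) subrr normr0 sub0r max_l ?mul0r// oppr_le0 ltW.
    rewrite /continuous_at h0; apply: cvg_near_cst.
    have : \forall s \near t, `|q t - q s| < e.
      by have /cvgrPdist_lt := cq tab; apply.
    rewrite (qL _ tab rt0); apply: filterS => s; rewrite distrC => qs.
    by rewrite /h max_l ?mul0r// subr_le0 ltW.
  apply: (@continuousM R R (fun t => Num.max 0 (`|q t - L| - e)) (fun t => (r t ^+ 2)^-1)) => //.
  apply: (@continuousV R R (fun t => r t ^+ 2)); first by rewrite expf_neq0.
  apply: (@continuous_comp _ _ _ r (fun u => u ^+ 2)); first exact: is_derive_continuous.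
  exact: exprn_continuous.
have [c cab hc] := EVT_max ab ch.
exists (h c); first by rewrite divr_ge0 ?sqr_ge0// le_max lexx.
move=> t tab.
have [rt0|rt0] := eqVneq (r t) 0.
  by rewrite rt0 expr0n mulr0 addr0 (qL _ tab rt0) subrr normr0 ltW.
have := hc t; rewrite in_itv /= => /(_ tab).
rewrite {1}/h ler_pdivrMr; last by rewrite exprn_even_gt0.
by move=> H; rewrite -lerBlDl; apply: le_trans H; rewrite le_max lexx orbT.
Qed.

Let integral_near_levelset (c0 c1 d : R) : 0 < d -> 0 <= c0 -> 0 <= c1 ->
  (\int[mu]_(t in `[a, b]) ((c0 + c1 * r t ^+ 2) * rp d t)%:E <=
   (c0 * poisson_mass d a b + c1 * (d / pi) * (r b - r a))%:E)%E.
Proof.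
move=> d0 c00 c10.
pose F t := c0 * (pi^-1 * atan (d^-1 * r t)) + (c1 * (d / pi)) * r t.
have -> : (c0 * poisson_mass d a b + c1 * (d / pi) * (r b - r a))%:E = (F b - F a)%:E.
  by rewrite /F /poisson_mass; congr EFin; ring.
have cr2 : continuous (fun t => r t ^+ 2).
  move=> t; apply: (@continuous_comp _ _ _ r (fun u => u ^+ 2)); first exact: is_derive_continuous.
  exact: exprn_continuous.
have cF : continuous (fun t => c0 * rp d t + c1 * (d / pi) * r' t).
  move=> t; apply: (@continuousD _ R R (fun t => c0 * rp d t) (fun t => c1 * (d / pi) * r' t)).
    by apply: (@continuousM R R (fun=> c0) (rp d)); [exact: cst_continuous|exact: crp].
  by apply: (@continuousM R R (fun=> c1 * (d / pi)) r'); [exact: cst_continuous|exact: cr'].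
have dF t : is_derive t (1 : R) F (c0 * rp d t + c1 * (d / pi) * r' t).
  apply: is_deriveD; first by apply: is_deriveZ; exact: is_derive_poisson.
rewrite -(integral_is_derive ab dF cF).
have pt t : a <= t <= b -> (c0 + c1 * r t ^+ 2) * rp d t <= c0 * rp d t + c1 * (d / pi) * r' t.
  move=> tab; rewrite mulrDl lerD2l /rp.
  rewrite (_ : c1 * r t ^+ 2 * _ = c1 * r' t * (r t ^+ 2 * poisson d (r t))); last by ring.
  rewrite (_ : c1 * (d / pi) * r' t = c1 * r' t * (d / pi)); last by rewrite mulrAC.
  by rewrite ler_wpM2l ?poisson_sqr// mulr_ge0// ltW// r'0.
apply: ge0_le_integral => //.
- move=> t; rewrite /= in_itv /= => tab; rewrite lee_fin mulr_ge0 ?rp0//.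
  by rewrite addr_ge0// mulr_ge0// sqr_ge0.
- apply/measurable_EFinP/measurable_funM; last exact: mrp.
  apply: measurable_funD => //; apply: measurable_funM => //.
  by apply: measurable_funS (continuous_measurable_fun cr2).
- by apply/measurable_EFinP; apply: measurable_funS (continuous_measurable_fun cF).
Qed.

(** In the last hypothesis, either the limit is 0 and the total mass does not matter, or [r] changes
    sign strictly inside the interval and the total mass tends to 1. *)
Lemma integral_poisson_cvg (L : R) : 0 <= L ->
  (forall t, a <= t <= b -> r t = 0 -> q t = L) ->
  L = 0 \/ r a < 0 /\ 0 < r b ->
  (\int[mu]_(t in `[a, b]) (q t * (r' t * poisson k.+1%:R^-1 (r t)))%:E)%E
    @[k --> \oo] --> L%:E.
Proof.
move=> L0 qL Lr.
pose d k : R := k.+1%:R^-1.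
have d0 k : 0 < d k by rewrite invr_gt0.
pose I k := (\int[mu]_(t in `[a, b]) (q t * rp (d k) t)%:E)%E.
have I0 k : (0 <= I k)%E.
  apply: integral_ge0 => t; rewrite /= in_itv /= => tab.
  by rewrite lee_fin mulr_ge0 ?q0 ?rp0.
(* From [q <= L + e + M * r ^+ 2] on the interval; by [poisson_sqr] the last term contributes only
   O([d k]). *)
have up e M k : 0 < e -> 0 <= M ->
    (forall t, a <= t <= b -> `|q t - L| <= e + M * (r t) ^+ 2) ->
    (I k <= ((L + e) * poisson_mass (d k) a b + M * (d k / pi) * (r b - r a))%:E)%E.
  move=> e0 M0 qM; apply: le_trans (integral_near_levelset (d0 k) _ M0); last first.
    by rewrite addr_ge0// ltW.
  have cr2 : continuous (fun t => r t ^+ 2).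
    move=> t; apply: (@continuous_comp _ _ _ r (fun u => u ^+ 2)); first exact: is_derive_continuous.
    exact: exprn_continuous.
  have pt t : a <= t <= b -> q t * rp (d k) t <= (L + e + M * r t ^+ 2) * rp (d k) t.
    move=> tab; rewrite ler_wpM2r ?rp0//.
    by have := ler_norm (q t - L); have := qM t tab; lra.
  apply: ge0_le_integral => //.
  - by move=> t; rewrite /= in_itv /= => tab; rewrite lee_fin mulr_ge0 ?q0 ?rp0.
  - by apply/measurable_EFinP/measurable_funM => //; exact: mrp.
  - apply/measurable_EFinP/measurable_funM; last exact: mrp.
    apply: measurable_funD => //; apply: measurable_funM => //.
    by apply: measurable_funS (continuous_measurable_fun cr2).
(* The lower bound is written with a sum on the right, to stay with integrals of non-negative
   functions. *)
have lo e M k : 0 < e -> 0 <= M ->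
    (forall t, a <= t <= b -> `|q t - L| <= e + M * (r t) ^+ 2) ->
    ((L * poisson_mass (d k) a b)%:E <=
     I k + (e * poisson_mass (d k) a b + M * (d k / pi) * (r b - r a))%:E)%E.
  move=> e0 M0 qM; apply: le_trans (leeD2l _ (integral_near_levelset (d0 k) (ltW e0) M0)).
  have cr2 : continuous (fun t => r t ^+ 2).
    move=> t; apply: (@continuous_comp _ _ _ r (fun u => u ^+ 2)); first exact: is_derive_continuous.
    exact: exprn_continuous.
  have m2 : measurable_fun `[a, b] (fun t => (e + M * r t ^+ 2) * rp (d k) t).
    apply/measurable_funM; last exact: mrp.
    apply: measurable_funD => //; apply: measurable_funM => //.
    by apply: measurable_funS (continuous_measurable_fun cr2).
  have m1 : measurable_fun `[a, b] (fun t => q t * rp (d k) t).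
    by apply: measurable_funM => //; exact: mrp.
  have p2 t : a <= t <= b -> 0 <= (e + M * r t ^+ 2) * rp (d k) t.
    move=> tab; apply: mulr_ge0; last exact: rp0.
    by apply: addr_ge0; [exact: ltW|apply: mulr_ge0 => //; exact: sqr_ge0].
  have n1 t : `[a, b]%classic t -> (0 <= (q t * rp (d k) t)%:E)%E.
    by rewrite /= in_itv /= => tab; rewrite lee_fin mulr_ge0 ?q0 ?rp0.
  have n2 t : `[a, b]%classic t -> (0 <= ((e + M * r t ^+ 2) * rp (d k) t)%:E)%E.
    by rewrite /= in_itv /= => tab; rewrite lee_fin p2.
  have n3 t : `[a, b]%classic t -> (0 <= (rp (d k) t)%:E)%E.
    by rewrite /= in_itv /= => tab; rewrite lee_fin rp0.
  have m1' : measurable_fun `[a, b] (fun t => (q t * rp (d k) t)%:E) by exact/measurable_EFinP.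
  have m2' : measurable_fun `[a, b] (fun t => ((e + M * r t ^+ 2) * rp (d k) t)%:E).
    exact/measurable_EFinP.
  have m3' : measurable_fun `[a, b] (fun t => (rp (d k) t)%:E).
    by apply/measurable_EFinP; exact: mrp.
  rewrite -ge0_integralD// EFinM -(integral_poisson (d0 k) ab).
  have L0' : (0 <= L%:E)%E by rewrite lee_fin.
  rewrite -ge0_integralZl//.
  have le t : `[a, b]%classic t -> (L%:E * (rp (d k) t)%:E <=
      (q t * rp (d k) t)%:E + ((e + M * r t ^+ 2) * rp (d k) t)%:E)%E.
    rewrite /= in_itv /= => tab; rewrite -EFinM -EFinD lee_fin -mulrDl.
    rewrite ler_wpM2r ?rp0//.
    by have := ler_norm (L - q t); rewrite distrC; have := qM t tab; lra.
  have n4 t : `[a, b]%classic t -> (0 <= L%:E * (rp (d k) t)%:E)%E.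
    by move=> /n3 h; exact: mule_ge0.
  apply: ge0_le_integral => //.
  - by apply/measurable_EFinP/measurable_funM => //; exact: mrp.
  - by apply/measurable_EFinP/measurable_funD.
have Ifin k : I k \is a fin_num.
  have [M M0 qM] := continuous_near_levelset ltr01 qL.
  by rewrite ge0_fin_numE// (le_lt_trans (up _ _ k ltr01 M0 qM))// ltry.
apply/fine_cvgP; split; first exact: nearW.
apply/cvgrPdist_le => e e0.
have e30 : 0 < e / 3 by rewrite divr_gt0.
have [M M0 qM] := continuous_near_levelset e30 qL.
have nL : \forall k \near \oo, `|L - L * poisson_mass (d k) a b| <= e / 3.
  case: Lr => [->|[ra rb]].
    by apply: nearW => k; rewrite mul0r subrr normr0 ltW.
  apply: (@cvgr_dist_le R R nat \oo _ (fun k => L * poisson_mass (d k) a b) L) => //.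
  rewrite -[X in _ --> X]mulr1.
  by apply: cvgM; [exact: cvg_cst|exact: (poisson_mass_cvg ra rb)].
near=> k; rewrite /= -/(I k).
have := up _ _ k e30 M0 qM; have := lo _ _ k e30 M0 qM.
rewrite -(fineK (Ifin k)) -EFinD !lee_fin.
have m1 := poisson_mass_le1 (d k) a b.
have m0 := poisson_mass_ge0 (d0 k) r_ab.
have hK : M * (d k / pi) * (r b - r a) <= e / 3.
  rewrite (_ : _ * _ = (M * (r b - r a) / pi) / k.+1%:R); last by rewrite /d; ring.
  rewrite ler_pdivrMr// [leRHS]mulrC -ler_pdivrMr//.
  apply: (@le_trans _ _ (k%:R)); last by rewrite ler_nat.
  by near: k; exact: nbhs_infty_ger.
have hL : `|L - L * poisson_mass (d k) a b| <= e / 3 by near: k.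
move: (fine (I k)) => x lo' up'.
have em : e / 3 * poisson_mass (d k) a b <= e / 3 by rewrite ler_piMr// ltW.
have Lm : L * poisson_mass (d k) a b <= L by rewrite ler_piMr.
move: hL; rewrite !ler_norml => /andP[].
move: m0 m1 em Lm lo' up'; rewrite mulrDl.
move: (L * poisson_mass _ _ _) (e / 3 * poisson_mass _ _ _) => Lp ep.
move: (M * _ * _) hK => K hK m0 m1 em Lm lo' up' h1 h2.
by rewrite /=; apply/andP; split; lra.
Unshelve. all: by end_near. Qed.
End poisson_kernel.

Section poisson_averaging.
Context {R : realType} {n : nat}.
Local Notation V := 'rV[R]_n.
Local Notation mu := lebesgue_measure.
Variables (f : V -> R) (G : V -> V) (w : V -> R) (v : V).
Hypothesis df : forall x t,
  is_derive t (1 : R) (fun t => f (x + t *: v)) (dot (G (x + t *: v)) v).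
Hypothesis cf : continuous f.
Hypothesis cG : continuous (fun x => dot (G x) v).
Hypothesis cw : continuous w.
Hypothesis w0 : forall x, 0 <= w x.
Hypothesis fv : forall x, f x != 0 -> f (x + v) != 0.
Hypothesis f_null : lebesgue_rV n [set x | f x = 0] = 0%E.
Variables (x0 : V) (e s B : R).
Hypothesis e0 : 0 < e.
Hypothesis s2 : s ^+ 2 = 1.
Hypothesis Gv0 : forall x, ball x0 (3 * e) x -> 0 < s * dot (G x) v.
Hypothesis wB : forall x, ball x0 (3 * e) x -> w x <= B * (s * dot (G x) v).
Variable phi : V -> R.
Hypothesis cphi : continuous phi.
Hypothesis phi01 : forall x, 0 <= phi x <= 1.
Hypothesis phi_ball : forall x, ~ ball x0 e x -> phi x = 0.

Let F k x := phi x * w x * poisson k.+1%:R^-1 (f x).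

Let F0 k x : 0 <= F k x.
Proof.
apply: mulr_ge0; last by apply: poisson_ge0; rewrite invr_gt0.
by apply: mulr_ge0 => //; case/andP: (phi01 x).
Qed.

Let cF k : continuous (F k).
Proof.
move=> x; apply: (@continuousM R V (fun x => phi x * w x) (fun x => poisson k.+1%:R^-1 (f x))).
  by apply: continuousM; [exact: cphi|exact: cw].
by apply: continuous_comp; [exact: cf|apply: continuous_poisson; rewrite invr_gt0].
Qed.

Let inner k x := (\int[mu]_(t in `[0%R, 1%R]) (F k (x + t *: v))%:E)%E.

Let v_neq0 : 0 < `|v|.
Proof.
rewrite normr_gt0; apply/eqP => v0.
have := Gv0 (ballxx x0 (mulr_gt0 (ltr0Sn R 2) e0)).
rewrite (_ : dot _ _ = 0) ?mulr0 ?ltxx// /dot big1// => j _.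
by rewrite v0 mxE mulr0.
Qed.

(** Two points of a line of direction [v] in the ball of radius [e] have parameters less than [h]
    apart. *)
Let h := 2 * e / `|v|.

Let continuous_line (g : V -> R) x : continuous g -> continuous (fun t : R => g (x + t *: v)).
Proof.
move=> cg t; apply: (@continuous_comp R V R (fun t : R => x + t *: v) g t); last exact: cg.
apply: continuousD; first exact: cst_continuous.
exact: (@scalel_continuous R V v).
Qed.

Section line.
Variables (x : V) (t1 : R).
Hypothesis t101 : 0 <= t1 <= 1.
Hypothesis xt1 : ball x0 e (x + t1 *: v).
(** On the window from [a] to [b] the line stays in the ball of radius [3 * e], where its slope is
    controlled; elsewhere in [0, 1] [phi] vanishes along it. *)
Let a := Num.max 0 (t1 - h).
Let b := Num.min 1 (t1 + h).

Let h0 : 0 < h. Proof. by rewrite /h divr_gt0 ?mulr_gt0. Qed.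

Let a_t1 : a <= t1. Proof. by rewrite ge_max; move: t101 h0; lra. Qed.
Let t1_b : t1 <= b. Proof. by rewrite le_min; move: t101 h0; lra. Qed.
Let ab : a <= b. Proof. exact: le_trans t1_b. Qed.
Let ab01 t : a <= t <= b -> 0 <= t <= 1.
Proof. by rewrite ge_max le_min; lra. Qed.

Let in_ball t : a <= t <= b -> ball x0 (3 * e) (x + t *: v).
Proof.
rewrite ge_max le_min => tab.
have tt1 : `|t1 - t| <= h by rewrite ler_norml; lra.
move: xt1; rewrite -!ball_normE /= => xt1'.
rewrite (_ : x0 - _ = x0 - (x + t1 *: v) + (t1 - t) *: v); last first.
  by rewrite scalerBl !opprD !addrA subrK.
apply: (le_lt_trans (ler_normD _ _)); rewrite normrZ.
have : `|t1 - t| * `|v| <= 2 * e by rewrite -ler_pdivlMr.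
by move: xt1'; lra.
Qed.

Let out_ball t : 0 <= t <= 1 -> ~ (a <= t <= b) -> phi (x + t *: v) = 0.
Proof.
move=> t01 tab; apply: phi_ball; rewrite -ball_normE /= => xt.
apply: tab; rewrite ge_max le_min.
have : `|t - t1| * `|v| < 2 * e.
  rewrite -normrZ scalerBl.
  rewrite (_ : _ - _ = (x0 - (x + t1 *: v)) - (x0 - (x + t *: v))); last first.
    by rewrite opprB [RHS]addrC subrKA opprD addrACA subrr add0r.
  apply: (le_lt_trans (ler_normB _ _)).
  by move: xt1; rewrite -ball_normE /= => xt1'; lra.
by rewrite -ltr_pdivlMr// ltr_norml; move: t01; rewrite -/h; lra.
Qed.

(** The sign [s] orients the line so that [r] increases; dividing by [r'] in [q] gives the integrand
    the form treated by [integral_poisson_cvg]. *)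
Let r t := s * f (x + t *: v).
Let r' t := s * dot (G (x + t *: v)) v.
Let q t := phi (x + t *: v) * w (x + t *: v) / r' t.

Let dr t : is_derive t (1 : R) r (r' t).
Proof. exact: is_deriveZ. Qed.

Let cr' : continuous r'.
Proof.
move=> t; apply: (@continuousM R R (fun=> s) (fun t => dot (G (x + t *: v)) v)).
  exact: cst_continuous.
exact: (@continuous_line (fun x => dot (G x) v)).
Qed.

Let r'0 t : a <= t <= b -> 0 < r' t.
Proof. by move=> tab; apply: Gv0; exact: in_ball. Qed.

Let q0 t : a <= t <= b -> 0 <= q t.
Proof.
move=> tab; apply: divr_ge0; last exact/ltW/r'0.
by apply: mulr_ge0 => //; case/andP: (phi01 (x + t *: v)).
Qed.

Let cq t : a <= t <= b -> {for t, continuous q}.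
Proof.
move=> tab.
apply: (@continuousM R R (fun t => phi (x + t *: v) * w (x + t *: v)) (fun t => (r' t)^-1)).
  by apply: (@continuous_line (fun y => phi y * w y)) => y; apply: continuousM; [exact: cphi|exact: cw].
by apply: continuousV; [rewrite gt_eqF// r'0|exact: cr'].
Qed.

Let innerE k : inner k x =
  (\int[mu]_(t in `[a, b]) (q t * (r' t * poisson k.+1%:R^-1 (r t)))%:E)%E.
Proof.
rewrite /inner integral_mkcond [RHS]integral_mkcond; apply: eq_integral => t _.
rewrite !patchE; have [tab|tab] := boolP (t \in `[a, b]%classic).
  have tab' : a <= t <= b by move: tab; rewrite inE /= in_itv.
  rewrite mem_set; last by rewrite /= in_itv /= ab01.
  congr EFin; rewrite /F /q mulrA divfK; last by rewrite gt_eqF// r'0.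
  by congr (_ * _); rewrite /r /poisson exprMn s2 mul1r.
case: ifPn => // t01; have t01' : 0 <= t <= 1 by move: t01; rewrite inE /= in_itv.
rewrite /F out_ball ?mul0r//; apply/negP; apply: contra tab => tab.
by rewrite inE /= in_itv.
Qed.

Let inner_le k : (inner k x <= B%:E)%E.
Proof.
rewrite innerE; apply: (integral_poisson_le dr cr' ab r'0 q0 cq).
  by rewrite invr_gt0.
move=> t tab; rewrite /q ler_pdivrMr; last exact: r'0.
apply: le_trans (wB (in_ball tab)).
by rewrite ler_piMl//; case/andP: (phi01 (x + t *: v)).
Qed.

Let inner_cvg0 : (forall t, 0 <= t <= 1 -> f (x + t *: v) = 0 -> phi (x + t *: v) = 0) ->
  inner k x @[k --> \oo] --> 0%E.
Proof.
move=> H; under eq_fun do rewrite innerE.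
apply: (integral_poisson_cvg dr cr' ab r'0 q0 cq (lexx 0)); last by left.
move=> t tab rt; rewrite /q H ?mul0r//; first exact: ab01.
apply/eqP; move/eqP: rt; rewrite mulf_eq0 => /orP[/eqP s0|//].
by move: s2; rewrite s0 expr0n /= => /esym/eqP; rewrite oner_eq0.
Qed.

Let inner_cvg : f x != 0 -> f (x + t1 *: v) = 0 -> inner k x @[k --> \oo] --> (q t1)%:E.
Proof.
move=> fx ft1; under eq_fun do rewrite innerE.
have rt1 : r t1 = 0 by rewrite /r ft1 mulr0.
(* A zero at an endpoint of [0, 1] would collect only half of the Poisson mass; [f x != 0] and [fv]
   exclude it. *)
have t10 : t1 != 0 by apply: contra_neq fx => t10; rewrite -ft1 t10 scale0r addr0.
have t11 : t1 != 1.
  by apply: contra_neq (fv fx) => t11; rewrite -ft1 t11 scale1r.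
have at1 : a < t1.
  by rewrite gt_max !lt_neqAle eq_sym t10; move: t101 h0; lra.
have t1b : t1 < b.
  by rewrite lt_min !lt_neqAle t11; move: t101 h0; lra.
have mono u u' : a <= u -> u < u' -> u' <= b -> r u < r u'.
  exact: (is_derive_gt0_lt dr r'0).
have qt1 : 0 <= q t1 by apply: q0; rewrite a_t1 t1_b.
apply: (integral_poisson_cvg dr cr' ab r'0 q0 cq qt1).
- move=> t /andP[at_ tb] rt; congr q; apply/eqP; rewrite eq_le !leNgt.
  apply/andP; split; apply/negP => tt1.
    by have := mono _ _ a_t1 tt1 tb; rewrite rt1 rt ltxx.
  by have := mono _ _ at_ tt1 t1_b; rewrite rt1 rt ltxx.
- by right; rewrite -rt1; split; apply: mono => //; exact: ltW.
Qed.

Lemma poisson_line : [/\ forall k, (inner k x <= B%:E)%E,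
  (forall t, 0 <= t <= 1 -> f (x + t *: v) = 0 -> phi (x + t *: v) = 0) ->
    inner k x @[k --> \oo] --> 0%E &
  f x != 0 -> f (x + t1 *: v) = 0 -> inner k x @[k --> \oo] -->
   (phi (x + t1 *: v) * w (x + t1 *: v) / `|dot (G (x + t1 *: v)) v|)%:E].
Proof.
split; [exact: inner_le|exact: inner_cvg0|move=> fx ft1].
suff -> : `|dot (G (x + t1 *: v)) v| = r' t1 by exact: inner_cvg.
rewrite /r'; have := r'0 (t := t1); rewrite a_t1 t1_b => /(_ isT); rewrite /r'.
move: (dot _ _) => g g0; rewrite -(gtr0_norm g0) normrM.
have /eqP := s2; rewrite sqrf_eq1 => /orP[]/eqP->; rewrite ?normrN normr1 mul1r//.
Qed.
End line.

Variable lim : V -> R.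
Hypothesis lim0 : forall x, f x != 0 ->
  (forall t, 0 <= t <= 1 -> f (x + t *: v) = 0 -> phi (x + t *: v) = 0) -> lim x = 0.
Hypothesis lim1 : forall x t, f x != 0 -> 0 <= t <= 1 -> f (x + t *: v) = 0 ->
  phi (x + t *: v) != 0 ->
  lim x = phi (x + t *: v) * w (x + t *: v) / `|dot (G (x + t *: v)) v|.

(* [\int F x dx = \int \int_0^1 F (x + t v) dt dx], and the inner integral is a
   one-dimensional Poisson approximation of a sum over zeros. *)
Lemma poisson_averaging :
  (\int[lebesgue_rV n]_x (phi x * w x * poisson k.+1%:R^-1 (f x))%:E)%E @[k --> \oo] -->
  (\int[lebesgue_rV n]_(x in ~` [set x | f x = 0%R]) (lim x)%:E)%E.
Proof.
set Z := [set x | f x = 0].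
have mZ : measurable Z.
  rewrite -[X in measurable X]setTI.
  exact: (continuous_measurable_rV cf measurableT (measurable_set1 0)).
have mFk k : measurable_fun setT (fun x => (F k x)%:E).
  by apply/measurable_EFinP; apply: continuous_measurable_rV; exact: cF.
have minner k : measurable_fun setT (inner k).
  by apply: (measurable_averaging v (mFk k)) => x; rewrite lee_fin.
have inner0 k x : (0 <= inner k x)%E.
  by apply: integral_ge0 => t _; rewrite lee_fin.
have -> : (fun k => \int[lebesgue_rV n]_x (phi x * w x * poisson k.+1%:R^-1 (f x))%:E)%E =
    (fun k => \int[lebesgue_rV n]_(x in ~` Z) inner k x)%E.
  apply/funext => k; rewrite (ge0_integral_averaging v (mFk k)); last first.
    by move=> x; rewrite lee_fin.
  rewrite -setTD; apply: (ge0_negligible_integral mZ measurableT (minner k) _ f_null).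
  by move=> x _; exact: inner0.
have trivial_line k x : ~ (exists2 t, 0 <= t <= 1 & ball x0 e (x + t *: v)) ->
    inner k x = 0%E.
  move=> H; apply: integral0_eq => t; rewrite /= in_itv /= => t01.
  by rewrite /F phi_ball ?mul0r// => xt; apply: H; exists t.
have B0 : 0 <= B.
  have bx := ballxx x0 (mulr_gt0 (ltr0Sn R 2) e0).
  by rewrite -(pmulr_lge0 _ (Gv0 bx)) (le_trans _ (wB bx)).
(* Each inner integral is at most [B], and it vanishes unless [x] is within [e + |v|] of [x0], since
   the segment from [x] to [x + v] has to meet the small ball. *)
apply: (@dominated_cvg _ _ _ (lebesgue_rV n) (~` Z) (measurableC mZ) inner (EFin \o lim)
  (fun x => (B%:E * (\1_(ball x0 (e + `|v|)) x)%:E)%E)).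
- by move=> k; apply: measurable_funS (minner k).
- move=> x fx; have fx' : f x != 0 by apply/eqP.
  have [[t t01 xt]|H] := pselect (exists2 t, 0 <= t <= 1 & ball x0 e (x + t *: v)); last first.
    rewrite (_ : (fun k => inner k x) = cst 0%E); last first.
      by apply/funext => k; exact: trivial_line.
    rewrite /= lim0//; first exact: cvg_cst.
    by move=> t t01 _; apply: phi_ball => xt; apply: H; exists t.
  have [[u u01 [fu pu]]|H] := pselect (exists2 u, 0 <= u <= 1 &
      f (x + u *: v) = 0 /\ phi (x + u *: v) != 0).
    rewrite /= (lim1 fx' u01 fu pu).
    have xu : ball x0 e (x + u *: v).
      by apply: contrapT => /phi_ball/eqP; rewrite (negbTE pu).
    by have [_ _ H] := poisson_line u01 xu; exact: H.
  have H' u : 0 <= u <= 1 -> f (x + u *: v) = 0 -> phi (x + u *: v) = 0.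
    by move=> u01 fu; apply/eqP/negPn/negP => pu; apply: H; exists u.
  by rewrite /= lim0//; have [_ + _] := poisson_line t01 xt; exact.
- by move=> x _; rewrite -EFinM.
- have mball := @measurable_rV_ball R n x0 (e + `|v|) (addr_gt0 e0 v_neq0).
  have mind : measurable_fun (~` Z)
      (fun x => (\1_(ball x0 (e + `|v|)) x : R)%:E).
    by apply/measurable_EFinP; exact: measurable_indic.
  apply/integrableP; split; first exact: measurable_funeM.
  rewrite (eq_integral (fun x => B%:E * (\1_(ball x0 (e + `|v|)) x)%:E)%E); last first.
    by move=> x _; rewrite gee0_abs// mule_ge0// lee_fin.
  have mCZ := measurableC mZ.
  have ind0 x : (~` Z) x -> (0 <= (\1_(ball x0 (e + `|v|)) x : R)%:E)%E.
    by rewrite lee_fin.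
  have B0' : (0 <= B%:E)%E by rewrite lee_fin.
  rewrite (ge0_integralZl _ mCZ mind ind0 B0') integral_indic// lte_mul_pinfty//.
  apply: (le_lt_trans _ (lebesgue_rV_ball x0 (e + `|v|))).
  apply: le_measure; rewrite ?inE.
  - exact: measurableI.
  - exact: mball.
  - exact: subIsetl.
- move=> k x _; rewrite gee0_abs//.
  have [[t t01 xt]|H] := pselect (exists2 t, 0 <= t <= 1 & ball x0 e (x + t *: v)); last first.
    by rewrite trivial_line// mule_ge0// lee_fin.
  have [+ _ _] := poisson_line t01 xt.
  rewrite indicE mem_set ?mule1; first exact.
  move: xt; rewrite -!ball_normE /= => xt.
  rewrite (_ : x0 - x = (x0 - (x + t *: v)) + t *: v); last first.
    by rewrite opprD addrA subrK.
  rewrite (le_lt_trans (ler_normD _ _))// ltr_leD// normrZ.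
  by rewrite ler_piMl// ger0_norm//; case/andP: t01.
Qed.

End poisson_averaging.

(** * Complex exponentials and roots of polynomials *)

Section complex_exponential.
Local Open Scope complex_scope.
Context {R : realType}.
Implicit Types (z w : R[i]) (t : R).

Lemma cReD z w : complex.Re (z + w) = complex.Re z + complex.Re w.
Proof. by case: z w => [? ?] [? ?]. Qed.

Lemma cImD z w : complex.Im (z + w) = complex.Im z + complex.Im w.
Proof. by case: z w => [? ?] [? ?]. Qed.

Lemma cReM z w : complex.Re (z * w) =
  complex.Re z * complex.Re w - complex.Im z * complex.Im w.
Proof. by case: z w => [? ?] [? ?]. Qed.

Lemma cImM z w : complex.Im (z * w) =
  complex.Re z * complex.Im w + complex.Im z * complex.Re w.
Proof. by case: z w => [? ?] [? ?]. Qed.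

Lemma cRe_sum (I : Type) (r : seq I) (F : I -> R[i]) :
  complex.Re (\sum_(i <- r) F i) = \sum_(i <- r) complex.Re (F i).
Proof. by elim: r => [|i r IH]; rewrite ?big_nil// !big_cons cReD IH. Qed.

Lemma complex_eqP z w : complex.Re z = complex.Re w -> complex.Im z = complex.Im w -> z = w.
Proof. by case: z w => [? ?] [? ?] /= -> ->. Qed.

Lemma cexpD z w : cexp (z + w) = cexp z * cexp w.
Proof.
rewrite /cexp cReD cImD expRD cosD sinD.
by apply: complex_eqP; rewrite !(cReM, cImM) /=; ring.
Qed.

Lemma cexp0 : cexp (0 : R[i]) = 1.
Proof. by rewrite /cexp /= expR0 cos0 sin0 mul1r. Qed.

Lemma cexp_neq0 z : cexp z != 0.
Proof.
have : cexp z * cexp (- z) != 0 by rewrite -cexpD subrr cexp0 oner_eq0.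
by apply: contra_neq => ->; rewrite mul0r.
Qed.

Lemma cexpN z : cexp (- z) = (cexp z)^-1.
Proof. by apply: (mulfI (cexp_neq0 z)); rewrite -cexpD subrr cexp0 mulfV// cexp_neq0. Qed.

Lemma cexpMn z k : cexp (z *+ k) = cexp z ^+ k.
Proof. by elim: k => [|k IH]; rewrite ?mulr0n ?cexp0// mulrS exprS cexpD IH. Qed.

Lemma cexpMz z (k : int) : cexp (z *~ k) = cexp z ^ k.
Proof.
case: k => k; first by rewrite -pmulrn cexpMn.
by rewrite NegzE mulrNz cexpN -pmulrn cexpMn -exprnN.
Qed.

Lemma norm_cexp z : `|cexp z| = (expR (complex.Re z))%:C.
Proof.
rewrite normc_def; congr (_%:C).
rewrite /cexp !(cReM, cImM) /= !mul0r addr0 subr0 !exprMn -mulrDr cos2Dsin2 mulr1.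
by rewrite sqrtr_sqr ger0_norm// expR_ge0.
Qed.

Definition expi t : R[i] := cexp (0 +i* (2 * pi * t)).

Lemma expiE t : expi t = cos (2 * pi * t) +i* sin (2 * pi * t).
Proof. by rewrite /expi /cexp /= expR0 mul1r. Qed.

Lemma expiD s t : expi (s + t) = expi s * expi t.
Proof. by rewrite /expi -cexpD; congr cexp; apply: complex_eqP; rewrite /= ?addr0// mulrDr. Qed.

Lemma expi0 : expi 0 = 1.
Proof. by rewrite expiE mulr0 cos0 sin0. Qed.

Lemma expi_neq0 t : expi t != 0. Proof. exact: cexp_neq0. Qed.

Lemma expiN t : expi (- t) = (expi t)^-1.
Proof. by apply: (mulfI (expi_neq0 t)); rewrite -expiD subrr expi0 mulfV// expi_neq0. Qed.

Lemma expiMz t (k : int) : expi (t * k%:~R) = expi t ^ k.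
Proof.
rewrite /expi -cexpMz; congr cexp; rewrite -[2 * pi * t]/(complex.Im (0 +i* (2 * pi * t))).
have E (u : R) : (0 +i* u) *~ k = 0 +i* (u *~ k).
  case: k => k; rewrite ?NegzE ?mulrNz -?pmulrn.
    by elim: k => [|k IH]; rewrite ?mulr0n// !mulrS IH; simpc.
  elim: k => [|k IH]; first by rewrite !mulr1n; simpc.
  by rewrite mulrS opprD IH [in RHS]mulrS opprD; simpc.
by rewrite E /= -mulrzl -[in RHS]mulrzl; congr (_ +i* _); rewrite mulrCA mulrA -mulrA; ring.
Qed.

Lemma norm_expi t : `|expi t| = 1.
Proof. by rewrite norm_cexp /= expR0. Qed.

Lemma conj_expi t : (expi t)^* = expi (- t).
Proof. by rewrite !expiE mulrN cosN sinN. Qed.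

Lemma expiZ (k : int) : expi k%:~R = 1.
Proof.
rewrite expiE; have := cos2piZ k (0 : R); have := sin2piZ k (0 : R).
by rewrite !add0r => -> ->; rewrite cos0 sin0.
Qed.

Lemma expi_surj z : `|z| = 1 -> exists2 t, 0 <= t < 1 & expi t = z.
Proof.
case: z => c s; rewrite normc_def => -[] /= /(congr1 (fun x => x ^+ 2)).
rewrite expr1n sqr_sqrtr ?addr_ge0 ?sqr_ge0// => cs.
have cs1 : -1 <= c <= 1.
  by have s2 := sqr_ge0 s; apply/andP; split; nra.
have pi0 := @pi_gt0 R.
have [s0|s0] := leP 0 s.
  exists (acos c / (2 * pi)).
    have p2 : 0 < 2 * (pi : R) by rewrite mulr_gt0.
    apply/andP; split; first by rewrite divr_ge0 ?acos_ge0// ltW.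
    by rewrite ltr_pdivrMr// mul1r (le_lt_trans (acos_lepi cs1))//; lra.
  rewrite expiE mulrC divfK; last by rewrite mulf_neq0// gt_eqF.
  rewrite acosK// sin_acos//; congr (_ +i* _).
  by rewrite (_ : 1 - c ^+ 2 = s ^+ 2) ?sqrtr_sqr ?ger0_norm//; lra.
have c1 : c < 1.
  case/andP: cs1 => _; rewrite le_eqVlt => /orP[/eqP c1|//].
  by move: cs s0; rewrite c1; have := sqr_ge0 s; nra.
exists (1 - acos c / (2 * pi)).
  have a0 : 0 < acos c / (2 * pi) by rewrite divr_gt0 ?mulr_gt0 ?acos_gt0//; lra.
  have a1 : acos c / (2 * pi) < 1.
    rewrite ltr_pdivrMr ?mulr_gt0// mul1r.
    by rewrite (le_lt_trans (acos_lepi cs1))//; lra.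
  lra.
rewrite expiE mulrBr mulr1 [X in 2 * pi - X]mulrC divfK; last by rewrite mulf_neq0// gt_eqF.
rewrite addrC mulrC mulr_natr cosD2pi sinD2pi cosN sinN acosK// sin_acos//.
congr (_ +i* _).
by rewrite (_ : 1 - c ^+ 2 = s ^+ 2) ?sqrtr_sqr ?ltr0_norm ?opprK//; lra.
Qed.

Lemma expi_inj s t : 0 <= s < 1 -> 0 <= t < 1 -> expi s = expi t -> s = t.
Proof.
wlog st : s t / s <= t.
  by move=> H hs ht; case: (leP s t) => [|/ltW] le E; [apply: H|apply/esym; apply: H].
move=> s01 t01 E; have {}E : expi (t - s) = 1.
  by rewrite expiD expiN -E mulfV// expi_neq0.
apply/eqP; rewrite eq_le st /= leNgt; apply/negP => lst.
have pi0 := @pi_gt0 R.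
move: E; rewrite expiE => -[] C1 S1.
have h0 : 0 \in `[0, (pi : R)] by rewrite in_itv /= lexx ltW.
have [u1|u1] := leP (2 * (t - s)) 1.
  have : cos (2 * pi * (t - s)) < cos 0.
    have hx : 2 * pi * (t - s) \in `[0, (pi : R)] by rewrite in_itv /=; apply/andP; split; nra.
    by rewrite ltr_cos//; nra.
  by rewrite C1 cos0 ltxx.
have : cos (2 * pi * (t - s)) < cos 0.
  have -> : cos (2 * pi * (t - s)) = cos (2 * pi + - (2 * pi * (t - s))).
    by rewrite -[LHS]cosN -[LHS]cosD2pi; congr cos; rewrite mulr2n; ring.
  have hx : 2 * pi + - (2 * pi * (t - s)) \in `[0, (pi : R)].
    by rewrite in_itv /=; apply/andP; split; nra.
  have ts1 : 0 < 1 - (t - s) by lra.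
  have := mulr_gt0 pi0 ts1 => ?.
  by rewrite ltr_cos//; lra.
by rewrite C1 cos0 ltxx.
Qed.

Lemma cexp_surj z : z != 0 -> exists2 w, cexp w = z & `|z| = (expR (complex.Re w))%:C.
Proof.
move=> z0; have nz0 : 0 < complex.Re `|z|.
  by have := normr_gt0 z; rewrite z0 ltcE => /andP[].
have zE : `|z| = (complex.Re `|z|)%:C by rewrite RRe_real// normr_real.
have [t _ tz] : exists2 t, 0 <= t < 1 & expi t = z / `|z|.
  by apply: expi_surj; rewrite normrM normfV normr_id mulfV// normr_eq0.
exists ((ln (complex.Re `|z|)) +i* (2 * pi * t)).
  transitivity (expi t * `|z|); last by rewrite tz divfK// normr_eq0.
  rewrite zE /expi /cexp /= expR0 lnK ?posrE//.
  by apply: complex_eqP; rewrite !(cReM, cImM) /=; ring.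
by rewrite /= lnK ?posrE.
Qed.

End complex_exponential.

Section roots_of_polynomials.
Local Open Scope complex_scope.
Context {F : fieldType}.
Implicit Types (rs : seq F) (c z : F).

(** The Lagrange numerator at [z]: when [rs] has no repetition it vanishes at the other roots, and
    its value at [z] is the derivative of the full product. *)
Let L rs z : {poly F} := \prod_(y <- rem z rs) ('X - y%:P).

Let prodL rs z : z \in rs -> \prod_(y <- rs) ('X - y%:P) = ('X - z%:P) * L rs z.
Proof. by move=> zrs; rewrite (perm_big _ (perm_to_rem zrs)) big_cons. Qed.

Let LE rs z y : uniq rs -> z \in rs -> y \in rs -> (L rs z).[y] != 0 = (y == z).
Proof.
move=> urs zrs yrs; have -> : ((L rs z).[y] != 0) = (y \notin rem z rs).
  by rewrite -rootE root_prod_XsubC.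
by rewrite mem_rem_uniq// inE negb_and negbK yrs orbF.
Qed.

Let derivL rs c z : z \in rs ->
  (c *: \prod_(y <- rs) ('X - y%:P))^`().[z] = c * (L rs z).[z].
Proof.
move=> zrs; rewrite (prodL zrs) derivZ derivM hornerZ hornerD !hornerM.
by rewrite derivXsubC hornerXsubC subrr mul0r addr0 hornerC mul1r.
Qed.

Let size_L rs z : z \in rs -> size (L rs z) = size rs.
Proof.
by move=> zrs; rewrite size_prod_XsubC size_rem// prednK//; case: rs zrs.
Qed.

(* Lagrange interpolation of 'X^m at the roots, in degree (size rs).-1 *)
Lemma sum_expr_div_deriv rs c m : c != 0 -> uniq rs -> (m < size rs)%N ->
  \sum_(z <- rs) z ^+ m / (c *: \prod_(y <- rs) ('X - y%:P))^`().[z] =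
  (m == (size rs).-1)%:R / c.
Proof.
move=> c0 urs msz.
pose Q : {poly F} := \sum_(z <- rs) (z ^+ m / (L rs z).[z]) *: L rs z.
have sL z : z \in rs -> (L rs z).[z] != 0 by move=> zrs; rewrite LE// eqxx.
have QX : 'X^m - Q = 0.
  apply: (@roots_geq_poly_eq0 _ _ rs) => //.
    apply/allP => y yrs; rewrite rootE hornerD hornerN hornerXn.
    rewrite horner_sum (bigD1_seq y)//= hornerZ divfK ?sL// big_seq_cond big1.
      by rewrite addr0 subrr.
    move=> z /andP[zrs zy]; rewrite hornerZ.
    have := LE urs zrs yrs; rewrite (eq_sym y) (negbTE zy) => /negbFE/eqP->.
    by rewrite mulr0.
  apply: (leq_trans (size_polyD _ _)); rewrite geq_max size_polyXn msz size_polyN.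
  apply: (leq_trans (size_sum _ _ _)); apply/bigmax_leqP_seq => z zrs _.
  by rewrite (leq_trans (size_scale_leq _ _))// size_L.
transitivity (Q`_(size rs).-1 / c); last first.
  by move/eqP: QX; rewrite subr_eq0 => /eqP<-; rewrite coefXn eq_sym.
rewrite coef_sum mulr_suml big_seq [RHS]big_seq; apply: eq_bigr => z zrs.
rewrite derivL// coefZ.
have -> : (L rs z)`_(size rs).-1 = 1.
  by rewrite -(size_L zrs) -lead_coefE; apply/eqP; exact: monic_prod_XsubC.
by rewrite mulr1 invfM; ring.
Qed.

(** The vanishing of [P] at each [z] makes these sums satisfy a linear recurrence with the
    coefficients of [P]. It extends the case of exponents below [size rs], settled by
    [sum_expr_div_deriv], to all exponents. *)
Lemma sum_expr_div_deriv_rec rs c m : let P := c *: \prod_(y <- rs) ('X - y%:P) in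
  c != 0 ->
  \sum_(z <- rs) z ^+ (m + size rs) / P^`().[z] =
  - c^-1 * \sum_(i < size rs) P`_i * \sum_(z <- rs) z ^+ (m + i) / P^`().[z].
Proof.
move=> P c0.
have sP : size P = (size rs).+1 by rewrite size_scale// size_prod_XsubC.
have cP : P`_(size rs) = c.
  rewrite coefZ (_ : _`_(size rs) = 1) ?mulr1//.
  have := monic_prod_XsubC rs xpredT (id : F -> F).
  by rewrite monicE lead_coefE size_prod_XsubC => /eqP.
apply: (mulfI c0); rewrite mulrA mulrN divff// mulN1r.
apply/eqP; rewrite -addr_eq0; apply/eqP.
under [X in _ + X]eq_bigr do rewrite mulr_sumr.
rewrite exchange_big /= mulr_sumr -big_split /= big_seq big1// => z zrs.
have /eqP : P.[z] = 0 by apply/eqP; rewrite -rootE rootZ// root_prod_XsubC.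
rewrite horner_coef sP big_ord_recr /= cP => /eqP Pz.
transitivity (z ^+ m / P^`().[z] * (\sum_(i < size rs) P`_i * z ^+ i + c * z ^+ size rs)).
  rewrite mulrDr addrC mulr_sumr; congr (_ + _); last by rewrite exprD; ring.
  by apply: eq_bigr => i _; rewrite exprD; ring.
by rewrite Pz mulr0.
Qed.
End roots_of_polynomials.

Section complex_roots.
Local Open Scope complex_scope.
Context {R : realType}.
Implicit Types (rs : seq R[i]) (c : R[i]).

(** The logarithmic derivative is a sum of terms 1 / (t - z), each of modulus at most 1 / (1 - t).
    The product form spares a division by the value of [P]. *)
Lemma norm_deriv_le rs c (t : R) : 0 <= 1 - t ->
  (forall z, z \in rs -> (1 - t)%:C <= `|t%:C - z|) ->
  let P := c *: \prod_(y <- rs) ('X - y%:P) in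
  `|P^`().[t%:C]| * (1 - t)%:C <= (size rs)%:R * `|P.[t%:C]|.
Proof.
move=> t1 Hrs /=; rewrite derivZ !hornerZ !normrM -mulrA [leRHS]mulrCA ler_wpM2l//.
elim: rs Hrs => [|z rs IH] Hrs.
  by rewrite !big_nil derivC horner0 normr0 !mul0r.
rewrite !big_cons derivM derivXsubC mul1r hornerD !hornerM hornerXsubC.
set Q := \prod_(_ <- rs) _.
have t1' : 0 <= (1 - t)%:C by rewrite ler0c.
apply: (@le_trans _ _ (`|Q.[t%:C]| * (1 - t)%:C +
   `|t%:C - z| * (`|Q^`().[t%:C]| * (1 - t)%:C))).
  by rewrite mulrA -normrM -mulrDl ler_wpM2r ?ler_normD.
rewrite -natr1 mulrDl mul1r normrM addrC lerD//.
  rewrite [leRHS]mulrCA ler_wpM2l// IH// => y yrs.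
  by apply: Hrs; rewrite inE yrs orbT.
by rewrite mulrC ler_wpM2r// Hrs// mem_head.
Qed.

(** When z is unimodular, - z times the conjugate of 1 - z equals 1 - z: each linear factor
    satisfies the identity, and it is multiplicative. *)
Lemma unimodular_roots rs c : (forall z, z \in rs -> `|z| = 1) ->
  let P := c *: \prod_(y <- rs) ('X - y%:P) in
  P.[0] * (P.[1])^* = c^* * P.[1] /\ `|P.[0]| = `|c|.
Proof.
move=> Hrs; rewrite /= !hornerZ rmorphM /=.
suff [H1 H2] : (\prod_(y <- rs) ('X - y%:P)).[0] * ((\prod_(y <- rs) ('X - y%:P)).[1])^* =
   (\prod_(y <- rs) ('X - y%:P)).[1] /\ `|(\prod_(y <- rs) ('X - y%:P)).[0]| = 1.
  by rewrite normrM H2 mulr1; split => //; rewrite mulrACA H1 [c * _]mulrC mulrA.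
elim: rs Hrs => [|z rs IH] Hrs.
  by rewrite big_nil !hornerC rmorph1 mulr1 normr1.
have [|IH1 IH2] := IH; first by move=> y yrs; apply: Hrs; rewrite inE yrs orbT.
rewrite !big_cons !hornerM !hornerXsubC rmorphM /= normrM IH2 mulr1 sub0r normrN.
have z1 : `|z| = 1 by apply: Hrs; rewrite mem_head.
split => //; rewrite -[in RHS]IH1 mulrACA; congr (_ * _).
rewrite rmorphB rmorph1 mulrBr mulr1.
have -> : - z * z^* = - 1.
  have := add_Re2_Im2 z; rewrite z1 expr1n => H.
  rewrite mulNr -H; congr (- _); case: (z) => a b /=.
  by apply: complex_eqP; rewrite /=; ring.
by rewrite opprK addrC.
Qed.
End complex_roots.

(** * Lee-Yang polynomials along integer directions *)

Section exponential_sums.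
Local Open Scope complex_scope.
Context {R : realType} {n : nat}.
Local Notation V := 'rV[R]_n.
Implicit Types (a b : 'rV[int]_n) (p : laurent R n) (x : V).

Definition idot a b : int := \sum_j a 0 j * b 0 j.

Lemma dot_rV_int a b : dot (rV_int a : V) (rV_int b) = (idot a b)%:~R.
Proof.
rewrite /idot rmorph_sum /=; apply: eq_bigr => j _.
by rewrite !mxE intrM.
Qed.

Lemma dotDr (l x y : V) : dot l (x + y) = dot l x + dot l y.
Proof. by rewrite /dot -big_split; apply: eq_bigr => j _; rewrite mxE mulrDr. Qed.

Lemma dotZr (l x : V) c : dot l (c *: x) = c * dot l x.
Proof. by rewrite /dot mulr_sumr; apply: eq_bigr => j _; rewrite mxE mulrCA. Qed.

Lemma dotC (l x : V) : dot l x = dot x l.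
Proof. by apply: eq_bigr => j _; rewrite mulrC. Qed.

Lemma dotDl (l x y : V) : dot (x + y) l = dot x l + dot y l.
Proof. by rewrite ![dot _ l]dotC dotDr. Qed.

Lemma dotZl (l x : V) c : dot (c *: x) l = c * dot x l.
Proof. by rewrite ![dot _ l]dotC dotZr. Qed.

Lemma dot0r (l : V) : dot l 0 = 0.
Proof. by rewrite -(scale0r 0) dotZr mul0r. Qed.

Lemma dotNr (l x : V) : dot l (- x) = - dot l x.
Proof. by rewrite -scaleN1r dotZr mulN1r. Qed.

Lemma dotNl (l x : V) : dot (- x) l = - dot x l.
Proof. by rewrite dotC dotNr dotC. Qed.

Lemma rV_intD a b : (rV_int (a + b) : V) = rV_int a + rV_int b.
Proof. exact: map_mxD. Qed.

Lemma rV_intN a : (rV_int (- a) : V) = - rV_int a.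
Proof. exact: map_mxN. Qed.

Lemma laurent_evalE p x : laurent_eval p (\row_j cexp (0 +i* (2 * pi * x 0 j))) =
  \sum_(a <- finsupp p) p a * expi (dot (rV_int a) x).
Proof.
apply: eq_bigr => a _; congr (_ * _); rewrite /monomial /dot.
transitivity (\prod_j expi (x 0 j * (a 0 j)%:~R)).
  by apply: eq_bigr => j _; rewrite mxE expiMz.
rewrite (big_morph expi (@expiD R) (@expi0 R)).
by apply: eq_bigr => j _; rewrite mxE mulrC.
Qed.

(* the value of p at exp (2 i pi (x + i y b) + w b') *)
Lemma laurent_eval_line p x (y : R) (w : R[i]) b b' :
  let z : 'rV[R[i]]_n := \row_j ((- (2 * pi * y * (b 0 j)%:~R)) +i* (2 * pi * x 0 j) + w *~ b' 0 j) in
  laurent_eval p (map_mx cexp z) =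
  \sum_(a <- finsupp p) p a * expi (dot (rV_int a) x) *
     (expR (- (2 * pi * y * (idot a b)%:~R)))%:C * cexp w ^ idot a b'.
Proof.
apply: eq_bigr => a _.
transitivity (p a * (expi (dot (rV_int a) x) *
  ((expR (- (2 * pi * y * (idot a b)%:~R)))%:C * cexp w ^ idot a b'))); last by rewrite !mulrA.
congr (_ * _); rewrite /monomial.
have cr (u : R) : cexp (u%:C) = (expR u)%:C.
  by rewrite /cexp /= cos0 sin0; apply: complex_eqP; rewrite ?(cReM, cImM) /=; ring.
transitivity (\prod_j (expi (x 0 j * (a 0 j)%:~R) *
    (cexp ((- (2 * pi * y * (b 0 j)%:~R * (a 0 j)%:~R))%:C) * cexp (w *~ (a 0 j * b' 0 j))))).
  apply: eq_bigr => j _; rewrite !mxE cexpD.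
  have -> : (- (2 * pi * y * (b 0 j)%:~R)) +i* (2 * pi * x 0 j) =
    0 +i* (2 * pi * x 0 j) + (- (2 * pi * y * (b 0 j)%:~R))%:C.
    by apply: complex_eqP; rewrite /=; ring.
  rewrite cexpD -/(expi _) 2!expfzMl -mulrA expiMz; congr (_ * (_ * _)).
    rewrite -cexpMz; congr cexp; rewrite -[in RHS]mulNr rmorphM /= rmorph_int.
    by rewrite [RHS]mulrzr.
  by rewrite -cexpMz -mulrzA mulrC.
rewrite big_split; congr (_ * _); last (rewrite big_split; congr (_ * _)).
- by rewrite /dot (big_morph expi (@expiD R) (@expi0 R)); apply: eq_bigr => j _; rewrite mxE mulrC.
- rewrite -(big_morph cexp (@cexpD R) (@cexp0 R)) -cr -(raddf_sum (real_complex R)).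
  congr (cexp (_ %:C)); rewrite sumrN; congr (- _).
  rewrite rmorph_sum /= mulr_sumr; apply: eq_bigr => j _.
  by rewrite intrM; ring.
- rewrite -(big_morph cexp (@cexpD R) (@cexp0 R)) -cexpMz; congr cexp.
  rewrite /idot; elim/big_rec2: _ => [|j u v _ ->]; first by rewrite mulr0z.
  by rewrite -mulrzDr.
Qed.

End exponential_sums.

Section derivative_comparison.
Local Open Scope complex_scope.
Context {R : realType}.

Lemma is_derive0_seq (f : R -> R) (d : R) : is_derive (0 : R) (1 : R) f d -> f 0 = 0 ->
  f k.+1%:R^-1 / k.+1%:R^-1 @[k --> \oo] --> d.
Proof.
move=> [exd eqd] f0.
have H : (h^-1 *: ((f \o shift 0) (h *: (1 : R)) - f 0)) @[h --> (0 : R)^'] --> d.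
  by rewrite -eqd; exact: exd.
have /cvgr_dnbhsP H' := H.
have {}H' := H' (fun k => k.+1%:R^-1).
have E : (fun k : nat => f k.+1%:R^-1 / k.+1%:R^-1) =
    (fun k : nat => (k.+1%:R^-1)^-1 *: ((f \o shift 0) (k.+1%:R^-1 *: 1) - f 0)).
  by apply/funext => k; rewrite /= f0 subr0 addr0 /GRing.scale /= mulr1 mulrC.
rewrite E; apply: H'; split; first by move=> k; rewrite invr_eq0 pnatr_eq0.
exact: cvg_harmonic.
Qed.

(* [q1, q2] are multiples of the derivative of a polynomial at the point [1 - T y], [f1, f2]
   its values there, and the inequality says that it has no root within [T y]. *)
Lemma derivative_comparison (f1 f2 q1 q2 T : R -> R) (rho D : R) :
  f1 0 = 0 -> f2 0 = 0 -> T 0 = 0 -> rho != 0 ->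
  is_derive (0 : R) (1 : R) f1 0 -> is_derive (0 : R) (1 : R) f2 0 ->
  is_derive (0 : R) (1 : R) T rho ->
  {for 0, continuous q1} -> {for 0, continuous q2} ->
  (\forall k \near \oo, let y := k.+1%:R^-1 in
    T y ^+ 2 * (q1 y ^+ 2 + q2 y ^+ 2) <= D * (f1 y ^+ 2 + f2 y ^+ 2)) ->
  q1 0 = 0 /\ q2 0 = 0.
Proof.
move=> f10 f20 T0 rho0 df1 df2 dT cq1 cq2 H.
pose u k : R := k.+1%:R^-1.
have u0 k : u k != 0 by rewrite invr_eq0 pnatr_eq0.
have qu (q : R -> R) : {for 0, continuous q} -> q (u k) @[k --> \oo] --> q 0.
  by move=> cq; apply: (@cvg_comp _ _ _ u q) cq; exact: cvg_harmonic.
(* The inequality is divided by the square of y: the left side then tends to a nonzero multiple of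
   the sum of squares at 0, and the right side to 0. *)
have lhs : (T (u k) / u k) ^+ 2 * (q1 (u k) ^+ 2 + q2 (u k) ^+ 2) @[k --> \oo] -->
    rho ^+ 2 * (q1 0 ^+ 2 + q2 0 ^+ 2).
  by apply: cvgM; [|apply: cvgD]; apply: cvgM => //; (exact: is_derive0_seq || exact: qu).
have rhs : D * ((f1 (u k) / u k) ^+ 2 + (f2 (u k) / u k) ^+ 2) @[k --> \oo] -->
    D * (0 ^+ 2 + 0 ^+ 2).
  apply: cvgM; first exact: cvg_cst.
  by apply: cvgD; apply: cvgM; exact: is_derive0_seq.
have le : rho ^+ 2 * (q1 0 ^+ 2 + q2 0 ^+ 2) <= D * (0 ^+ 2 + 0 ^+ 2).
  apply: (ler_cvg_to lhs rhs); near=> k.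
  have : T (u k) ^+ 2 * (q1 (u k) ^+ 2 + q2 (u k) ^+ 2) <= D * (f1 (u k) ^+ 2 + f2 (u k) ^+ 2).
    by near: k; exact: H.
  rewrite !expr_div_n (mulrAC (T _ ^+ 2)) -mulrDl [D * (_ / _)]mulrA.
  by rewrite ler_pM2r// invr_gt0 exprn_gt0// invr_gt0.
move: le; rewrite expr0n /= addr0 mulr0 => le.
have : q1 0 ^+ 2 + q2 0 ^+ 2 == 0.
  rewrite eq_le addr_ge0 ?sqr_ge0// andbT.
  by rewrite -(@pmulr_rle0 _ (rho ^+ 2)) ?exprn_even_gt0.
by rewrite paddr_eq0 ?sqr_ge0// !sqrf_eq0 => /andP[/eqP-> /eqP->].
Unshelve. all: by end_near. Qed.

Lemma is_derive_sum_exp (I : Type) (r : seq I) (c l : I -> R) (y : R) :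
  is_derive y (1 : R) (fun y => \sum_(i <- r) c i * expR (l i * y))
    (\sum_(i <- r) c i * l i * expR (l i * y)).
Proof.
elim: r => [|i r IH].
  under eq_fun do rewrite big_nil; rewrite big_nil; exact: is_derive_cst.
under eq_fun do rewrite big_cons; rewrite big_cons; apply: is_deriveD.
rewrite -mulrA; apply: is_deriveZ.
rewrite mulrC; apply: (@is_derive1_comp _ expR (fun y => l i * y)).
by rewrite -[X in is_derive _ _ _ X]mulr1; exact: is_deriveZ.
Qed.

End derivative_comparison.

Section complex_real_sums.
Local Open Scope complex_scope.
Context {R : realType} (I : Type).
Implicit Types (r : seq I) (l : I -> R[i]) (w : I -> R).

Lemma cRe_sum_real r l w : complex.Re (\sum_(i <- r) l i * (w i)%:C) =
  \sum_(i <- r) complex.Re (l i) * w i.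
Proof.
elim: r => [|i r IH]; first by rewrite !big_nil.
by rewrite !big_cons cReD IH cReM /= mulr0 subr0.
Qed.

Lemma cIm_sum_real r l w : complex.Im (\sum_(i <- r) l i * (w i)%:C) =
  \sum_(i <- r) complex.Im (l i) * w i.
Proof.
elim: r => [|i r IH]; first by rewrite !big_nil.
by rewrite !big_cons cImD IH cImM /= mulr0 add0r.
Qed.

End complex_real_sums.

Section lee_yang_lines.
Local Open Scope complex_scope.
Context {R : realType} {n : nat}.
Local Notation V := 'rV[R]_n.
Variables (p : laurent R n) (K : set V).
Hypothesis KZ : forall (t : R) x, 0 < t -> K x -> K (t *: x).
Hypothesis KD : forall x y, K x -> K y -> K (x + y).
Hypothesis pK : forall z : 'rV[R[i]]_n,
  K (map_mx (@complex.Re R) z) \/ K (- map_mx (@complex.Re R) z) ->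
  laurent_eval p (map_mx cexp z) != 0.
Implicit Types (a b : 'rV[int]_n) (x : V).

Definition lcoef x a : R[i] := p a * expi (dot (rV_int a) x).

(** Moving by w b' from the point with real part - 2 pi y b and imaginary part 2 pi x gives a
    Laurent polynomial in e^w, made polynomial by the factor e^(w M). The absolute value is exact
    once [M] makes all exponents non-negative. *)
Definition linepoly x (y : R) b b' (M : int) : {poly R[i]} :=
  \sum_(a <- finsupp p) (lcoef x a * (expR (- (2 * pi * y * (idot a b)%:~R)))%:C) *:
    'X^(absz (idot a b' + M)).

Lemma Re_mulrz (w : R[i]) (k : int) : complex.Re (w *~ k) = complex.Re w * k%:~R.
Proof.
have E (m : nat) : complex.Re (w *+ m) = complex.Re w * m%:R.
  by elim: m => [|m IH]; rewrite ?mulr0n ?mulr0// mulrS cReD IH -[m.+1%:R]natr1 mulrDr mulr1 addrC.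
case: k => m; first exact: E.
have -> : w *~ Negz m = - (w *+ m.+1) by [].
have -> : (Negz m)%:~R = - (m.+1%:R) :> R by [].
by rewrite mulrN -E; case: (w *+ _).
Qed.

Lemma linepoly_eval x y b b' (M : int) (w : R[i]) :
  (forall a, a \in finsupp p -> 0 <= idot a b' + M) ->
  (linepoly x y b b' M).[cexp w] = cexp w ^ M *
    laurent_eval p (map_mx cexp (\row_j ((- (2 * pi * y * (b 0 j)%:~R))
      +i* (2 * pi * x 0 j) + w *~ b' 0 j))).
Proof.
move=> HM; rewrite laurent_eval_line horner_sum mulr_sumr !big_seq.
apply: eq_bigr => a asupp; rewrite hornerZ hornerXn.
rewrite [RHS]mulrC -[RHS]mulrA -expfzDr ?cexp_neq0//; congr (_ * _).
by rewrite -[in RHS](gez0_abs (HM _ asupp)).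
Qed.

Lemma linepoly_neq0 x y b b' (M : int) (w : R[i]) :
  (forall a, a \in finsupp p -> 0 <= idot a b' + M) ->
  let u := (- (2 * pi * y)) *: rV_int b + (complex.Re w) *: rV_int b' in
  K u \/ K (- u) -> (linepoly x y b b' M).[cexp w] != 0.
Proof.
move=> HM u Ku; rewrite linepoly_eval// mulf_neq0//.
  by rewrite expfz_neq0// cexp_neq0.
apply: pK; suff -> : map_mx (@complex.Re R) (\row_j ((- (2 * pi * y * (b 0 j)%:~R))
      +i* (2 * pi * x 0 j) + w *~ b' 0 j)) = u by [].
apply/rowP => j; rewrite !mxE cReD Re_mulrz /=; ring.
Qed.

(** If 0 < |z| < 1, then z = e^w with Re w < 0 and the corresponding point has its real part in
    [- K], where [p] does not vanish. The root 0 is set apart because the shift [M] may create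
    it. *)
Lemma linepoly_root x y b b' (M : int) (z : R[i]) : 0 <= y ->
  (forall a, a \in finsupp p -> 0 <= idot a b' + M) ->
  K (rV_int b) -> K (rV_int b') ->
  root (linepoly x y b b' M) z -> z = 0 \/ 1 <= `|z|.
Proof.
move=> y0 HM Kb Kb' rz; have [->|z0] := eqVneq z 0; [by left|right].
have [w wz nz] := cexp_surj z0; rewrite nz lecR.
rewrite leNgt -expR0 ltr_expR; apply/negP => w0.
move: rz; rewrite rootE -wz; apply/negP; apply: linepoly_neq0 => //; right.
rewrite opprD -scaleNr opprK -scaleNr.
have Kb2 : K ((- complex.Re w) *: rV_int b') by apply: KZ => //; rewrite oppr_gt0.
move: y0; rewrite le_eqVlt => /orP[/eqP<-|y0]; first by rewrite mulr0 scale0r add0r.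
by apply: KD => //; apply: KZ => //; rewrite !mulr_gt0// pi_gt0.
Qed.

(** At depth 0 a nonzero Re w of either sign puts the real part in [K] or [- K], so nonzero roots
    are excluded on both sides of the circle. *)
Lemma linepoly_root_unit x b b' (M : int) (z : R[i]) :
  (forall a, a \in finsupp p -> 0 <= idot a b' + M) ->
  K (rV_int b') -> root (linepoly x 0 b b' M) z -> z = 0 \/ `|z| = 1.
Proof.
move=> HM Kb' rz; have [->|z0] := eqVneq z 0; [by left|right].
have [w wz nz] := cexp_surj z0; rewrite nz.
suff -> : complex.Re w = 0 by rewrite expR0.
apply/eqP; apply: contraTT rz => w0; rewrite rootE -wz.
apply: linepoly_neq0 => //; rewrite mulr0 oppr0 scale0r add0r.
have [wn|wp] := ltP (complex.Re w) 0.
  by right; rewrite -scaleNr; apply: KZ => //; rewrite oppr_gt0.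
by left; apply: KZ => //; rewrite lt_neqAle eq_sym w0.
Qed.

Lemma size_linepoly x y b b' (M : int) :
  (size (linepoly x y b b' M) <= (\sum_(a <- finsupp p) absz (idot a b' + M)%R).+1)%N.
Proof.
apply: (leq_trans (size_sum _ _ _)); apply/bigmax_leqP_seq => a asupp _.
rewrite (leq_trans (size_scale_leq _ _))// size_polyXn ltnS.
by rewrite (big_rem a)//= leq_addr.
Qed.

Lemma exists_shift b' : exists M : int, forall a, a \in finsupp p -> 0 <= idot a b' + M.
Proof.
exists (\sum_(a <- finsupp p) `|idot a b'|) => a asupp.
have h : 0 <= idot a b' + `|idot a b'| by rewrite -lerBlDl sub0r -normrN ler_norm.
by rewrite (big_rem a)//= addrA addr_ge0// sumr_ge0.
Qed.

(* With [P y] the restriction at depth [y] in direction [b], the hypotheses say that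
   [P y] at [tau y = e^(-2 pi kap y)] is [o(y)]. As the roots of [P y] other than [0] have
   modulus at least 1, [|P'| <= deg * |P| / (1 - tau)] at [tau y], forcing [P' = 0] in the
   limit [y -> 0]. *)
Lemma lee_yang_transversal x b b' (kap : R) : 0 < kap ->
  K (rV_int b) -> K (rV_int b') ->
  \sum_(a <- finsupp p) lcoef x a = 0 ->
  \sum_(a <- finsupp p) lcoef x a * (idot a b)%:~R =
    - (kap%:C * \sum_(a <- finsupp p) lcoef x a * (idot a b')%:~R) ->
  \sum_(a <- finsupp p) lcoef x a * (idot a b')%:~R = 0.
Proof.
move=> kap0 Kb Kb' S0 Sb; have [M HM] := exists_shift b'.
pose m a := absz (idot a b' + M).
have mE a : a \in finsupp p -> (m a)%:R = (idot a b' + M)%:~R :> R.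
  by move=> /HM h; rewrite /m pmulrn gez0_abs.
(* The exponential rate in [y] of the term of index [a] when [P y] is evaluated at [tau y]. *)
pose lam a : R := - (2 * pi) * ((idot a b)%:~R + kap * (m a)%:R).
pose tau (y : R) : R := expR (- (2 * pi * kap) * y).
pose P y := linepoly x y b b' M.
pose S (w : 'rV[int]_n -> R) (y : R) : R[i] :=
  \sum_(a <- finsupp p) lcoef x a * (w a * expR (lam a * y))%:C.
have tau0 y : 0 < tau y by exact: expR_gt0.
have tauX y k : tau y ^+ k = expR (- (2 * pi * kap) * y * k%:R).
  by rewrite /tau -expRM_natr.
have PE y : (P y).[(tau y)%:C] = S (fun=> 1) y.
  rewrite horner_sum; apply: eq_bigr => a _; rewrite hornerZ hornerXn -rmorphXn /= tauX.
  rewrite -[LHS]mulrA -rmorphM /= -expRD mul1r; congr (_ * (expR _)%:C).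
  by rewrite /lam; ring.
have P'E y : (tau y)%:C * ((P y)^`()).[(tau y)%:C] = S (fun a => (m a)%:R) y.
  rewrite raddf_sum /= horner_sum mulr_sumr; apply: eq_bigr => a _.
  rewrite derivZ derivXn hornerZ hornerMn hornerXn -/(m a).
  rewrite -[_ *+ m a]mulr_natl mulrCA [(tau y)%:C * _]mulrCA.
  have -> : (m a)%:R * ((tau y)%:C * (tau y)%:C ^+ (m a).-1) = ((m a)%:R * tau y ^+ m a)%:C.
    rewrite rmorphM /= rmorph_nat rmorphXn /=; case: (m a) => [|k]; first by rewrite !mul0r.
    by rewrite -exprS.
  rewrite -[LHS]mulrA -rmorphM /= tauX mulrCA -expRD; congr (_ * (_ * expR _)%:C).
  by rewrite /lam; ring.
have ReS w y : complex.Re (S w y) =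
    \sum_(a <- finsupp p) (complex.Re (lcoef x a) * w a) * expR (lam a * y).
  by rewrite cRe_sum_real; apply: eq_bigr => a _; rewrite mulrA.
have ImS w y : complex.Im (S w y) =
    \sum_(a <- finsupp p) (complex.Im (lcoef x a) * w a) * expR (lam a * y).
  by rewrite cIm_sum_real; apply: eq_bigr => a _; rewrite mulrA.
have S00 w : S w 0 = \sum_(a <- finsupp p) lcoef x a * (w a)%:C.
  by apply: eq_bigr => a _; rewrite mulr0 expR0 mulr1.
have Sm : S (fun a => (m a)%:R) 0 = \sum_(a <- finsupp p) lcoef x a * (idot a b')%:~R.
  rewrite S00; transitivity (\sum_(a <- finsupp p) (lcoef x a * (idot a b')%:~R + lcoef x a * M%:~R)).
    rewrite big_seq [RHS]big_seq; apply: eq_bigr => a asupp.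
    by rewrite mE// -mulrDr -rmorphD rmorph_int.
  by rewrite big_split /= -mulr_suml S0 mul0r addr0.
(* The hypothesis relating [b] and [b'] says exactly that the first-order term in [y] vanishes at
   0. *)
have Slam : \sum_(a <- finsupp p) lcoef x a * (lam a)%:C = 0.
  transitivity ((- (2 * pi))%:C * (\sum_(a <- finsupp p) lcoef x a * (idot a b)%:~R +
     kap%:C * S (fun a => (m a)%:R) 0)).
    rewrite S00 mulr_sumr -big_split /= mulr_sumr; apply: eq_bigr => a _.
    by rewrite /lam rmorphM rmorphD rmorphM /= rmorph_int; ring.
  by rewrite Sm Sb addNr mulr0.
suff [q1 q2] : complex.Re (S (fun a => (m a)%:R) 0) = 0 /\ complex.Im (S (fun a => (m a)%:R) 0) = 0.
  by rewrite -Sm; apply: complex_eqP.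
pose D := (\sum_(a <- finsupp p) m a)%N.
have dS (f : R[i] -> R) : (f = @complex.Re R \/ f = @complex.Im R) ->
    [/\ f (S (fun=> 1) 0) = 0, is_derive (0 : R) (1 : R) (fun y => f (S (fun=> 1) y)) 0 &
     {for 0, continuous (fun y => f (S (fun a => (m a)%:R) y))}].
  move=> Hf; have fS w y : f (S w y) = \sum_(a <- finsupp p) (f (lcoef x a) * w a) * expR (lam a * y).
    by case: Hf => ->.
  have f0 : f 0 = 0 by case: Hf => ->.
  have fsum c : \sum_(a <- finsupp p) f (lcoef x a) * c a =
      f (\sum_(a <- finsupp p) lcoef x a * (c a)%:C).
    by case: Hf => ->; rewrite ?cRe_sum_real ?cIm_sum_real.
  split.
  - rewrite S00 (_ : \sum_(a <- _) _ = 0)//.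
    by rewrite -[RHS]S0; apply: eq_bigr => a _; rewrite mulr1.
  - under eq_fun do rewrite fS.
    rewrite [X in is_derive _ _ _ X](_ : 0 =
        \sum_(a <- finsupp p) (f (lcoef x a) * 1) * lam a * expR (lam a * 0)).
      exact: is_derive_sum_exp.
    apply: (etrans (esym f0)); rewrite -[X in f X]Slam -fsum; apply: eq_bigr => a _.
    by rewrite mulr0 expR0 !mulr1.
  - have -> : (fun y => f (S (fun a => (m a)%:R) y)) =
        (fun y => \sum_(a <- finsupp p) (f (lcoef x a) * (m a)%:R) * expR (lam a * y)).
      by apply/funext => y; rewrite fS.
    apply/differentiable_continuous/derivable1_diffP.
    by have [] := is_derive_sum_exp (finsupp p) (fun a => f (lcoef x a) * (m a)%:R) lam 0.
have [f10 df1 cq1] := dS _ (or_introl erefl).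
have [f20 df2 cq2] := dS _ (or_intror erefl).
have T0 : 1 - tau 0 = 0 by rewrite /tau mulr0 expR0 subrr.
have dT : is_derive (0 : R) (1 : R) (fun y => 1 - tau y) (2 * pi * kap).
  have -> : 2 * pi * kap = 0 - (- (2 * pi * kap)) * expR (- (2 * pi * kap) * 0).
    by rewrite mulr0 expR0; ring.
  apply: is_deriveB; rewrite mulrC.
  apply: (@is_derive1_comp _ expR (fun y => - (2 * pi * kap) * y)).
  by rewrite -[X in is_derive _ _ _ X]mulr1; exact: is_deriveZ.
have rho0 : 2 * pi * kap != 0 by rewrite !mulf_neq0// gt_eqF// pi_gt0.
apply: (derivative_comparison (D := D%:R ^+ 2) f10 f20 T0 rho0 df1 df2 dT cq1 cq2).
(* The root 0 escapes the lower bound on moduli; from [1 / 2 <= tau] its distance [tau] to the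
   evaluation point is still at least [1 - tau]. *)
have ntau : \forall k \near \oo, 1 / 2 <= tau k.+1%:R^-1.
  have ctau : tau k.+1%:R^-1 @[k --> \oo] --> (1 : R).
    have ctau0 : {for 0, continuous tau}.
      apply: (@continuous_comp R R R (fun y => - (2 * pi * kap) * y) expR 0).
        exact: mulrl_continuous.
      exact: continuous_expR.
    have tau00 : tau 0 = 1 by rewrite /tau mulr0 expR0.
    pose u k : R := k.+1%:R^-1.
    have cu : u @ \oo --> (0 : R) by exact: cvg_harmonic.
    by have := @cvg_comp _ _ _ u tau _ _ _ cu ctau0; rewrite tau00.
  by apply: (cvgr_ge _ ctau); lra.
near=> k; set y : R := k.+1%:R^-1.
have y0 : 0 < y by rewrite invr_gt0.
have ty : 1 / 2 <= tau y by rewrite /y; near: k.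
have ty1 : 0 <= 1 - tau y.
  rewrite subr_ge0 -expR0 ler_expR mulNr oppr_le0 !mulr_ge0// ?pi_ge0// ltW//.
have ReIm (z : R[i]) : `|z| ^+ 2 = (complex.Re z ^+ 2 + complex.Im z ^+ 2)%:C.
  by rewrite add_Re2_Im2.
have [P0|P0] := eqVneq (P y) 0.
  have -> : S (fun a => (m a)%:R) y = 0 by rewrite -P'E P0 deriv0 horner0 mulr0.
  have -> : S (fun=> 1) y = 0 by rewrite -PE P0 horner0.
  by rewrite /= expr0n /= addr0 !mulr0.
have [rs Prs] := closed_field_poly_normal (P y).
have srs : (size rs <= D)%N.
  have : (size (P y) <= D.+1)%N by exact: size_linepoly.
  by rewrite {1}Prs size_scale ?lead_coef_eq0// size_prod_XsubC.
have Hrs z : z \in rs -> (1 - tau y)%:C <= `|(tau y)%:C - z|.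
  move=> zrs; have : root (P y) z.
    by rewrite Prs rootZ ?lead_coef_eq0// root_prod_XsubC.
  have tn : `|(tau y)%:C| = (tau y)%:C by rewrite ger0_norm// ler0c ltW.
  move=> /(linepoly_root (ltW y0) HM Kb Kb')[->|z1].
    by rewrite subr0 tn lecR; lra.
  rewrite distrC; apply: le_trans (lerB_dist _ _); rewrite tn rmorphB /= rmorph1.
  by rewrite lerD2r.
have := norm_deriv_le (lead_coef (P y)) ty1 Hrs; rewrite /= -Prs => H.
have {}H : `|S (fun a => (m a)%:R) y| * (1 - tau y)%:C <= (D%:R)%:C * `|S (fun=> 1) y|.
  rewrite -P'E -PE normrM.
  apply: (@le_trans _ _ (`|((P y)^`()).[(tau y)%:C]| * (1 - tau y)%:C)).
    rewrite -mulrA; apply: ler_piMl; first by rewrite mulr_ge0// ler0c.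
    have -> : `|(tau y)%:C| = (tau y)%:C by rewrite ger0_norm// ler0c ltW.
    by rewrite -[1]/(1%:C) lecR; lra.
  apply: (le_trans H); rewrite ler_wpM2r//.
  by rewrite rmorph_nat ler_nat.
have : (`|S (fun a => (m a)%:R) y| * (1 - tau y)%:C) ^+ 2 <= ((D%:R)%:C * `|S (fun=> 1) y|) ^+ 2.
  by rewrite lerXn2r// nnegrE mulr_ge0// ler0c.
rewrite !exprMn !ReIm -!rmorphXn -!rmorphM /= lecR.
by rewrite [X in X <= _]mulrC.
Unshelve. all: by end_near. Qed.

End lee_yang_lines.

Section curves.
Local Open Scope complex_scope.
Context {R : realType} {n : nat}.
Local Notation V := 'rV[R]_n.

Lemma is_derive_dot (w : V) (gam : R -> V) (t : R) (v : V) :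
  is_derive t (1 : R) gam v -> is_derive t (1 : R) (fun s => dot w (gam s)) (dot w v).
Proof.
move=> [dg gv].
have cg : h^-1 *: ((gam \o shift t) (h *: (1 : R)) - gam t) @[h --> (0 : R)^'] --> v.
  by rewrite -gv; exact: dg.
have cd : {for v, continuous (dot w)} by exact: dot_continuous.
have := @cvg_comp _ _ _ _ (dot w) _ _ _ cg cd.
rewrite (_ : dot w \o _ = fun h : R =>
   h^-1 *: (((fun s => dot w (gam s)) \o shift t) (h *: (1 : R)) - dot w (gam t))); last first.
  by apply/funext => h /=; rewrite dotZr dotDr dotNr.
move=> H; split; first by apply/cvg_ex; exists (dot w v).
exact: (cvg_lim _ H).
Qed.

Lemma is_derive_line (x v : V) (t : R) : is_derive t (1 : R) (fun s : R => x + s *: v) v.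
Proof.
have H : h^-1 *: (((fun s : R => x + s *: v) \o shift t) (h *: (1 : R)) - (x + t *: v))
    @[h --> (0 : R)^'] --> v.
  apply: cvg_near_cst; near=> h.
  have h0 : h != 0 by near: h; exact: nbhs_dnbhs_neq.
  have -> : ((fun s : R => x + s *: v) \o shift t) (h *: (1 : R)) - (x + t *: v) = h *: v.
    have -> : h *: (1 : R) = h by exact: mulr1.
    by rewrite /= scalerDl opprD addrACA subrr add0r addrK.
  by rewrite scalerA mulVf// scale1r.
split; first by apply/cvg_ex; exists v.
exact: (cvg_lim _ H).
Unshelve. all: by end_near. Qed.

End curves.

(** * A real function with the same zeros on the torus *)

Section real_form.
Local Open Scope complex_scope.
Context {R : realType} {n : nat}.
Local Notation V := 'rV[R]_n.
Variables (p : laurent R n) (ap am : 'rV[int]_n).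
Implicit Types (x v : V) (b : 'rV[int]_n) (c : R[i]).

Definition tsum x : R[i] := \sum_(a <- finsupp p) lcoef p x a.

Definition gsum x v : R[i] := \sum_(a <- finsupp p) lcoef p x a * (dot (rV_int a) v)%:C.

(* Shifting frequencies by the midpoint of the extreme exponents [ap], [am] makes the sum
   real up to a unimodular constant; [wmid] may be half-integral. *)
Definition wmid : V := 2^-1 *: (rV_int ap + rV_int am).

Definition cfreq a : V := rV_int a - wmid.

Definition hform c x : R[i] := \sum_(a <- finsupp p) c * p a * expi (dot (cfreq a) x).

Definition rform c x : R := complex.Re (hform c x).

Definition hgrad c x v : R[i] := \sum_(a <- finsupp p)
  c * p a * expi (dot (cfreq a) x) * (0 +i* (2 * pi * dot (cfreq a) v)).

Definition rgrad c x : V := \row_j complex.Re (hgrad c x (delta_mx 0 j)).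

Lemma dot_delta (w : V) j : dot w (delta_mx 0 j) = w 0 j.
Proof.
rewrite /dot (bigD1 j)//= big1 ?addr0 ?mxE ?eqxx ?mulr1// => k kj.
by rewrite mxE (negbTE kj) andbF mulr0.
Qed.

Lemma Re_hgrad c x v : complex.Re (hgrad c x v) = dot (rgrad c x) v.
Proof.
rewrite /dot cRe_sum; under [RHS]eq_bigr do rewrite mxE cRe_sum mulr_suml.
rewrite exchange_big /=; apply: eq_bigr => a _.
transitivity (\sum_j (complex.Re (c * p a * expi (dot (cfreq a) x) * (0 +i* (2 * pi)))) *
   (cfreq a 0 j * v 0 j)).
  by rewrite -mulr_sumr -/(dot _ _) ![complex.Re (_ * (_ +i* _))]cReM /=; ring.
apply: eq_bigr => j _; rewrite dot_delta ![complex.Re (_ * (_ +i* _))]cReM /=; ring.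
Qed.

Lemma hformE c x : hform c x = c * expi (- dot wmid x) * tsum x.
Proof.
rewrite mulr_sumr; apply: eq_bigr => a _; rewrite /lcoef dotDl dotNl expiD; ring.
Qed.

(** Stating differentiability along curves covers both the lines needed by the mean value theorem
    and the curves in the definition of [tangent]. *)
Lemma is_derive_rform c (gam : R -> V) (t : R) v : is_derive t (1 : R) gam v ->
  is_derive t (1 : R) (fun s => rform c (gam s)) (dot (rgrad c (gam t)) v).
Proof.
move=> dgam; rewrite -Re_hgrad.
pose wa a (y : R) : R := complex.Re (c * p a) * cos y - complex.Im (c * p a) * sin y.
have E x : rform c x = \sum_(a <- finsupp p) wa a (2 * pi * dot (cfreq a) x).
  rewrite /rform cRe_sum; apply: eq_bigr => a _; rewrite /wa expiE.
  by case: (c * p a) => u w; rewrite cReM.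
under eq_fun do rewrite E.
rewrite cRe_sum; elim: (finsupp p : seq _) => [|a r IH].
  by under eq_fun do rewrite big_nil; rewrite big_nil; exact: is_derive_cst.
under eq_fun do rewrite big_cons; rewrite big_cons; apply: is_deriveD.
have da : is_derive t (1 : R) (fun s => 2 * pi * dot (cfreq a) (gam s))
    (2 * pi * dot (cfreq a) v).
  by apply: is_deriveZ; exact: is_derive_dot.
have dw (y : R) : is_derive y (1 : R) (wa a)
   (- (complex.Re (c * p a) * sin y + complex.Im (c * p a) * cos y)).
  by rewrite opprD -mulrN; exact: is_deriveB.
have := @is_derive1_comp _ (wa a) (fun s => 2 * pi * dot (cfreq a) (gam s)) t _ _ (dw _) da.
congr is_derive; rewrite expiE; case: (c * p a) => u w; rewrite !(cReM, cImM) /=; ring.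
Qed.

Lemma continuous_hgrad c v : continuous (fun x => complex.Re (hgrad c x v)).
Proof.
have E x : complex.Re (hgrad c x v) = \sum_(a <- finsupp p) - (2 * pi * dot (cfreq a) v) *
   (complex.Re (c * p a) * sin (2 * pi * dot (cfreq a) x) +
    complex.Im (c * p a) * cos (2 * pi * dot (cfreq a) x)).
  rewrite /hgrad cRe_sum; apply: eq_bigr => a _.
  by rewrite expiE; case: (c * p a) => u w; rewrite !(cReM, cImM) /=; ring.
under eq_fun do rewrite E.
apply: (@continuous_sumr R V _ _ (fun a x => - (2 * pi * dot (cfreq a) v) *
   (complex.Re (c * p a) * sin (2 * pi * dot (cfreq a) x) +
    complex.Im (c * p a) * cos (2 * pi * dot (cfreq a) x)))) => a x.
have cd : {for x, continuous (fun x => 2 * pi * dot (cfreq a) x)}.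
  apply: (@continuousM R V (cst (2 * pi)) (dot (cfreq a))); first exact: cst_continuous.
  exact: dot_continuous.
have cs (f : R -> R) : continuous f ->
    {for x, continuous (fun x => f (2 * pi * dot (cfreq a) x))}.
  by move=> cf; apply: (@continuous_comp V R R (fun x => 2 * pi * dot (cfreq a) x) f) => //; exact: cf.
apply: (@continuousM R V (cst _) (fun x => complex.Re (c * p a) * sin (2 * pi * dot (cfreq a) x) +
    complex.Im (c * p a) * cos (2 * pi * dot (cfreq a) x))); first exact: cst_continuous.
apply: (@continuousD R R V (fun x => complex.Re (c * p a) * sin (2 * pi * dot (cfreq a) x))
   (fun x => complex.Im (c * p a) * cos (2 * pi * dot (cfreq a) x))).
  apply: (@continuousM R V (cst _) (fun x => sin (2 * pi * dot (cfreq a) x))); first exact: cst_continuous.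
  exact/cs/continuous_sin.
apply: (@continuousM R V (cst _) (fun x => cos (2 * pi * dot (cfreq a) x))); first exact: cst_continuous.
exact/cs/continuous_cos.
Qed.

Lemma continuous_rgrad c v : continuous (fun x => dot (rgrad c x) v).
Proof. by under eq_fun do rewrite -Re_hgrad; exact: continuous_hgrad. Qed.

Lemma continuous_rform c : continuous (rform c).
Proof.
have E x : rform c x = \sum_(a <- finsupp p)
   (complex.Re (c * p a) * cos (2 * pi * dot (cfreq a) x)
    - complex.Im (c * p a) * sin (2 * pi * dot (cfreq a) x)).
  rewrite /rform cRe_sum; apply: eq_bigr => a _; rewrite expiE.
  by case: (c * p a) => u w; rewrite cReM.
rewrite (_ : rform c = fun x => \sum_(a <- finsupp p)
   (complex.Re (c * p a) * cos (2 * pi * dot (cfreq a) x)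
    - complex.Im (c * p a) * sin (2 * pi * dot (cfreq a) x))); last exact/funext.
apply: (@continuous_sumr R V _ _ (fun a x =>
   (complex.Re (c * p a) * cos (2 * pi * dot (cfreq a) x)
    - complex.Im (c * p a) * sin (2 * pi * dot (cfreq a) x)))) => a x.
have cd : {for x, continuous (fun x => 2 * pi * dot (cfreq a) x)}.
  apply: (@continuousM R V (cst (2 * pi)) (dot (cfreq a))); first exact: cst_continuous.
  exact: dot_continuous.
have cs (f : R -> R) : continuous f ->
    {for x, continuous (fun x => f (2 * pi * dot (cfreq a) x))}.
  by move=> cf; apply: (@continuous_comp V R R (fun x => 2 * pi * dot (cfreq a) x) f) => //; exact: cf.
apply: (@continuousB R R V (fun x => complex.Re (c * p a) * cos (2 * pi * dot (cfreq a) x))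
   (fun x => complex.Im (c * p a) * sin (2 * pi * dot (cfreq a) x))).
  apply: (@continuousM R V (cst _) (fun x => cos (2 * pi * dot (cfreq a) x))); first exact: cst_continuous.
  exact/cs/continuous_cos.
apply: (@continuousM R V (cst _) (fun x => sin (2 * pi * dot (cfreq a) x))); first exact: cst_continuous.
exact/cs/continuous_sin.
Qed.

Section real.
Variable c : R[i].
Hypothesis c1 : `|c| = 1.
Hypothesis hform_real : forall x, complex.Im (hform c x) = 0.

Let c0 : c != 0. Proof. by rewrite -normr_eq0 c1 oner_eq0. Qed.

Lemma rform_eq0 x : (rform c x == 0) = (tsum x == 0).
Proof.
have -> : (rform c x == 0) = (hform c x == 0).
  apply/eqP/eqP => [h|h]; last by rewrite /rform h.
  by apply: complex_eqP => //; rewrite hform_real.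
by rewrite hformE (mulf_eq0 _ (tsum x)) (mulf_eq0 c) (negbTE c0) (negbTE (expi_neq0 _)).
Qed.

(** On the zero set the gradient is [gsum] times a factor independent of [v], so ratios of
    directional derivatives are ratios of values of [gsum]. *)
Lemma rgradE x v : tsum x = 0 ->
  (dot (rgrad c x) v)%:C = c * expi (- dot wmid x) * (0 +i* (2 * pi)) * gsum x v.
Proof.
move=> Fx.
(* Replacing c by - i c turns the imaginary part of [hform] into a real part; being identically
   zero, it has zero derivative along lines. *)
have hN z : hform (- (0 +i* 1) * c) z = - (0 +i* 1) * hform c z.
  by rewrite mulr_sumr; apply: eq_bigr => a _; ring.
have hgN z : hgrad (- (0 +i* 1) * c) z v = - (0 +i* 1) * hgrad c z v.
  by rewrite mulr_sumr; apply: eq_bigr => a _; ring.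
have Im0 : complex.Im (hgrad c x v) = 0.
  have [_ H1] := is_derive_rform (- (0 +i* 1) * c) (is_derive_line x v 0).
  have F0 : (fun s : R => rform (- (0 +i* 1) * c) (x + s *: v)) = cst 0.
    apply/funext => s; rewrite /rform hN /=; have := hform_real (x + s *: v).
    by case: (hform _ _) => u w /= ->; ring.
  have [_ H2] := is_derive_cst (0 : R) (0 : R) (1 : R).
  move: H1; rewrite F0 H2 scale0r addr0 -Re_hgrad hgN.
  by case: (hgrad _ _ _) => u w /= H; move: (esym H); lra.
rewrite -Re_hgrad; transitivity (hgrad c x v).
  by apply: complex_eqP.
transitivity (c * expi (- dot wmid x) * (0 +i* (2 * pi)) *
   (gsum x v - (dot wmid v)%:C * tsum x)); last by rewrite Fx mulr0 subr0.
rewrite [(dot wmid v)%:C * _]mulr_sumr -sumrB mulr_sumr; apply: eq_bigr => a _.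
have -> : 0 +i* (2 * pi * dot (cfreq a) v) =
   (0 +i* (2 * pi)) * ((dot (rV_int a) v)%:C - (dot wmid v)%:C).
  by rewrite dotDl dotNl; apply: complex_eqP; rewrite /=; ring.
by rewrite dotDl dotNl expiD /lcoef; ring.
Qed.

End real.

End real_form.

Lemma uniq_simple_roots (F : idomainType) (rs : seq F) :
  (forall z, z \in rs -> (\prod_(y <- rs) ('X - y%:P))^`().[z] != 0) -> uniq rs.
Proof.
elim: rs => [//|z rs IH] H; have E y : (\prod_(w <- z :: rs) ('X - w%:P))^`().[y] =
    (\prod_(w <- rs) ('X - w%:P)).[y] + (y - z) * (\prod_(w <- rs) ('X - w%:P))^`().[y].
  by rewrite big_cons derivM derivXsubC mul1r hornerD hornerM hornerXsubC.
have R0 y : ((\prod_(w <- rs) ('X - w%:P)).[y] == 0) = (y \in rs).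
  by rewrite -root_prod_XsubC rootE.
rewrite /= IH ?andbT.
  have := H z (mem_head _ _).
  by rewrite E subrr mul0r addr0 R0.
move=> y yrs; have := H y; rewrite inE yrs orbT => /(_ isT).
have /eqP Qy : (\prod_(w <- rs) ('X - w%:P)).[y] == 0 by rewrite R0.
by rewrite E Qy add0r mulf_eq0 negb_or => /andP[].
Qed.

(** * Zeros along an integer direction *)

Section good_directions.
Local Open Scope complex_scope.
Context {R : realType} {n : nat}.
Local Notation V := 'rV[R]_n.
Variables (p : laurent R n) (K : set V).
Hypothesis KZ : forall (t : R) x, 0 < t -> K x -> K (t *: x).
Hypothesis KD : forall x y, K x -> K y -> K (x + y).
Hypothesis pK : forall z : 'rV[R[i]]_n,
  K (map_mx (@complex.Re R) z) \/ K (- map_mx (@complex.Re R) z) ->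
  laurent_eval p (map_mx cexp z) != 0.
Variables (ap am : 'rV[int]_n).
Hypotheses (aps : ap \in finsupp p) (ams : am \in finsupp p).
Implicit Types (x v : V) (a b : 'rV[int]_n).

(* The shifts by the basis vectors stay in [K] so that a gradient orthogonal to [b] can be
   tested against every coordinate direction in [gsum_neq0]. *)
Definition good_dir b :=
  [/\ K (rV_int b),
      forall j, K (rV_int (b + delta_mx 0 j)) /\ K (rV_int (b - delta_mx 0 j)),
      forall a, a \in finsupp p -> a != ap -> idot a b < idot ap b &
      forall a, a \in finsupp p -> a != am -> idot am b < idot a b].

Lemma gsum_int x b : gsum p x (rV_int b) =
  \sum_(a <- finsupp p) lcoef p x a * (idot a b)%:~R.
Proof. by apply: eq_bigr => a _; rewrite dot_rV_int rmorph_int. Qed.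

Lemma gsumD x v v' : gsum p x (v + v') = gsum p x v + gsum p x v'.
Proof. by rewrite -big_split; apply: eq_bigr => a _; rewrite dotDr rmorphD /= mulrDr. Qed.

Lemma gsumZ x (t : R) v : gsum p x (t *: v) = t%:C * gsum p x v.
Proof. by rewrite mulr_sumr; apply: eq_bigr => a _; rewrite dotZr rmorphM /= mulrCA. Qed.

Lemma lcoef_shift x (t : R) b a :
  lcoef p (x + t *: rV_int b) a = lcoef p x a * expi t ^ idot a b.
Proof. by rewrite /lcoef dotDr dotZr dot_rV_int expiD expiMz mulrA. Qed.

Lemma linepoly0E x b M :
  linepoly p x 0 b b M = \sum_(a <- finsupp p) lcoef p x a *: 'X^(absz (idot a b + M)).
Proof.
by apply: eq_bigr => a _; rewrite mulr0 mul0r oppr0 expR0 mulr1.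
Qed.

Lemma linepoly_expi x b M (t : R) :
  (forall a, a \in finsupp p -> 0 <= idot a b + M) ->
  (linepoly p x 0 b b M).[expi t] = expi t ^ M * tsum p (x + t *: rV_int b).
Proof.
move=> HM; rewrite linepoly0E horner_sum mulr_sumr !big_seq.
apply: eq_bigr => a asupp; rewrite hornerZ hornerXn lcoef_shift.
rewrite [RHS]mulrCA -expfzDr ?expi_neq0// [M + _]addrC; congr (_ * _).
by rewrite -[in RHS](gez0_abs (HM _ asupp)).
Qed.

Lemma linepoly_deriv_expi x b M (t : R) :
  (forall a, a \in finsupp p -> 0 <= idot a b + M) ->
  expi t * (linepoly p x 0 b b M)^`().[expi t] =
  expi t ^ M * (gsum p (x + t *: rV_int b) (rV_int b) + M%:~R * tsum p (x + t *: rV_int b)).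
Proof.
move=> HM; rewrite linepoly0E raddf_sum /= horner_sum gsum_int !mulr_sumr -big_split /= mulr_sumr.
rewrite !big_seq; apply: eq_bigr => a asupp.
rewrite derivZ derivXn hornerZ hornerMn hornerXn lcoef_shift.
transitivity (lcoef p x a * ((absz (idot a b + M))%:R * expi t ^+ absz (idot a b + M))).
  rewrite mulrCA; congr (_ * _); rewrite -mulr_natl mulrCA.
  by case: (absz _) => [|k]; rewrite ?mul0r// -exprS.
have -> : (absz (idot a b + M))%:R = (idot a b + M)%:~R :> R[i].
  by rewrite pmulrn gez0_abs// HM.
have -> : expi t ^+ absz (idot a b + M) = expi t ^ M * expi t ^ idot a b.
  by rewrite -expfzDr ?expi_neq0// [M + _]addrC -[in RHS](gez0_abs (HM _ asupp)).
rewrite intrD; set u := expi t ^ M; set w := expi t ^ idot a b; ring.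
Qed.

Section direction.
Variable b : 'rV[int]_n.
Hypothesis bgood : good_dir b.

(** In a good direction this shift makes [am] the constant term and [ap] the leading one, and
    neither coefficient vanishes for any [x]. *)
Definition dirpoly x := linepoly p x 0 b b (- idot am b).
Definition dirdeg := absz (idot ap b - idot am b).

Let HM a : a \in finsupp p -> 0 <= idot a b + - idot am b.
Proof.
move=> asupp; rewrite subr_ge0; case: bgood => _ _ _ H.
by have [->//|/(H _ asupp)/ltW] := eqVneq a am.
Qed.

Let Hdeg a : a \in finsupp p -> (absz (idot a b - idot am b) <= dirdeg)%N.
Proof.
move=> asupp; rewrite -lez_nat !gez0_abs ?HM// lerD2r; case: bgood => _ _ H _.
by have [->//|/(H _ asupp)/ltW] := eqVneq a ap.
Qed.

Let Hdeg_eq a : a \in finsupp p -> (absz (idot a b - idot am b) == dirdeg) = (a == ap).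
Proof.
move=> asupp; apply/eqP/eqP => [|->//] => E; apply/eqP; apply: contraTT isT => aap.
case: bgood => _ _ /(_ _ asupp aap) H _.
have : (absz (idot a b - idot am b))%:Z = dirdeg%:Z by rewrite E.
by rewrite !gez0_abs ?HM// => /addIr E'; rewrite E' ltxx in H.
Qed.

Let Hdeg_eq0 a : a \in finsupp p -> (absz (idot a b - idot am b) == 0)%N = (a == am).
Proof.
move=> asupp; apply/eqP/eqP => [|->]; last by rewrite subrr.
move=> /eqP; rewrite absz_eq0 subr_eq0 => /eqP E; apply/eqP; apply: contraTT isT => aam.
by case: bgood => _ _ _ /(_ _ asupp aam); rewrite E ltxx.
Qed.

Let coefE x i : (dirpoly x)`_i =
  \sum_(a <- finsupp p) lcoef p x a * (i == absz (idot a b - idot am b))%:R.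
Proof.
rewrite /dirpoly linepoly0E coef_sum; apply: eq_bigr => a _.
by rewrite coefZ coefXn.
Qed.

Let lcoef_neq0 x a : a \in finsupp p -> lcoef p x a != 0.
Proof. by rewrite mem_finsupp => pa; rewrite mulf_neq0// expi_neq0. Qed.

Let coef_only x i a0 : a0 \in finsupp p ->
  (forall a, a \in finsupp p -> (i == absz (idot a b - idot am b)) = (a == a0)) ->
  (dirpoly x)`_i = lcoef p x a0.
Proof.
move=> a0s H; rewrite coefE (bigD1_seq a0 a0s (fset_uniq _)) /= (H _ a0s) eqxx mulr1.
rewrite big_seq_cond big1 ?addr0// => a /andP[asupp /negbTE aa].
by rewrite H// aa mulr0.
Qed.

Let coef_top x : (dirpoly x)`_dirdeg = lcoef p x ap.
Proof. by apply: coef_only => // a asupp; rewrite eq_sym Hdeg_eq. Qed.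

Lemma dirpoly_coef0 x : (dirpoly x)`_0 = lcoef p x am.
Proof. by apply: coef_only => // a asupp; rewrite eq_sym Hdeg_eq0. Qed.

Lemma size_dirpoly x : size (dirpoly x) = dirdeg.+1.
Proof.
apply/eqP; rewrite eqn_leq; apply/andP; split.
  apply/leq_sizeP => j jd; rewrite coefE big_seq big1// => a /Hdeg ad.
  by rewrite gtn_eqF ?mulr0//; lia.
rewrite ltnNge; apply/negP => /leq_sizeP/(_ _ (leqnn _)) /eqP.
by rewrite coef_top (negbTE (lcoef_neq0 _ aps)).
Qed.

Lemma lead_coef_dirpoly x : lead_coef (dirpoly x) = lcoef p x ap.
Proof. by rewrite lead_coefE size_dirpoly coef_top. Qed.

Lemma dirpoly_roots x : exists2 rs : seq R[i],
  dirpoly x = lcoef p x ap *: \prod_(z <- rs) ('X - z%:P) &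
  size rs = dirdeg /\ forall z, z \in rs -> `|z| = 1.
Proof.
have [rs E] := closed_field_poly_normal (dirpoly x).
rewrite lead_coef_dirpoly in E; exists rs => //; split.
  have := size_dirpoly x.
  by rewrite E size_scale ?lcoef_neq0// size_prod_XsubC => -[].
move=> z zrs; have rz : root (dirpoly x) z.
  by rewrite E rootZ ?lcoef_neq0// root_prod_XsubC.
case: bgood => Kb _ _ _.
have [z0|//] := linepoly_root_unit KZ pK HM Kb rz.
by move: rz; rewrite rootE z0 horner_coef0 dirpoly_coef0 (negbTE (lcoef_neq0 _ ams)).
Qed.

(* All roots of the restriction being unimodular, it is self-inversive; the constant is a
   square root of the ratio of its extreme coefficients. *)
Lemma hform_unit : exists2 c : R[i], `|c| = 1 & forall x, complex.Im (hform p ap am c x) = 0.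
Proof.
have pap : p ap != 0 by rewrite -mem_finsupp.
have pam : p am != 0 by rewrite -mem_finsupp.
pose kap := Num.conj (p ap) / p am.
have P1 x : (dirpoly x).[1] = tsum p x.
  rewrite /dirpoly -(@expi0 R) linepoly_expi// expi0 exp1rz mul1r scale0r addr0.
  done.
have H x : lcoef p x am * Num.conj (tsum p x) = Num.conj (lcoef p x ap) * tsum p x /\
    `|lcoef p x am| = `|lcoef p x ap|.
  have [rs E [_ Hrs]] := dirpoly_roots x.
  have := unimodular_roots (lcoef p x ap) Hrs; rewrite /= -E.
  by rewrite P1 horner_coef0 dirpoly_coef0.
have nkap : `|kap| = 1.
  have [_] := H 0; rewrite /lcoef (normrM (p am)) (normrM (p ap)) !norm_expi !mulr1 => E.
  by rewrite /kap normrM normfV norm_conjC -E mulfV// normr_eq0.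
have kap0 : kap != 0 by rewrite -normr_eq0 nkap oner_eq0.
have [w wk nw] := cexp_surj kap0.
have {}nw : complex.Re w = 0.
  move: nw; rewrite nkap => -[] /(congr1 (@ln R)); rewrite ln1 expRK.
  by move=> <-.
(* Halving the argument of [kap] gives a square root; [expi] already contains the factor [2 * pi],
   hence [4 * pi]. *)
pose c := expi (complex.Im w / (4 * pi)).
have cc : c * c = kap.
  rewrite -wk /c -expiD /expi; congr cexp.
  have pi0 : (pi : R) != 0 by rewrite gt_eqF// pi_gt0.
  apply: complex_eqP; first by rewrite nw.
  by rewrite /=; move: (pi : R) pi0 => q q0; field.
exists c; first exact: norm_expi.
move=> x; have [{}H _] := H x.
suff : Num.conj (hform p ap am c x) = hform p ap am c x.
  by case: (hform _ _ _ _ _) => u t [] /= E; lra.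
have cE t : Num.conj (expi t) = expi (- t) :> R[i] by exact: conj_expi.
have cM (z z' : R[i]) : Num.conj (z * z') = Num.conj z * Num.conj z' by exact: rmorphM.
have F : Num.conj (tsum p x) = kap * expi (- (dot (wmid ap am) x + dot (wmid ap am) x)) * tsum p x.
  have H0 : p am * expi (dot (rV_int am) x) * Num.conj (tsum p x) =
      Num.conj (p ap) * expi (- dot (rV_int ap) x) * tsum p x.
    by rewrite -cE -cM; exact: H.
  apply: (mulfI (mulf_neq0 pam (expi_neq0 (dot (rV_int am) x)))); rewrite H0.
  have -> : expi (- dot (rV_int ap) x) = expi (dot (rV_int am) x) *
      expi (- (dot (wmid ap am) x + dot (wmid ap am) x)).
    by rewrite -expiD; congr expi; rewrite /wmid dotZl dotDl; lra.
  rewrite /kap; move: (Num.conj (p ap)) (expi _) (expi _) (tsum p x) => q u w' T.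
  by field.
rewrite hformE (cM _ (tsum p x)) (cM c) F cE opprK /c cE -/c.
rewrite -cc opprD expiD /c; set u := complex.Im w / _.
have e1 : expi (- u) * expi u = 1 by rewrite -expiD addNr expi0.
have e2 : expi (dot (wmid ap am) x) * expi (- dot (wmid ap am) x) = 1.
  by rewrite -expiD subrr expi0.
transitivity ((expi (- u) * expi u) * (expi (dot (wmid ap am) x) * expi (- dot (wmid ap am) x)) *
   (expi u * expi (- dot (wmid ap am) x) * tsum p x)); last by rewrite e1 e2 !mul1r.
set A := expi u; set B := expi _; set C := expi _; set E := expi _; ring.
Qed.

Hypothesis preg : regular p.

(** On the torus, [gsum] along the [j]-th basis vector is z_j times the [j]-th partial derivative of
    [p], so the claim is regularity at a zero. *)
Lemma gsum_delta_neq0 x : tsum p x = 0 -> exists j, gsum p x (delta_mx 0 j) != 0.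
Proof.
move=> Fx; apply/existsP; apply: contraT; rewrite negb_exists => /forallP H.
exfalso; apply: (preg (u := \row_j cexp (0 +i* (2 * pi * x 0 j)))).
  by move=> j; rewrite mxE norm_expi.
split; first by rewrite laurent_evalE.
move=> j; have /negPn/eqP := H j; rewrite /gsum => Hj.
rewrite -[RHS](mulr0 (expi (- x 0 j))) -Hj mulr_sumr.
apply: eq_bigr => a _; rewrite /lcoef dot_delta mxE rmorph_int.
have -> : monomial (a - delta_mx 0 j) (\row_j cexp (0 +i* (2 * pi * x 0 j))) =
    expi (dot (rV_int a) x) * expi (- x 0 j).
  rewrite -expiD -(dot_delta x j) [dot x _]dotC -dotNl.
  have -> : - delta_mx 0 j = rV_int (- delta_mx 0 j) :> V.
    by apply/rowP => i; rewrite !mxE rmorphN /=; case: eqP.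
  rewrite -dotDl -rV_intD /monomial /dot.
  transitivity (\prod_i expi (x 0 i * ((a - delta_mx 0 j) 0 i)%:~R)).
    by apply: eq_bigr => i _; rewrite mxE expiMz.
  rewrite (big_morph expi (@expiD R) (@expi0 R)).
  by apply: eq_bigr => i _; rewrite [in RHS]mxE mulrC.
rewrite -[p a *~ _]mulrzr; set u := expi _; set w := expi _; ring.
Qed.

(** If [gsum] vanished along [b], its values along [b + e_j] and [b - e_j] would be opposite, and
    [lee_yang_transversal] with constant 1 would make them zero for every [j], against
    regularity. *)
Lemma gsum_neq0 x : tsum p x = 0 -> gsum p x (rV_int b) != 0.
Proof.
move=> Fx; apply/negP => /eqP gb; have [j /negP gj] := gsum_delta_neq0 Fx.
case: bgood => Kb /(_ j)[Kp Km] _ _.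
have dj : (rV_int (delta_mx 0 j) : V) = delta_mx 0 j.
  by apply/rowP => i; rewrite !mxE; case: (_ && _).
have E1 : gsum p x (rV_int (b + delta_mx 0 j)) = gsum p x (delta_mx 0 j).
  by rewrite rV_intD gsumD gb add0r dj.
have E2 : gsum p x (rV_int (b - delta_mx 0 j)) = - gsum p x (delta_mx 0 j).
  by rewrite rV_intD rV_intN gsumD gb add0r dj -scaleN1r gsumZ rmorphN rmorph1 mulN1r.
apply: gj; rewrite -oppr_eq0 -E2 gsum_int; apply/eqP.
apply: (lee_yang_transversal KZ KD pK (@ltr01 R) Kp Km Fx).
by rewrite -!gsum_int E1 E2 rmorph1 mul1r opprK.
Qed.

Lemma dirpoly_deriv_neq0 x (t : R) : root (dirpoly x) (expi t) ->
  (dirpoly x)^`().[expi t] != 0.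
Proof.
rewrite rootE linepoly_expi// mulf_eq0 expfz_eq0 (negbTE (expi_neq0 t)) andbF /= => /eqP Fx.
suff : expi t * (dirpoly x)^`().[expi t] != 0 by rewrite mulf_eq0 negb_or => /andP[].
rewrite linepoly_deriv_expi// Fx mulr0 addr0 mulf_neq0// ?expfz_neq0 ?expi_neq0//.
exact: gsum_neq0.
Qed.

(** The non-vanishing extreme coefficients fix the number of roots for all [x], and simplicity makes
    it the number of distinct parameters in [0, 1). *)
Lemma dir_zeros x : exists ts : seq R,
  [/\ sorted <%R ts, size ts = dirdeg,
      forall t, (t \in ts) = (0 <= t < 1) && (tsum p (x + t *: rV_int b) == 0) &
      dirpoly x = lcoef p x ap *: \prod_(t <- ts) ('X - (expi t)%:P)].
Proof.
have [rs E [srs nrs]] := dirpoly_roots x.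
have rootP z : (z \in rs) = root (dirpoly x) z.
  by rewrite E rootZ ?lcoef_neq0// root_prod_XsubC.
have zroot t : root (dirpoly x) (expi t) = (tsum p (x + t *: rV_int b) == 0).
  by rewrite rootE linepoly_expi// mulf_eq0 expfz_eq0 (negbTE (expi_neq0 t)) andbF.
have /choice[arg Harg] (z : R[i]) : exists t, z \in rs -> 0 <= t < 1 /\ expi t = z.
  have [zrs|] := boolP (z \in rs); last by exists 0.
  by have [t t01 tz] := expi_surj (nrs _ zrs); exists t.
have urs : uniq rs.
  apply: uniq_simple_roots => z zrs; have [_ tz] := Harg _ zrs.
  have := @dirpoly_deriv_neq0 x (arg z); rewrite tz -rootP => /(_ zrs).
  by rewrite E derivZ hornerZ mulf_eq0 negb_or => /andP[].
have umap : uniq (map arg rs).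
  rewrite map_inj_in_uniq// => z w zrs wrs E'.
  by rewrite -(Harg z zrs).2 -(Harg w wrs).2 E'.
have pE : perm_eq (sort <=%R (map arg rs)) (map arg rs) by exact/permPl/perm_sort.
exists (sort <=%R (map arg rs)); split.
- by rewrite sort_lt_sorted.
- by rewrite size_sort size_map.
- move=> t; rewrite mem_sort; apply/mapP/andP => [[z zrs ->]|[t01 Ft]].
    by have [? tz] := Harg _ zrs; rewrite -zroot tz -rootP.
  have trs : expi t \in rs by rewrite rootP zroot.
  exists (expi t) => //; have [h1 h2] := Harg _ trs.
  exact: expi_inj.
- rewrite (perm_big _ pE) big_map E; congr (_ *: _).
  by rewrite big_seq [RHS]big_seq; apply: eq_bigr => z zrs; rewrite (Harg _ zrs).2.
Qed.

End direction.

End good_directions.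

(** * Trigonometric polynomials *)

Section trig_polynomials.
Local Open Scope complex_scope.
Context {R : realType} {n : nat}.
Local Notation V := 'rV[R]_n.
Implicit Types (Q : 'rV[int]_n -> Prop) (f : V -> R[i]).

(** Only a condition on the frequencies is recorded: excluding the frequency 0 already makes the
    integral over the cube vanish, whatever the coefficients. *)
Definition trig_poly Q f := exists2 s : seq (R[i] * 'rV[int]_n),
  forall cq, cq \in s -> Q cq.2 &
  forall x, f x = \sum_(cq <- s) cq.1 * expi (dot (rV_int cq.2) x).

Lemma trig_poly_ext Q f g : f =1 g -> trig_poly Q f -> trig_poly Q g.
Proof. by move=> fg [s sQ sE]; exists s => // x; rewrite -fg. Qed.

Lemma trig_poly0 Q : trig_poly Q (fun=> 0).
Proof. by exists [::] => // x; rewrite big_nil. Qed.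

Lemma trig_polyD Q f g : trig_poly Q f -> trig_poly Q g -> trig_poly Q (fun x => f x + g x).
Proof.
move=> [s sQ sE] [r rQ rE]; exists (s ++ r) => [cq|x].
  by rewrite mem_cat => /orP[/sQ|/rQ].
by rewrite big_cat sE rE.
Qed.

Lemma trig_poly_sum Q (I : eqType) (r : seq I) (f : I -> V -> R[i]) :
  (forall i, i \in r -> trig_poly Q (f i)) -> trig_poly Q (fun x => \sum_(i <- r) f i x).
Proof.
elim: r => [|i r IH] H.
  by apply: trig_poly_ext (trig_poly0 Q) => x; rewrite big_nil.
have H1 : trig_poly Q (f i) by apply: H; rewrite mem_head.
have H2 : trig_poly Q (fun x => \sum_(i <- r) f i x).
  by apply: IH => j jr; apply: H; rewrite inE jr orbT.
by apply: trig_poly_ext (trig_polyD H1 H2) => x; rewrite big_cons.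
Qed.

Lemma trig_polyM Q Q' (c : R[i]) q0 f : (forall q, Q q -> Q' (q0 + q)) -> trig_poly Q f ->
  trig_poly Q' (fun x => c * expi (dot (rV_int q0) x) * f x).
Proof.
move=> QQ' [s sQ sE]; exists [seq (c * cq.1, q0 + cq.2) | cq <- s] => [cq|x].
  by move=> /mapP[d ds ->] /=; exact/QQ'/sQ.
rewrite big_map sE mulr_sumr; apply: eq_bigr => -[d q] _ /=.
rewrite rV_intD dotDl expiD.
by move: (expi _) (expi _) => u w; ring.
Qed.

Lemma trig_polyZ Q (c : R[i]) f : trig_poly Q f -> trig_poly Q (fun x => c * f x).
Proof.
move=> H; have H' q : Q q -> Q (0 + q) by rewrite add0r.
apply: trig_poly_ext (trig_polyM c H' H) => x.
have -> : (rV_int 0 : V) = 0 by apply/rowP => j; rewrite !mxE.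
by rewrite dotC dot0r expi0 mulr1.
Qed.

Lemma trig_poly_mono Q c q : Q q -> trig_poly Q (fun x => c * expi (dot (rV_int q) x)).
Proof.
move=> Qq; exists [:: (c, q)] => [cq|x]; first by rewrite inE => /eqP ->.
by rewrite big_seq1.
Qed.

(** The phase [pi / 2] yields the sine, hence the real part of every exponential with a complex
    coefficient. *)
Lemma integral_trig_cos (q : 'rV[int]_n) (c : R) : q != 0 ->
  (lebesgue_rV n).-integrable unit_cube (fun x => (cos (2 * pi * dot (rV_int q) x + c))%:E) /\
  (\int[lebesgue_rV n]_(x in unit_cube) (cos (2 * pi * dot (rV_int q) x + c))%:E = 0)%E.
Proof.
move=> q0; have mC := @measurable_unit_cube R n.
have C1 : lebesgue_rV n (@unit_cube R n) = 1%E by exact: lebesgue_rV_cube.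
have mcos : measurable_fun (@unit_cube R n) (fun x : V => (cos (2 * pi * dot (rV_int q) x + c))%:E).
  apply/measurable_EFinP; apply: (@measurable_funS _ _ _ _ setT) => //.
  apply: continuous_measurable_rV => x.
  apply: (@continuous_comp V R R (fun x => 2 * pi * dot (rV_int q) x + c) cos);
    last exact: continuous_cos.
  apply: (@continuousD R R V (fun x => 2 * pi * dot (rV_int q) x) (cst c)); last exact: cst_continuous.
  apply: (@continuousM R V (cst (2 * pi)) (dot (rV_int q))); first exact: cst_continuous.
  exact: dot_continuous.
have i1 : (lebesgue_rV n).-integrable (@unit_cube R n) (cst 1%E).
  apply/integrableP; split; first exact: measurable_cst.
  rewrite (eq_integral (cst 1%E)) => [|x _]; last by rewrite /= normr1.
  by rewrite integral_cst// mul1e [X in (X < _)%E]C1 ltry.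
have ic : (lebesgue_rV n).-integrable (@unit_cube R n)
    (fun x => (cos (2 * pi * dot (rV_int q) x + c))%:E).
  apply: (le_integrable mC mcos _ i1) => x _ /=.
  by rewrite lee_fin normr1 ler_norml cos_geN1 cos_le1.
split=> //.
have := integral_unit_cube_cos c q0.
under eq_integral do rewrite EFinD.
rewrite integralD// integral_cst// mul1e [X in (X + _)%E]C1.
case: (integral _ _ _) => //= r [] /eqP; rewrite -subr_eq0 addrAC subrr add0r => /eqP -> //.
Qed.

Lemma integral_trig_poly Q f : ~ Q 0 -> trig_poly Q f ->
  (lebesgue_rV n).-integrable unit_cube (fun x => (complex.Re (f x))%:E) /\
  (\int[lebesgue_rV n]_(x in unit_cube) (complex.Re (f x))%:E = 0)%E.
Proof.
move=> Q0 [s sQ sE]; have mC := @measurable_unit_cube R n.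
under eq_fun do rewrite sE.
elim: s sQ {sE} => [|[c q] s IH] sQ.
  under eq_fun do rewrite big_nil.
  by rewrite integral0; split => //; exact: integrable0.
have q0 : q != 0.
  by apply: contra_notN Q0 => /eqP <-; exact: (sQ _ (mem_head _ _)).
have [{}IH1 IH2] := IH (fun cq h => sQ cq (mem_behead (s := (c, q) :: s) h)).
have E x : (complex.Re (\sum_(cq <- (c, q) :: s) cq.1 * expi (dot (rV_int cq.2) x)))%:E =
   ((complex.Re c)%:E * (cos (2 * pi * dot (rV_int q) x + 0))%:E +
   ((complex.Im c)%:E * (cos (2 * pi * dot (rV_int q) x + pi / 2))%:E +
   (complex.Re (\sum_(cq <- s) cq.1 * expi (dot (rV_int cq.2) x)))%:E))%E.
  rewrite big_cons cReD -!EFinM -!EFinD; congr EFin; rewrite addrA; congr (_ + _).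
  by rewrite /= cosDpihalf addr0 expiE cReM /= mulrN.
under eq_fun do rewrite E.
have [i1 z1] := integral_trig_cos 0 q0.
have [i2 z2] := integral_trig_cos (pi / 2) q0.
have j1 := integrableZl mC (complex.Re c) i1.
have j2 := integrableZl mC (complex.Im c) i2.
have j3 := integrableD mC j2 IH1.
split; first exact: integrableD.
by rewrite integralD// integralD// !integralZl// z1 z2 IH2 !mule0 !add0e.
Qed.

End trig_polynomials.

Section ratio_sums.
Local Open Scope complex_scope.
Context {R : realType} {n : nat}.
Local Notation V := 'rV[R]_n.
Variables (p : laurent R n) (K : set V).
Hypothesis KZ : forall (t : R) x, 0 < t -> K x -> K (t *: x).
Hypothesis KD : forall x y, K x -> K y -> K (x + y).
Hypothesis pK : forall z : 'rV[R[i]]_n,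
  K (map_mx (@complex.Re R) z) \/ K (- map_mx (@complex.Re R) z) ->
  laurent_eval p (map_mx cexp z) != 0.
Variables (ap am : 'rV[int]_n).
Hypotheses (aps : ap \in finsupp p) (ams : am \in finsupp p).
Hypothesis preg : regular p.
Variable b : 'rV[int]_n.
Hypothesis bgood : good_dir p K ap am b.
Variable ts : V -> seq R.
Hypothesis ts_sorted : forall x, sorted <%R (ts x).
Hypothesis ts_size : forall x, size (ts x) = dirdeg ap am b.
Hypothesis tsP : forall x t,
  (t \in ts x) = (0 <= t < 1) && (tsum p (x + t *: rV_int b) == 0).
Hypothesis ts_poly : forall x, dirpoly p am b x =
  lcoef p x ap *: \prod_(t <- ts x) ('X - (expi t)%:P).
Variable Cn : 'rV[int]_n -> Prop.
Hypothesis Cn0 : Cn 0.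
Hypothesis CnD : forall q q', Cn q -> Cn q' -> Cn (q + q').
Hypothesis Cnap : forall a, a \in finsupp p -> Cn (ap - a).

Let sm m x := \sum_(t <- ts x) expi t ^+ m / (dirpoly p am b x)^`().[expi t].

Let lap_neq0 x : lcoef p x ap != 0.
Proof. by move: aps; rewrite mem_finsupp => pa; rewrite mulf_neq0// expi_neq0. Qed.

Let HM a : a \in finsupp p -> 0 <= idot a b - idot am b.
Proof.
move=> asupp; rewrite subr_ge0; case: bgood => _ _ _ H.
by have [->//|/(H _ asupp)/ltW] := eqVneq a am.
Qed.

(** Below the degree, Lagrange interpolation leaves at most the frequency [- ap], coming from the
    inverse of the leading coefficient. Each step of the recurrence adds some [a - ap], the opposite
    of an element of [Cn], so frequencies stay in [- ap - Cn]. *)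
Let sm_trig m : trig_poly (fun q => Cn (- ap - q)) (sm m).
Proof.
have E x : dirpoly p am b x = lcoef p x ap *: \prod_(z <- map expi (ts x)) ('X - z%:P).
  by rewrite big_map ts_poly.
have uts x : uniq (map expi (ts x)).
  rewrite map_inj_in_uniq.
    by have := ts_sorted x; rewrite lt_sorted_uniq_le => /andP[].
  by move=> s t; rewrite !tsP => /andP[s01 _] /andP[t01 _]; exact: expi_inj.
have smE k x : sm k x = \sum_(z <- map expi (ts x)) z ^+ k /
   (lcoef p x ap *: \prod_(z <- map expi (ts x)) ('X - z%:P))^`().[z].
  by rewrite -E big_map.
have stx x : size (map expi (ts x)) = dirdeg ap am b by rewrite size_map.
have inv_lap x : (lcoef p x ap)^-1 = (p ap)^-1 * expi (dot (rV_int (- ap)) x).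
  by rewrite /lcoef invfM rV_intN dotNl expiN.
elim/ltn_ind: m => m IH; have [md|dm] := ltnP m (dirdeg ap am b).
  apply: (@trig_poly_ext _ _ _ (fun x =>
     ((m == (dirdeg ap am b).-1)%:R * (p ap)^-1) * expi (dot (rV_int (- ap)) x))).
    by move=> x; rewrite smE sum_expr_div_deriv ?stx// inv_lap -mulrA.
  by apply: trig_poly_mono; rewrite subrr.
rewrite -(subnK dm); set m' := (m - _)%N.
apply: (@trig_poly_ext _ _ _ (fun x => \sum_(i <- index_iota 0 (dirdeg ap am b))
   \sum_(a <- finsupp p) (- ((p ap)^-1 * p a * (i == absz (idot a b - idot am b))%:R)) *
      expi (dot (rV_int (a - ap)) x) * sm (m' + i)%N x)).
  move=> x; rewrite smE -(stx x) sum_expr_div_deriv_rec// stx big_mkord mulr_sumr.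
  apply: eq_bigr => i _; rewrite -smE -E /dirpoly linepoly0E coef_sum mulr_suml mulr_sumr.
  apply: eq_bigr => a _; rewrite coefZ coefXn inv_lap /lcoef.
  rewrite rV_intD dotDl expiD.
  by move: (expi _) (expi _) (sm _ _) => u w s; ring.
apply: trig_poly_sum => i; rewrite mem_index_iota => /andP[_ id].
apply: trig_poly_sum => a asupp.
apply: (@trig_polyM _ _ (fun q => Cn (- ap - q))); last first.
  by apply: IH; rewrite -(subnK dm) ltn_add2l.
move=> q Cq; have -> : - ap - (a - ap + q) = (- ap - q) + (ap - a).
  by apply/rowP => j; rewrite !mxE; ring.
by apply: CnD => //; exact: Cnap.
Qed.

(** At a root z the denominator is z P'(z) z^<am,b>, while the exponential contributes z^(-<k,b>).
    The power of z in the term of index [a] is thus <a,b> - <am,b> - <k,b> - 1, which is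
    non-negative precisely thanks to <k,b> < 0; this brings the sum under [sm_trig]. *)
Lemma ratio_sum_trig (k : 'rV[int]_n) (v : V) : idot k b < 0 ->
  trig_poly (fun q => Cn (- k - q)) (fun x => \sum_(t <- ts x)
    expi (- dot (rV_int k) (x + t *: rV_int b)) *
    (gsum p (x + t *: rV_int b) v / gsum p (x + t *: rV_int b) (rV_int b))).
Proof.
move=> kb; pose ma (a : 'rV[int]_n) := absz (idot a b - idot am b - idot k b - 1)%R.
have maE a : a \in finsupp p -> (ma a)%:Z = idot a b - idot am b - idot k b - 1.
  by move=> /HM h; rewrite /ma gez0_abs//; lia.
apply: (@trig_poly_ext _ _ _ (fun x => \sum_(a <- finsupp p)
    (p a * (dot (rV_int a) v)%:C) * expi (dot (rV_int (a - k)) x) * sm (ma a) x)); last first.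
  apply: trig_poly_sum => a asupp.
  apply: (@trig_polyM _ _ (fun q => Cn (- ap - q))); last exact: sm_trig.
  move=> q Cq; have -> : - k - (a - k + q) = (- ap - q) + (ap - a).
    by apply/rowP => j; rewrite !mxE; ring.
  by apply: CnD => //; exact: Cnap.
move=> x; under eq_bigr do rewrite mulr_sumr.
rewrite exchange_big /= big_seq [RHS]big_seq; apply: eq_bigr => t tts.
have Ft : tsum p (x + t *: rV_int b) = 0 by apply/eqP; move: tts; rewrite tsP => /andP[].
have g0 := gsum_neq0 KZ KD pK bgood preg Ft.
have := linepoly_deriv_expi x t HM; rewrite Ft mulr0 addr0 -/(dirpoly p am b x).
set d := (_^`()).[_]; set z := expi t => Ed.
have z0 : z != 0 by exact: expi_neq0.
have d0 : d != 0.
  apply: contra_neq g0 => d0; move: Ed; rewrite d0 mulr0 => /esym/eqP.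
  by rewrite mulf_eq0 expfz_eq0 (negbTE z0) andbF /= => /eqP.
have Eg : gsum p (x + t *: rV_int b) (rV_int b) = z * d * z ^ idot am b.
  by rewrite Ed mulrAC -expfzDr// addNr expr0z mul1r.
have -> : expi (- dot (rV_int k) (x + t *: rV_int b)) = expi (- dot (rV_int k) x) * z ^ (- idot k b).
  by rewrite dotDr dotZr dot_rV_int opprD expiD -expiMz intrN mulrN.
rewrite Eg /gsum mulr_suml mulr_sumr big_seq [RHS]big_seq; apply: eq_bigr => a asupp.
rewrite lcoef_shift rV_intD rV_intN dotDl dotNl expiD /lcoef -/z.
have -> : z ^+ ma a = z ^ idot a b * (z ^ idot am b)^-1 * z ^ (- idot k b) * (z ^ 1)^-1.
  by rewrite !invr_expz -!expfzDr// -(maE _ asupp).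
rewrite expr1z !invfM; move: (expi _) (expi _) (z ^ idot a b) (z ^ idot am b) (z ^ (- _)) => u w z1 z2 z3.
by ring.
Qed.

End ratio_sums.

(** * The measure carried by the roots *)

Section density.
Local Open Scope complex_scope.
Local Open Scope ereal_scope.
Context d (T : measurableType d) (R : realType).
Variable nu : {measure set T -> \bar R}.
Variable f : T -> R.
Hypothesis mf : measurable_fun setT f.
Hypothesis f0 : forall x, (0 <= f x)%R.

Definition density (A : set T) : \bar R := \int[nu]_(x in A) (f x)%:E.

Let density0 : density set0 = 0. Proof. exact: integral_set0. Qed.

Let density_ge0 A : 0 <= density A.
Proof. by apply: integral_ge0 => x _; rewrite lee_fin. Qed.

Let density_sigma_additive : semi_sigma_additive density.
Proof.
apply: semi_sigma_additive_nng_induced; first exact/measurable_EFinP.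
by move=> x; rewrite lee_fin.
Qed.

Definition density_measure : {measure set T -> \bar R} :=
  HB.pack density (isMeasure.Build _ _ _ density density0 density_ge0 density_sigma_additive).

Import HBNNSimple.

Lemma ge0_integral_density D (g : T -> \bar R) : measurable D ->
  measurable_fun D g -> (forall x, D x -> 0 <= g x) ->
  \int[density_measure]_(x in D) g x = \int[nu]_(x in D) (g x * (f x)%:E).
Proof.
move=> mD mg g0; pose g_ := nnsfun_approx mD mg.
have mfD : measurable_fun D (fun x => (f x)%:E).
  by apply/measurable_EFinP; exact: measurable_funTS.
have mgD k : measurable_fun D (fun x => (g_ k x)%:E).
  by apply/measurable_EFinP; exact: measurable_funTS.
transitivity (limn (fun k => \int[density_measure]_(x in D) (g_ k x)%:E)).
  rewrite -monotone_convergence//.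
  - apply: eq_integral => y /[!inE] yD; apply/esym/cvg_lim => //.
    by apply: cvg_nnsfun_approx.
  - by move=> k y _; rewrite lee_fin.
  - by move=> y _ i j ij; rewrite lee_fin; exact/lefP/nd_nnsfun_approx.
transitivity (limn (fun k => \int[nu]_(x in D) ((g_ k x)%:E * (f x)%:E))); last first.
  rewrite -monotone_convergence//.
  - apply: eq_integral => y /[!inE] yD; apply/cvg_lim => //.
    by apply: cvgeZr => //; exact: cvg_nnsfun_approx.
  - by move=> k; exact: emeasurable_funM.
  - by move=> k y _; rewrite mule_ge0// lee_fin.
  - move=> y _ i j ij; rewrite lee_wpmul2r// lee_fin//.
    exact/lefP/nd_nnsfun_approx.
congr (limn _); apply/funext => k.
have mg_ r : measurable (g_ k @^-1` [set r]) by exact: measurable_funPTI.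
under eq_integral do rewrite fimfunE -fsumEFin//.
rewrite ge0_integral_fsum//; last 2 first.
- by move=> y; exact/measurable_EFinP/measurable_funM.
- by move=> y x _; rewrite nnfun_muleindic_ge0.
transitivity (\sum_(r \in range (g_ k))
    \int[nu]_(x in D) ((r * \1_(g_ k @^-1` [set r]) x)%:E * (f x)%:E)); last first.
  rewrite -ge0_integral_fsum//.
  - apply: eq_integral => x _; rewrite [in RHS]fimfunE -fsumEFin//.
    by rewrite ge0_mule_fsuml// => r; rewrite nnfun_muleindic_ge0.
  - move=> r; apply: emeasurable_funM => //.
    exact/measurable_EFinP/measurable_funM.
  - by move=> r x _; rewrite mule_ge0 ?[X in 0 <= X]EFinM ?nnfun_muleindic_ge0// lee_fin.
apply: eq_fsbigr => r /[!inE] -[x0 _ x0r]; have r0 : (0 <= r)%R by rewrite -x0r.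
rewrite integralZl_indic_nnsfun// integral_indic//=.
under [RHS]eq_integral do rewrite EFinM -muleA.
rewrite ge0_integralZl_EFin//; last 2 first.
- by move=> x _; rewrite mule_ge0// lee_fin.
- apply: emeasurable_funM => //; exact/measurable_EFinP.
congr (_ * _); rewrite /density.
rewrite setIC integral_mkcondr; apply: eq_integral => x _.
by rewrite /patch /= indicE; case: (x \in _); rewrite ?mul1e ?mul0e.
Qed.

End density.

Section root_measure.
Context {R : realType} {n : nat}.
Local Notation V := 'rV[R]_n.
Local Notation mu := (lebesgue_rV n).

Lemma measurable_fun_lt (g : V -> R) (c : R) : measurable_fun setT g ->
  measurable [set x | g x < c].
Proof.
move=> mg; rewrite [X in measurable X](_ : _ = setT `&` g @^-1` `]-oo, c[%classic).
  by apply: mg.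
by rewrite setTI; apply/seteqP; split => x; rewrite /= in_itv.
Qed.

(** By compactness a continuous function has a zero in [0, 1] as soon as its values at rational
    points of [0, 1] come arbitrarily close to 0, which is a countable condition. *)
Lemma measurable_exists_zero (h : V -> R -> R) :
  (forall r, measurable_fun setT (h ^~ r)) -> (forall x, continuous (h x)) ->
  measurable [set x | exists2 t, 0 <= t <= 1 & h x t = 0].
Proof.
move=> mh ch.
pose B (m : nat) (r : rat) : set V := if 0 <= (ratr r : R) <= 1 then
   [set x | `|h x (ratr r)| < m.+1%:R^-1] else set0.
rewrite [X in measurable X](_ : _ = \bigcap_m \bigcup_(r : rat) B m r).
  apply: bigcapT_measurable => m; apply: countable_bigcupT_measurable => // r.
  by rewrite /B; case: ifP => // _; apply: measurable_fun_lt; exact: measurableT_comp.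
apply/seteqP; split => [x [t t01 ht] m _|x H] /=.
  have [e /= e0 He] : exists2 e : R, 0 < e & forall u, ball t e u -> `|h x u| < m.+1%:R^-1.
    have /cvgr_norm_lt : h x u @[u --> t] --> h x t by exact: ch.
    rewrite ht normr0 => /(_ m.+1%:R^-1); rewrite invr_gt0 ltr0Sn => /(_ isT).
    by move=> /nbhs_ballP[e /= e0 He]; exists e.
  have [q] : exists q : rat, ratr q \in `](Num.max 0 (t - e)), (Num.min 1 (t + e))[.
    by apply: rat_in_itvoo; rewrite gt_max !lt_min; move: t01 e0; lra.
  rewrite in_itv /= gt_max lt_min => /andP[/andP[q0 qt] /andP[q1 qt']].
  exists q => //; rewrite /B !ltW//=; apply: He.
  by rewrite -ball_normE /= ltr_norml; move: qt qt'; lra.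
have cn : {within `[0, 1], continuous (fun t => `|h x t|)}.
  apply: continuous_subspaceT => t; apply: continuous_comp; first exact: ch.
  exact: norm_continuous.
have [c c01 Hc] := EVT_min (@ler01 R) cn.
exists c => //; apply/eqP; apply: contraT => hc.
have [m Hm] : exists m : nat, m.+1%:R^-1 < `|h x c|.
  have /ltr_add_invr[k] : 0 < `|h x c| by rewrite normr_gt0.
  by rewrite add0r => ?; exists k.
have [q _] := H m I; rewrite /B; case: ifP => // q01 /= hq.
by have := lt_trans hq Hm; rewrite ltNge Hc// in_itv.
Qed.

Variables (f : V -> R) (v : V) (D : nat) (ts : V -> seq R).
Hypothesis cf : continuous f.
Hypothesis ts_sorted : forall x, sorted <%R (ts x).
Hypothesis ts_size : forall x, size (ts x) = D.
Hypothesis tsP : forall x t, (t \in ts x) = (0 <= t < 1) && (f (x + t *: v) == 0).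

(** The [j]-th zero in increasing order on the line through [x], not a radical; the default 0 beyond
    the last zero keeps it in [0, 1]. *)
Definition nth_root j x : R := nth 0 (ts x) j.

Definition root_map j x : V := x + nth_root j x *: v.

Lemma continuous_line (x : V) : continuous (fun t : R => x + t *: v).
Proof.
move=> t; apply: (@continuousD R V R (cst x) (fun t : R => t *: v) t); first exact: cst_continuous.
exact: (@scalel_continuous R V v).
Qed.

Lemma nth_rootP j x : (j < D)%N -> 0 <= nth_root j x < 1 /\ f (root_map j x) = 0.
Proof.
move=> jD; have : nth_root j x \in ts x by rewrite mem_nth// ts_size.
by rewrite tsP => /andP[? /eqP].
Qed.

Lemma nth_root_lt i j x : (i < j < D)%N -> nth_root i x < nth_root j x.
Proof.
move=> /andP[ij jD]; rewrite /nth_root (lt_sorted_ltn_nth 0 (ts_sorted x))// inE ts_size//.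
exact: ltn_trans jD.
Qed.

Lemma root_index x t : 0 <= t < 1 -> f (x + t *: v) = 0 -> exists2 j, (j < D)%N & t = nth_root j x.
Proof.
move=> t01 ft; have tts : t \in ts x by rewrite tsP t01 ft eqxx.
exists (index t (ts x)); first by rewrite -(ts_size x) index_mem.
by rewrite /nth_root nth_index.
Qed.

Lemma nth_root_bound j x : 0 <= nth_root j x <= 1.
Proof.
have [jD|jD] := ltnP j D.
  by have [/andP[-> /ltW ->]] := nth_rootP x jD.
by rewrite /nth_root nth_default ?ts_size// lexx ler01.
Qed.

Let zeros_in (q c : R) : set V := [set x | exists2 t, q <= t <= c & f (x + t *: v) = 0].

Let measurable_zeros_in q c : q <= c -> measurable (zeros_in q c).
Proof.
move=> qc; have := @measurable_exists_zero (fun x r => f (x + (q + r * (c - q)) *: v)).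
rewrite [X in measurable X](_ : _ = zeros_in q c); first apply.
- move=> r; apply: (measurableT_comp (f := f)).
    exact: continuous_measurable_rV.
  exact: measurable_rV_shift.
- move=> x r; apply: (@continuous_comp R V R (fun r => x + (q + r * (c - q)) *: v) f); last exact: cf.
  apply: (@continuous_comp R R V (fun r => q + r * (c - q)) (fun t => x + t *: v)).
    apply: continuousD; first exact: cst_continuous.
    exact: mulrr_continuous.
  exact: continuous_line.
- apply/seteqP; split => [x [r r01 fr]|x [t tqc ft]].
    exists (q + r * (c - q)) => //; move: r01 qc; nra.
  have [cq|cq] := eqVneq c q.
    exists 0; first by rewrite lexx ler01.
    by rewrite mul0r addr0; have -> : q = t by move: tqc; rewrite cq; lra.
  have cq0 : 0 < c - q by rewrite subr_gt0 lt_neqAle eq_sym cq.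
  exists ((t - q) / (c - q)).
    by rewrite divr_ge0 ?ler_pdivrMr ?mul1r ?lerB ?subr_ge0 ?(ltW cq0)//; move: tqc => /andP[].
  by rewrite divfK ?gt_eqF// (addrC q) subrK.
Qed.

Let measurable_nth_root_le j : (forall c, measurable [set x | nth_root j x <= c]) ->
  measurable_fun setT (nth_root j).
Proof.
move=> H; apply: (measurability _ (RGenOInfty.measurableE R)) => //.
move=> _ [_ [c ->] <-]; rewrite setTI.
rewrite [X in measurable X](_ : _ = ~` [set x | nth_root j x <= c]).
  exact: measurableC.
by apply/seteqP; split => x /=; rewrite ?in_itv/= ?andbT ltNge => /negP.
Qed.

(** By induction on the rank: the next zero is at most [c] exactly when some rational separates the
    previous one from a zero not exceeding [c]. Values of [c] outside [0, 1) and ranks beyond [D]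
    are trivial. *)
Lemma measurable_nth_root j : measurable_fun setT (nth_root j).
Proof.
elim: j => [|j IH]; apply: measurable_nth_root_le => c.
all: have [c0|c0] := ltP c 0.
- rewrite [X in measurable X](_ : _ = set0)//; apply/seteqP; split => // x /= xc.
  by have := nth_root_bound 0 x; move: xc c0; lra.
- have [c1|c1] := leP 1 c.
    rewrite [X in measurable X](_ : _ = setT)//; apply/seteqP; split => // x _ /=.
    by apply: le_trans c1; case/andP: (nth_root_bound 0 x).
  have [D0|D0] := posnP D.
    rewrite [X in measurable X](_ : _ = setT)//; apply/seteqP; split => // x _ /=.
    by rewrite /nth_root nth_default// ts_size D0.
  rewrite [X in measurable X](_ : _ = zeros_in 0 c); first exact: measurable_zeros_in.
  apply/seteqP; split => [x /= xc|x [t /andP[t0 tc] ft]] /=.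
    have [/andP[h0 _] fx] := nth_rootP x D0.
    by exists (nth_root 0 x) => //; rewrite h0.
  have [|j jD tj] := root_index (x := x) (t := t) _ ft.
    by rewrite t0 (le_lt_trans tc c1).
  apply: le_trans tc; rewrite tj; case: j jD {tj} => [//|j jD].
  by apply/ltW/nth_root_lt.
- rewrite [X in measurable X](_ : _ = set0)//; apply/seteqP; split => // x /= xc.
  by have := nth_root_bound j.+1 x; move: xc c0; lra.
- have [c1|c1] := leP 1 c.
    rewrite [X in measurable X](_ : _ = setT)//; apply/seteqP; split => // x _ /=.
    by apply: le_trans c1; case/andP: (nth_root_bound j.+1 x).
  have [D0|jD] := leqP D j.+1.
    rewrite [X in measurable X](_ : _ = setT)//; apply/seteqP; split => // x _ /=.
    by rewrite /nth_root nth_default// ts_size.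
  pose B (q : rat) : set V := if (ratr q : R) <= c then
    [set x | nth_root j x < ratr q] `&` zeros_in (ratr q) c else set0.
  rewrite [X in measurable X](_ : _ = \bigcup_(q : rat) B q).
    apply: countable_bigcupT_measurable => // q; rewrite /B; case: ifP => // qc.
    apply: measurableI; last exact: measurable_zeros_in.
    exact: measurable_fun_lt.
  apply/seteqP; split => [x /= xc|x [q _]] /=.
    have lt1 : nth_root j x < nth_root j.+1 x by apply: nth_root_lt; rewrite ltnSn.
    have [q] := rat_in_itvoo lt1; rewrite in_itv /= => /andP[q1 q2].
    exists q => //; rewrite /B (le_trans (ltW q2) xc); split => //=.
    have [_ fx] := nth_rootP x jD.
    by exists (nth_root j.+1 x) => //; rewrite (ltW q2) xc.
  rewrite /B; case: ifP => // qc [/= jq [t /andP[qt tc] ft]].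
  have jt : nth_root j x < t by exact: lt_le_trans qt.
  have [|i iD ti] := root_index (x := x) (t := t) _ ft.
    rewrite (le_lt_trans tc c1) andbT; apply: le_trans (ltW jt).
    by case/andP: (nth_root_bound j x).
  apply: le_trans tc; rewrite ti leNgt; apply/negP => ij.
  move: jt; rewrite ti ltNge => /negP; apply.
  have [ji|] := leqP i j.
    move: ji; rewrite leq_eqVlt => /orP[/eqP ->//|ji].
    by apply/ltW/nth_root_lt; rewrite ji (ltnW jD).
  rewrite leq_eqVlt => /orP[/eqP e|ji]; first by move: ij; rewrite e ltxx.
  by have := nth_root_lt x (i := j.+1) (j := i); rewrite ji iD => /(_ isT) /(lt_trans ij); rewrite ltxx.
Qed.

Lemma measurable_root_map j : measurable_fun setT (root_map j).
Proof.
apply: measurable_fun_rV => i.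
rewrite (_ : _ \o _ = (fun x => rV_coord i x + nth_root j x * v 0 i)); last first.
  by apply/funext => x; rewrite /= /rV_coord !mxE.
apply: measurable_funD; first exact: measurable_rV_coord.
apply: measurable_funM => //; exact: measurable_nth_root.
Qed.

Definition root_pushforward j : {measure set V -> \bar R} :=
  measure_function_pushforward__canonical__measure_function_Measure mu (measurable_root_map j).

Definition root_measure : {measure set V -> \bar R} := msum root_pushforward D.

Lemma ge0_integral_root_measure A (g : V -> \bar R) : measurable A ->
  measurable_fun A g -> (forall x, A x -> 0 <= g x)%E ->
  (\int[root_measure]_(x in A) g x =
   \sum_(j < D) \int[mu]_(x in root_map j @^-1` A) g (root_map j x))%E.
Proof.
move=> mA mg g0; rewrite ge0_integral_measure_sum//; apply: eq_bigr => j _.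
by rewrite ge0_integral_pushforward//; [exact: measurable_root_map|move=> y /[!inE]; exact: g0].
Qed.

Let mZ : measurable [set x | f x = 0].
Proof.
rewrite -[X in measurable X]setTI.
exact: (continuous_measurable_rV cf measurableT (measurable_set1 0)).
Qed.

Lemma root_measure_support : root_measure (~` [set x | f x = 0]) = 0%E.
Proof.
rewrite /= /msum big1// => j _ /=; rewrite /pushforward (_ : _ @^-1` _ = set0) ?measure0//.
by apply/seteqP; split => // x /=; have [_] := nth_rootP x (ltn_ord j).
Qed.

Lemma root_measure_ball x0 (r : R) : 0 < r -> (root_measure (ball x0 r) < +oo)%E.
Proof.
move=> r0; rewrite /= /msum; apply: lte_sum_pinfty => j _ /=.
apply: (@le_lt_trans _ _ (mu (ball x0 (r + `|v|)))); last exact: lebesgue_rV_ball.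
apply: (le_measure mu); rewrite ?inE.
- rewrite -[X in measurable X]setTI; apply: measurable_root_map => //.
  exact: measurable_rV_ball.
- by apply: measurable_rV_ball; rewrite ltr_pwDl.
- move=> x; rewrite -!ball_normE /= => H.
  rewrite -(addrK (nth_root j x *: v) x) opprB addrCA.
  rewrite addrC; apply: (le_lt_trans (ler_normD _ _)); apply: ltr_leD => //.
  rewrite normrZ; have /andP[t0 t1] := nth_root_bound j x.
  by rewrite ger0_norm// ler_piMl.
Qed.

(** Averaging along [v] reduces the measure to that of the zeros on segments, which are finite in
    number. *)
Lemma zero_set_null : mu [set x | f x = 0] = 0%E.
Proof.
have mi : measurable_fun setT (fun x : V => (\1_[set x | f x = 0] x : R)%:E).
  by apply/measurable_EFinP; exact: measurable_indic.
rewrite -[X in mu X]setIT -integral_indic// (ge0_integral_averaging v mi) => [|x]; last by rewrite lee_fin.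
rewrite [LHS](eq_integral (cst 0%E)) ?integral0// => x _ /=.
pose A := [set t : R | f (x + t *: v) = 0].
have cfl : continuous (fun t : R => f (x + t *: v)).
  move=> t; apply: (@continuous_comp R V R (fun t : R => x + t *: v) f); last exact: cf.
  exact: continuous_line.
have mA : measurable A.
  have mfl : measurable_fun setT (fun t : R => f (x + t *: v)) by exact: continuous_measurable_fun.
  rewrite -[X in measurable X]setTI.
  exact: (mfl measurableT [set 0] (measurable_set1 _)).
transitivity (\int[lebesgue_measure]_(t in `[0%R, 1%R]) (\1_A t : R)%:E)%E.
  by apply: eq_integral => t _; rewrite !indicE.
rewrite integral_indic//; apply: countable_lebesgue_measure0.
(* The list covers [0, 1) only, whereas the averaging segment is closed: the parameter 1 is
   added. *)
apply: (@sub_countable _ _ _ [set` 1 :: ts x]).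
  apply: subset_card_le => t [/= ft]; rewrite in_itv /= => /andP[t0 t1].
  rewrite inE tsP t0 ft eqxx andbT lt_neqAle t1 andbT.
  by case: eqP.
exact/finite_set_countable/finite_seq.
Qed.

End root_measure.

Section measurable_rV.
Context {R : realType}.

Lemma open_continuous_measurable_rV n (U : set 'rV[R]_n) (g : 'rV[R]_n -> R) : open U ->
  (forall y, U y -> {for y, continuous g}) -> measurable_fun U g.
Proof.
move=> oU cg; apply: (measurability _ (RGenOpens.measurableE R)) => //.
move=> _ [_ [a [b ->] <-]]; apply: measurable_rV_open; rewrite openE => y [Uy gy].
apply: filterI; first exact: open_nbhs_nbhs.
have : nbhs (g y) `]a, b[%classic.
  by apply: open_nbhs_nbhs; split => //; exact: interval_open.
exact: cg.
Qed.

Lemma measurable_fun_inv_norm d (T : measurableType d) (g : T -> R) : measurable_fun setT g ->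
  measurable_fun setT (fun x => `|g x|^-1).
Proof.
move=> mg; under eq_fun do rewrite -(powR_inv1 (normr_ge0 _)).
apply: (measurableT_comp (measurable_powR (- 1))).
exact: measurableT_comp.
Qed.

End measurable_rV.

(** * Poisson approximation of the area of the zero set *)

Section flux.
Context {R : realType} {n : nat}.
Local Notation V := 'rV[R]_n.
Local Notation mu := (lebesgue_rV n).
Variables (f : V -> R) (G : V -> V).
Hypothesis df : forall (gam : R -> V) (t : R) v, is_derive t (1 : R) gam v ->
  is_derive t (1 : R) (fun s => f (gam s)) (dot (G (gam t)) v).
Hypothesis cf : continuous f.
Hypothesis cG : forall v, continuous (fun x => dot (G x) v).
Hypothesis fper : forall x (q : 'rV[int]_n), (f (x + rV_int q) == 0) = (f x == 0).

(** The Euclidean norm, as the area element requires; the norm on row vectors is the maximum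
    norm. *)
Definition gradnorm x := Num.sqrt (dot (G x) (G x)).

Lemma continuous_gradnorm : continuous gradnorm.
Proof.
move=> x; apply: (@continuous_comp V R R (fun x => dot (G x) (G x)) Num.sqrt);
  last exact: sqrt_continuous.
have cc j : continuous (fun x => G x 0 j).
  by under eq_fun do rewrite -dot_delta; exact: cG.
apply: (@continuous_sumr R V _ _ (fun j x => G x 0 j * G x 0 j)) => j.
by move=> z; apply: (@continuousM R V (fun x => G x 0 j) (fun x => G x 0 j)); exact: cc.
Qed.

(* The factor 3 lets a line that meets the ball of radius [e] continue for a length [2 e]. *)
Definition flux_box (v x0 : V) (e s B : R) :=
  [/\ 0 < e, s ^+ 2 = 1, forall x, ball x0 (3 * e) x -> 0 < s * dot (G x) v &
      forall x, ball x0 (3 * e) x -> gradnorm x <= B * (s * dot (G x) v)].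

Lemma flux_box_le v x0 e e' s B : 0 < e' -> e' <= e -> flux_box v x0 e s B -> flux_box v x0 e' s B.
Proof.
move=> e'0 ee' [e0 s2 h1 h2]; have sub x : ball x0 (3 * e') x -> ball x0 (3 * e) x.
  by apply: le_ball; rewrite ler_pM2l.
by split => // x /sub; [exact: h1|exact: h2].
Qed.

Lemma exists_flux_box v x0 : dot (G x0) v != 0 -> exists e s B, flux_box v x0 e s B.
Proof.
move=> G0; pose s := Num.sg (dot (G x0) v); pose h x := s * dot (G x) v.
have hx0 : h x0 = `|dot (G x0) v| by rewrite /h /s normrEsg.
have h0 : 0 < h x0 by rewrite hx0 normr_gt0.
have ch : {for x0, continuous h}.
  by apply: (@continuousM R V (cst s) (fun x => dot (G x) v)); [exact: cst_continuous|exact: cG].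
have H1 : \forall x \near x0, h x0 / 2 < h x by apply: (cvgr_gt _ ch); lra.
have H2 : \forall x \near x0, gradnorm x < gradnorm x0 + 1.
  have cg : gradnorm x @[x --> x0] --> gradnorm x0 by exact: continuous_gradnorm.
  by apply: (cvgr_lt _ cg); lra.
have /nbhs_ballP[r /= r0 Hr] : \forall x \near x0, h x0 / 2 < h x /\ gradnorm x < gradnorm x0 + 1.
  by near=> x; split; near: x.
have r3 : 3 * (r / 3) = r by rewrite mulrC divfK.
(* On the ball of radius [r] the oriented slope exceeds half its value at [x0], and the norm of the
   gradient is below its value plus 1; [B] is the quotient of these bounds. *)
exists (r / 3), s, ((gradnorm x0 + 1) / (h x0 / 2)); split.
- by rewrite divr_gt0.
- by rewrite sqr_sg G0.
- by move=> x; rewrite r3 => /Hr[hx _]; move: hx h0; rewrite -/(h x); lra.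
- move=> x; rewrite r3 => /Hr[hx gx]; apply: (le_trans (ltW gx)).
  have g0 : 0 <= gradnorm x0 by exact: sqrtr_ge0.
  rewrite mulrAC ler_pdivlMr ?divr_gt0// ler_pM2l; first exact: ltW.
  by rewrite ltr_wpDl.
Unshelve. all: by end_near. Qed.

Section box.
Variables (v x0 : V) (e s B : R).
Hypothesis box : flux_box v x0 e s B.

(** The mean value theorem would give a zero slope along [v] between the two zeros, at a point that
    still lies in the ball of radius [3 * e]. *)
Lemma box_zero_lt x (t t' : R) : ball x0 e (x + t *: v) -> ball x0 e (x + t' *: v) ->
  f (x + t *: v) = 0 -> f (x + t' *: v) = 0 -> ~ (t < t').
Proof.
case: box => e0 s2 Gv _ b1 b2 f1 f2 tt'.
have dl c : is_derive c (1 : R) (fun u : R => f (x + u *: v)) (dot (G (x + c *: v)) v).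
  by apply: (@df (fun u => x + u *: v)); exact: is_derive_line.
have cl : continuous (fun u : R => f (x + u *: v)).
  move=> u; apply: (@continuous_comp R V R (fun t : R => x + t *: v) f); last exact: cf.
  exact: continuous_line.
have [c /[!in_itv]/= /andP[tc ct'] E] : exists2 c, c \in `]t, t'[%R &
    f (x + t' *: v) - f (x + t *: v) = dot (G (x + c *: v)) v * (t' - t).
  by apply: (@MVT R (fun u => f (x + u *: v))) => //; exact: continuous_subspaceT.
have Gc : 0 < s * dot (G (x + c *: v)) v.
  apply: Gv; move: b1 b2; rewrite -!ball_normE /= => b1 b2.
  have n1 : (t' - t) * `|v| < 2 * e.
    rewrite -[t' - t]ger0_norm ?subr_ge0 1?ltW// -normrZ.
    rewrite (_ : _ *: v = (x0 - (x + t *: v)) - (x0 - (x + t' *: v))); last first.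
      by rewrite scalerBl; apply/rowP => j; rewrite !mxE; ring.
    by apply: (le_lt_trans (ler_normB _ _)); lra.
  rewrite (_ : x0 - _ = (x0 - (x + t *: v)) - (c - t) *: v); last first.
    by apply/rowP => j; rewrite !mxE; ring.
  apply: (le_lt_trans (ler_normB _ _)); rewrite normrZ (@ger0_norm _ (c - t)) ?subr_ge0 1?ltW//.
  have : (c - t) * `|v| <= (t' - t) * `|v| by rewrite ler_wpM2r// lerD2r ltW.
  by lra.
move: E; rewrite f1 f2 subrr => /esym/eqP; rewrite mulf_eq0 => /orP[] /eqP E.
  by move: Gc; rewrite E mulr0 ltxx.
by move: tt'; rewrite -subr_gt0 E ltxx.
Qed.

Lemma box_zero_inj x (t t' : R) : ball x0 e (x + t *: v) -> ball x0 e (x + t' *: v) ->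
  f (x + t *: v) = 0 -> f (x + t' *: v) = 0 -> t = t'.
Proof.
move=> b1 b2 f1 f2; apply/eqP; rewrite eq_le !leNgt.
by apply/andP; split; apply/negP; [exact: (box_zero_lt b2 b1)|exact: (box_zero_lt b1 b2)].
Qed.

Variable phi : V -> R.
Hypothesis cphi : continuous phi.
Hypothesis phi01 : forall x, 0 <= phi x <= 1.
Hypothesis phi_ball : forall x, ~ ball x0 e x -> phi x = 0.

(** The quotient is 1 / |<n, v>| for the unit normal n: it converts measure projected along [v] into
    area. *)
Definition flux_density x := phi x * gradnorm x / `|dot (G x) v|.

Lemma flux_density_ge0 x : 0 <= flux_density x.
Proof.
by rewrite /flux_density divr_ge0// mulr_ge0 ?sqrtr_ge0//; case/andP: (phi01 x).
Qed.

Lemma measurable_flux_density : measurable_fun setT flux_density.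
Proof.
apply: measurable_funM; last first.
  by apply: measurable_fun_inv_norm; apply: continuous_measurable_rV; exact: cG.
apply: measurable_funM; apply: continuous_measurable_rV; [exact: cphi|exact: continuous_gradnorm].
Qed.

(** The sequence on the left does not involve [v]. Its limits computed for two directions must
    agree, which is how the root measure and the charts are compared. *)
Lemma flux_cvg (lim : V -> R) : (mu [set x | f x = 0%R] = 0%E) ->
  (forall x, f x != 0 -> f (x + v) != 0) ->
  measurable_fun setT lim -> (forall x, 0 <= lim x) ->
  (forall x, f x != 0 ->
    (forall t, 0 <= t <= 1 -> f (x + t *: v) = 0 -> phi (x + t *: v) = 0) -> lim x = 0) ->
  (forall x t, f x != 0 -> 0 <= t <= 1 -> f (x + t *: v) = 0 -> phi (x + t *: v) != 0 ->
    lim x = flux_density (x + t *: v)) ->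
  (\int[mu]_x (phi x * gradnorm x * poisson k.+1%:R^-1 (f x))%:E)%E @[k --> \oo] -->
  (\int[mu]_x (lim x)%:E)%E.
Proof.
case: box => e0 s2 Gv gB f0 fv mlim lim_ge0 lim0 lim1.
have mZ : measurable [set x | f x = 0].
  rewrite -[X in measurable X]setTI.
  exact: (continuous_measurable_rV cf measurableT (measurable_set1 0)).
have -> : (\int[mu]_x (lim x)%:E = \int[mu]_(x in ~` [set x | f x = 0%R]) (lim x)%:E)%E.
  rewrite (ge0_negligible_integral mZ)//; first by rewrite setTD.
  - exact/measurable_EFinP.
  - by move=> x _; rewrite lee_fin.
have dl (x : V) (t : R) : is_derive t (1 : R) (fun u => f (x + u *: v)) (dot (G (x + t *: v)) v).
  by apply: (@df (fun u => x + u *: v)); exact: is_derive_line.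
have g0 x : 0 <= gradnorm x by exact: sqrtr_ge0.
have H0 := poisson_averaging dl cf (@cG v) continuous_gradnorm g0 fv f0 e0.
have H1 := H0 _ _ _ s2 Gv gB phi cphi phi01 phi_ball.
exact: (H1 lim lim0 lim1).
Qed.

End box.

Section root_flux.
Variables (b : 'rV[int]_n) (D : nat) (ts : V -> seq R).
Hypothesis ts_sorted : forall x, sorted <%R (ts x).
Hypothesis ts_size : forall x, size (ts x) = D.
Hypothesis tsP : forall x t, (t \in ts x) = (0 <= t < 1) && (f (x + t *: rV_int b) == 0).
Variables (x0 : V) (e s B : R).
Hypothesis box : flux_box (rV_int b) x0 e s B.
Variable phi : V -> R.
Hypothesis cphi : continuous phi.
Hypothesis phi01 : forall x, 0 <= phi x <= 1.
Hypothesis phi_ball : forall x, ~ ball x0 e x -> phi x = 0.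

(** The limit function is the sum of the density over all [D] roots; at most one term is nonzero,
    since a line has at most one zero in the small ball. *)
Lemma root_flux_cvg :
  (\int[mu]_x (phi x * gradnorm x * poisson k.+1%:R^-1 (f x))%:E)%E @[k --> \oo] -->
  (\int[root_measure cf ts_sorted ts_size tsP]_x (flux_density (rV_int b) phi x)%:E)%E.
Proof.
pose rm j x := @root_map R n (rV_int b) ts j x.
have mrm j : measurable_fun setT (rm j) by exact: (measurable_root_map cf ts_sorted ts_size tsP).
pose fd := flux_density (rV_int b) phi.
have fd0 : forall x, 0 <= fd x by exact: flux_density_ge0.
have mfd : measurable_fun setT fd by exact: measurable_flux_density.
have -> : (\int[root_measure cf ts_sorted ts_size tsP]_x (fd x)%:E =
   \int[mu]_x (\sum_(j < D) fd (rm j x))%:E)%E.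
  rewrite ge0_integral_root_measure//; last 2 first.
  - exact/measurable_EFinP.
  - by move=> x _; rewrite lee_fin.
  under [RHS]eq_integral do rewrite -sumEFin.
  rewrite ge0_integral_sum//.
  - by move=> j; apply/measurable_EFinP; exact: measurableT_comp.
  - by move=> j x _; rewrite lee_fin.
have fv x : f x != 0 -> f (x + rV_int b) != 0 by rewrite fper.
have f0 := zero_set_null cf tsP.
have fz j x : (j < D)%N -> f (rm j x) = 0.
  by move=> jD; have [_] := nth_rootP ts_size tsP x jD.
apply: (flux_cvg box cphi phi01 phi_ball f0 fv).
- apply: measurable_sum => j; exact: measurableT_comp.
- by move=> x; apply: sumr_ge0.
- move=> x fx Hx; apply: big1 => j _.
  rewrite /fd /flux_density Hx ?mul0r//; last exact: fz.
  exact: (nth_root_bound ts_size tsP).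
- move=> x t fx t01 ft pt.
  have inb y : phi y != 0 -> ball x0 e y by move=> py; apply: contra_notP (negP py) => /phi_ball ->.
  have t1 : 0 <= t < 1.
    move: t01 => /andP[-> t1]; rewrite lt_neqAle t1 andbT; apply: contra_neq (fv _ fx) => t1'.
    by rewrite -[rV_int b]scale1r -t1'.
  have [j jD tj] := root_index ts_size tsP t1 ft.
  rewrite (bigD1 (Ordinal jD))//= big1 ?addr0 => [|i ij]; first by rewrite tj.
  rewrite /fd /flux_density; have [->|pi0] := eqVneq (phi (rm i x)) 0; first by rewrite !mul0r.
  exfalso; have E : nth_root ts i x = nth_root ts j x.
    rewrite -tj; apply: (box_zero_inj box (inb _ pi0) (inb _ pt) _ ft).
    exact: fz.
  have inj k l : (k < l < D)%N -> nth_root ts k x = nth_root ts l x -> False.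
    move=> kl; have := nth_root_lt ts_sorted ts_size x kl => /[swap] ->.
    by rewrite ltxx.
  have [ilj|jli|ej] := ltngtP i j.
  - by apply: (inj i j) => //; rewrite ilj jD.
  - by apply: (inj j i) => //; rewrite jli ltn_ord.
  - by move: ij => /eqP; apply; exact/val_inj.
Qed.

End root_flux.

End flux.

(** * Charts and the surface measure *)

Section derivatives.
Context {R : realType}.

Lemma is_derive_scalel n (h : R -> R) (t d : R) (u : 'rV[R]_n) : is_derive t (1 : R) h d ->
  is_derive t (1 : R) (fun s => h s *: u) (d *: u).
Proof.
move=> [dh hd].
have ch : k^-1 *: ((h \o shift t) (k *: (1 : R)) - h t) @[k --> (0 : R)^'] --> d.
  by rewrite -hd; exact: dh.
have H : (k^-1 *: ((h \o shift t) (k *: (1 : R)) - h t)) *: u @[k --> (0 : R)^'] --> d *: u.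
  by apply: cvgZr_tmp.
have E : (fun k : R => k^-1 *: (((fun s => h s *: u) \o shift t) (k *: (1 : R)) - h t *: u)) =
   (fun k : R => (k^-1 *: ((h \o shift t) (k *: (1 : R)) - h t)) *: u).
  by apply/funext => k; rewrite /= -scalerBl scalerA.
split; first by apply/cvg_ex; exists (d *: u); rewrite E.
by apply: cvg_lim => //; rewrite E.
Qed.

Lemma is_derive_along n (g : 'rV[R]_n -> R) y v : derivable g y v ->
  is_derive (0 : R) (1 : R) (fun t => g (y + t *: v)) ('D_v g y).
Proof.
move=> dg; have E : (fun k : R => k^-1 *: (((fun t => g (y + t *: v)) \o shift 0) (k *: (1 : R))
     - g (y + 0 *: v))) = (fun k : R => k^-1 *: ((g \o shift y) (k *: v) - g y)).
  apply/funext => k /=; rewrite scale0r addr0 addr0 [y + _]addrC.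
  by have -> : k *: (1 : R) = k by exact: mulr1.
split; first by apply/cvg_ex; exists ('D_v g y); rewrite E; exact: dg.
by apply: cvg_lim => //; rewrite E; exact: dg.
Qed.

Lemma is_derive_near0 (F : R -> R) (d : R) : (\forall t \near (0 : R), F t = 0) ->
  is_derive (0 : R) (1 : R) F d -> d = 0.
Proof.
move=> F0 dF; have F00 : F 0 = 0 by exact: (nbhs_singleton F0).
have H := is_derive0_seq dF F00.
have H0 : F k.+1%:R^-1 / k.+1%:R^-1 @[k --> \oo] --> (0 : R).
  apply: cvg_near_cst; pose u k : R := k.+1%:R^-1.
  have cu : u @ \oo --> (0 : R) by exact: cvg_harmonic.
  have : \forall k \near \oo, F (u k) = 0 by exact: (cu _ F0).
  by apply: filterS => k Fk; rewrite -/(u k) Fk mul0r.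
exact: (cvg_unique _ H H0).
Qed.

Lemma tangent_gradient n (f : 'rV[R]_n -> R) (G : 'rV[R]_n -> 'rV[R]_n) x v :
  (forall (gam : R -> 'rV[R]_n) (t : R) v, is_derive t (1 : R) gam v ->
    is_derive t (1 : R) (fun s => f (gam s)) (dot (G (gam t)) v)) ->
  tangent [set x | f x = 0] x v -> dot (G x) v = 0.
Proof.
move=> df [gam [<- gam0 dgam]]; exact: (is_derive_near0 gam0 (df _ _ _ dgam)).
Qed.

End derivatives.

Section chart_flux.
Context {R : realType} {n : nat}.
Local Notation V := 'rV[R]_n.+1.
Local Notation mu := (lebesgue_rV n.+1).
Variables (f : V -> R) (G : V -> V).
Hypothesis df : forall (gam : R -> V) (t : R) v, is_derive t (1 : R) gam v ->
  is_derive t (1 : R) (fun s => f (gam s)) (dot (G (gam t)) v).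
Hypothesis cf : continuous f.
Hypothesis cG : forall v, continuous (fun x => dot (G x) v).
Hypothesis fper : forall x (q : 'rV[int]_n.+1), (f (x + rV_int q) == 0) = (f x == 0).
Hypothesis G0 : forall x, f x = 0 -> exists j, G x 0 j != 0.
Variables (i : 'I_n.+1) (V0 : set V) (U : set 'rV[R]_n) (g : 'rV[R]_n -> R).
Hypothesis chart : graph_chart [set x | f x = 0] i V0 U g.

Let ins t (y : 'rV[R]_n) : V := @rV_insert R n.+1 i t y.

Lemma rV_insertE t y : ins t y = t *: delta_mx 0 i + \sum_k y 0 k *: delta_mx 0 (lift i k).
Proof.
have li k : (lift i k == i) = false by rewrite eq_sym (negbTE (neq_lift _ _)).
apply/rowP => j; rewrite !mxE summxE /=; case: unliftP => [k ->|->].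
  rewrite li mulr0 add0r (bigD1 k)//= !mxE !eqxx mulr1 big1 ?addr0// => l lk.
  by rewrite !mxE /= (inj_eq lift_inj) eq_sym (negbTE lk) mulr0.
rewrite !eqxx mulr1 big1 ?addr0// => l _.
by rewrite !mxE /= (negbTE (neq_lift _ _)) mulr0.
Qed.

Let Uo : open U. Proof. by case: chart. Qed.

Let fins y : U y -> f (ins (g y) y) = 0.
Proof.
case: chart => _ _ _ E Uy.
have [] // : ([set x | f x = 0] `&` V0) (ins (g y) y).
by rewrite E; exists y.
Qed.

Let cg y : U y -> {for y, continuous g}.
Proof.
by case: chart => _ _ H _ /H[dg _]; exact: differentiable_continuous.
Qed.

Lemma chart_tangent y k : U y -> tangent [set x | f x = 0] (ins (g y) y)
  ('D_(delta_mx 0 k) g y *: delta_mx 0 i + delta_mx 0 (lift i k)).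
Proof.
move=> Uy; case: chart => _ _ H _; have [dg _] := H y Uy.
have dgk : derivable g y (delta_mx 0 k) by exact: diff_derivable.
have d1 := is_derive_along dgk.
pose gam t : V := ins 0 y + (g (y + t *: delta_mx 0 k) *: delta_mx 0 i + t *: delta_mx 0 (lift i k)).
have gamE t : gam t = ins (g (y + t *: delta_mx 0 k)) (y + t *: delta_mx 0 k).
  rewrite /gam !rV_insertE scale0r add0r addrCA; congr (_ + _).
  under [RHS]eq_bigr do rewrite !mxE scalerDl.
  rewrite big_split /=; congr (_ + _); rewrite (bigD1 k)//= !eqxx mulr1 big1 ?addr0// => l lk.
  by rewrite (negbTE lk) mulr0 scale0r.
have dgam : is_derive (0 : R) (1 : R) gam
    ('D_(delta_mx 0 k) g y *: delta_mx 0 i + delta_mx 0 (lift i k)).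
  rewrite -[X in is_derive _ _ _ X]add0r; apply: is_deriveD.
  apply: is_deriveD; first exact: is_derive_scalel.
  rewrite -[X in is_derive _ _ _ X]scale1r; apply: is_derive_scalel; exact: is_derive_id.
exists gam; split => //; first by rewrite gamE scale0r addr0.
near=> t; rewrite /= gamE; apply: fins; near: t.
have cl : {for 0, continuous (fun t : R => y + t *: delta_mx 0 k)} by exact: continuous_line.
by apply: cl; rewrite scale0r addr0; exact: open_nbhs_nbhs.
Unshelve. all: by end_near. Qed.

Lemma chart_gradient y k : U y ->
  G (ins (g y) y) 0 i * 'D_(delta_mx 0 k) g y + G (ins (g y) y) 0 (lift i k) = 0.
Proof.
move=> /(chart_tangent k)/(tangent_gradient (@df)); rewrite dotDr dotZr !dot_delta => <-.
by rewrite mulrC.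
Qed.

(** The chart is an arbitrary one, not produced by the implicit function theorem, so transversality
    has to be derived: the tangent vectors make every component of the gradient a multiple of the
    [i]-th. *)
Lemma chart_gradient_neq0 y : U y -> G (ins (g y) y) 0 i != 0.
Proof.
move=> Uy; apply/eqP => Gi; have [j] := G0 (fins Uy).
have [k ->|->] := unliftP i j; last by rewrite Gi eqxx.
by have := chart_gradient k Uy; rewrite Gi mul0r add0r => ->; rewrite eqxx.
Qed.

Definition chart_area y := Num.sqrt (1 + \sum_k ('D_(delta_mx 0 k) g y) ^+ 2).

Lemma chart_areaE y : U y ->
  chart_area y = gradnorm G (ins (g y) y) / `|G (ins (g y) y) 0 i|.
Proof.
move=> Uy; have Gi := chart_gradient_neq0 Uy; set X := ins _ _ in Gi *.
have nG : gradnorm G X = Num.sqrt (G X 0 i ^+ 2 * (1 + \sum_k ('D_(delta_mx 0 k) g y) ^+ 2)).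
  congr Num.sqrt; rewrite /dot (bigD1_ord i)//= mulrDr mulr1 mulr_sumr; congr (_ + _).
  apply: eq_bigr => k _; rewrite -exprMn.
  have -> : G X 0 i * 'D_(delta_mx 0 k) g y = - G X 0 (lift i k).
    by apply/eqP; rewrite -addr_eq0; apply/eqP; exact: chart_gradient.
  by rewrite sqrrN.
by rewrite nG sqrtrM ?sqr_ge0// sqrtr_sqr mulrAC mulfV ?mul1r// normr_eq0.
Qed.

Let mU : measurable U. Proof. exact: measurable_rV_open. Qed.

(** The area element and the chart function are extended by 0 outside [U], to define a push-forward
    from the whole space of parameters. *)
Let a := chart_area \_ U.

Let ma : measurable_fun setT a.
Proof.
suff cA y : U y -> {for y, continuous chart_area}.
  exact: ((measurable_restrictT _ mU).1 (open_continuous_measurable_rV Uo cA)).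
move=> Uy.
apply: (@continuous_comp _ R R (fun y => 1 + \sum_k ('D_(delta_mx 0 k) g y) ^+ 2) Num.sqrt);
  last exact: sqrt_continuous.
pose D2 z k := 'D_(delta_mx 0 k) g z * 'D_(delta_mx 0 k) g z.
have cs (r : seq 'I_n) : \sum_(k <- r) D2 z k @[z --> y] --> \sum_(k <- r) D2 y k.
  elim: r => [|k r IH].
    by under eq_fun do rewrite big_nil; rewrite big_nil; exact: (@cst_continuous _ _ (0 : R) y).
  under eq_fun do rewrite big_cons; rewrite big_cons.
  case: chart => _ _ H _; have [_ ck] := H y Uy.
  have ck' : 'D_(delta_mx 0 k) g z @[z --> y] --> 'D_(delta_mx 0 k) g y by exact: ck.
  have H2 := @continuousM R _ (fun z => 'D_(delta_mx 0 k) g z)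
    (fun z => 'D_(delta_mx 0 k) g z) y ck' ck'.
  exact: (cvgD H2 IH).
apply: (@continuousD R R _ (cst 1) (fun y => \sum_k ('D_(delta_mx 0 k) g y) ^+ 2)).
  exact: cst_continuous.
exact: cs.
Qed.

Let a0 y : 0 <= a y.
Proof. by rewrite /a /patch; case: ifP => // _; exact: sqrtr_ge0. Qed.

Let gU := g \_ U.

Let mgU : measurable_fun setT gU.
Proof.
exact: ((measurable_restrictT _ mU).1 (open_continuous_measurable_rV Uo cg)).
Qed.

Let insU y : V := ins (gU y) y.

Let insUE y : U y -> insU y = ins (g y) y.
Proof. by move=> Uy; rewrite /insU /gU patchE mem_set. Qed.

Let minsU : measurable_fun setT insU.
Proof.
have := measurableT_comp (@measurable_rV_insert R n i)
  (measurable_fun_pair (@measurable_id _ 'rV[R]_n setT) mgU).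
exact.
Qed.

Definition chart_measure : {measure set V -> \bar R} :=
  measure_function_pushforward__canonical__measure_function_Measure
    (density_measure (lebesgue_rV n) ma a0) minsU.

Lemma chart_measureE A : measurable A -> chart_measure A =
  (\int[lebesgue_rV n]_(y in U `&` [set y | A (ins (g y) y)]) (chart_area y)%:E)%E.
Proof.
move=> mA; rewrite /= /pushforward /= /density.
have mA' : measurable (insU @^-1` A) by rewrite -[X in measurable X]setTI; exact: minsU.
rewrite (_ : U `&` _ = (insU @^-1` A) `&` U); last first.
  by apply/seteqP; split => [y [Uy Ay]|y [Ay Uy]]; split => //=; move: Ay; rewrite /= insUE.
rewrite integral_mkcondr; apply: eq_integral => y _.
by rewrite /a /patch; case: ifP.
Qed.

Lemma chart_measure_support : chart_measure (~` [set x | f x = 0]) = 0%E.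
Proof.
rewrite chart_measureE; last first.
  apply: measurableC; rewrite -[X in measurable X]setTI.
  exact: (continuous_measurable_rV cf measurableT (measurable_set1 0)).
rewrite (_ : U `&` _ = set0) ?integral_set0//.
by apply/seteqP; split => // y [Uy /= ]; rewrite fins.
Qed.

Let pr (x : V) : 'rV[R]_n := \row_k x 0 (lift i k).

Let pr_ins t y : pr (ins t y) = y.
Proof. by apply/rowP => k; rewrite !mxE liftK. Qed.

Let ins_i t y : ins t y 0 i = t.
Proof. by rewrite mxE unlift_none. Qed.

Let ins_pr (x : V) : ins (x 0 i) (pr x) = x.
Proof.
by apply/rowP => j; rewrite !mxE; case: unliftP => [k ->|-> //]; rewrite mxE.
Qed.

Let insD t s y : ins t y + s *: delta_mx 0 i = ins (t + s) y.
Proof. by rewrite !rV_insertE addrAC -scalerDl. Qed.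

Variables (x0 : V) (e s B : R).
Hypothesis box : flux_box G (delta_mx 0 i) x0 e s B.
Hypothesis ballV0 : ball x0 e `<=` V0.
Variable phi : V -> R.
Hypothesis cphi : continuous phi.
Hypothesis phi01 : forall x, 0 <= phi x <= 1.
Hypothesis phi_ball : forall x, ~ ball x0 e x -> phi x = 0.
Hypothesis f0 : mu [set x | f x = 0%R] = 0%E.

(** Along the [i]-th axis a line meets the graph once. Integrating the limit function over the
    [i]-th coordinate multiplies by the length of a unit interval, and [chart_areaE] recognizes the
    remaining factor as the area element. *)
Lemma chart_flux_cvg :
  (\int[mu]_x (phi x * gradnorm G x * poisson k.+1%:R^-1 (f x))%:E)%E @[k --> \oo] -->
  (\int[chart_measure]_x (phi x)%:E)%E.
Proof.
pose fd := flux_density G (delta_mx 0 i) phi.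
have fd0 : forall x, 0 <= fd x by exact: flux_density_ge0.
have mfd : measurable_fun setT fd by exact: measurable_flux_density.
pose h y := fd (insU y) * \1_U y.
have mh : measurable_fun setT h.
  by apply: measurable_funM; [exact: measurableT_comp|exact: measurable_indic].
have h0 y : 0 <= h y by rewrite /h mulr_ge0.
pose I01 : set R := `[0, 1]%classic.
(* The line from [x] reaches the graph at time [gU (pr x) - x 0 i], and it counts when this time is
   in [0, 1]. *)
pose lim x := h (pr x) * \1_I01 (gU (pr x) - x 0 i).
have mpr : measurable_fun setT pr.
  apply: measurable_fun_rV => k; rewrite (_ : _ \o _ = rV_coord (lift i k)).
    exact: measurable_rV_coord.
  by apply/funext => x; rewrite /= /rV_coord mxE.
have mlim : measurable_fun setT lim.
  apply: measurable_funM; first exact: measurableT_comp.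
  have mI : measurable_fun setT (\1_I01 : R -> R).
    by apply: measurable_indic; exact: measurable_itv.
  have md : measurable_fun setT (fun x => gU (pr x) - x 0 i : R).
    apply: measurable_funB; first exact: measurableT_comp.
    exact: (@measurable_rV_coord R n.+1 i).
  exact: (measurableT_comp mI md).
have lim_ge0 x : 0 <= lim x by rewrite /lim mulr_ge0.
have -> : (\int[chart_measure]_x (phi x)%:E = \int[mu]_x (lim x)%:E)%E.
  have mphi : measurable_fun setT (fun x => (phi x)%:E).
    by apply/measurable_EFinP; exact: continuous_measurable_rV.
  have phi0 x : (0 <= (phi x)%:E)%E by rewrite lee_fin; case/andP: (phi01 x).
  have mphiU : measurable_fun setT (fun y => (phi (insU y))%:E) by exact: (measurableT_comp mphi minsU).
  transitivity (\int[density_measure (lebesgue_rV n) ma a0]_y (phi (insU y))%:E)%E.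
    exact: (ge0_integral_pushforward minsU _ measurableT mphi (fun x _ => phi0 x)).
  rewrite (@ge0_integral_density _ _ _ (lebesgue_rV n) a ma a0 setT (fun y => (phi (insU y))%:E) measurableT mphiU (fun y _ => phi0 (insU y))).
  rewrite (ge0_integral_rV_insert i); last 2 first.
  - exact/measurable_EFinP.
  - by move=> x; rewrite lee_fin.
  apply: eq_integral => y _.
  transitivity (\int[lebesgue_measure]_t ((h y)%:E * (\1_[set t | I01 (gU y - t)] t)%:E))%E; last first.
    by apply: eq_integral => t _; rewrite -/(ins t y) /lim pr_ins ins_i EFinM !indicE.
  have E : [set t | I01 (gU y - t)] = `[gU y - 1, gU y]%classic.
    by apply/seteqP; split => t; rewrite /I01 /= !in_itv /=; lra.
  have mI : measurable [set t | I01 (gU y - t)] by rewrite E; exact: measurable_itv.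
  rewrite ge0_integralZl//; last 2 first.
  - by apply/measurable_EFinP; exact: measurable_indic.
  - by rewrite lee_fin.
  have mE : lebesgue_measure [set t | I01 (gU y - t)] = 1%E.
    rewrite E lebesgue_measure_itv /= lte_fin ltrBlDr ltrDl ltr01 -EFinB.
    by congr EFin; rewrite opprB addrC subrK.
  rewrite integral_indic// setIT [X in _ = (_ * X)%E]mE mule1 -EFinM; congr EFin.
  rewrite /h /a /fd /patch indicE; case: ifPn => yU; last by rewrite !mulr0.
  have Uy := set_mem yU.
  by rewrite mulr1 /flux_density dot_delta -mulrA insUE// -chart_areaE.
have fv x : f x != 0 -> f (x + delta_mx 0 i) != 0.
  have -> : delta_mx 0 i = rV_int (delta_mx 0 i) :> V.
    by apply/rowP => j; rewrite !mxE; case: (_ && _).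
  by rewrite fper.
have xi (x : V) t : x + t *: delta_mx 0 i = ins (x 0 i + t) (pr x).
  by rewrite -{1}(ins_pr x) insD.
apply: (flux_cvg df cf cG box cphi phi01 phi_ball f0 fv mlim lim_ge0).
- move=> x fx Hx; rewrite /lim /h indicE; have [yU|] := boolP (pr x \in U); last by rewrite mulr0 mul0r.
  have Uy := set_mem yU; rewrite indicE.
  have [tI|] := boolP (gU (pr x) - x 0 i \in I01); last by rewrite mulr0.
  have {}tI := set_mem tI; rewrite /I01 /= in_itv /= in tI.
  have E : x + (gU (pr x) - x 0 i) *: delta_mx 0 i = insU (pr x) by rewrite xi addrC subrK.
  have := Hx _ tI; rewrite E insUE// fins// => /(_ erefl) ph.
  by rewrite /fd /flux_density ph !mul0r.
- move=> x t fx t01 ft pt.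
  have inb : ball x0 e (x + t *: delta_mx 0 i).
    by apply: contra_notP (negP pt) => /phi_ball ->.
  case: chart => _ _ _ E.
  have : ([set x | f x = 0] `&` V0) (x + t *: delta_mx 0 i) by split => //; exact: ballV0.
  rewrite E => -[y Uy]; rewrite -/(ins _ _) xi => E'.
  have yE : y = pr x by rewrite -(pr_ins (g y) y) E' pr_ins.
  have gE : g y = x 0 i + t by rewrite -(ins_i (g y) y) E' ins_i.
  rewrite /lim /h indicE -yE mem_set// mulr1 /gU patchE mem_set// gE addrC addKr.
  rewrite indicE mem_set ?mulr1; last by rewrite /I01 /= in_itv.
  by rewrite insUE// gE.
Qed.

End chart_flux.

Section surface_measure.
Context {R : realType} {n : nat}.
Local Notation V := 'rV[R]_n.
Variables (f : V -> R) (G : V -> V).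
Hypothesis df : forall (gam : R -> V) (t : R) v, is_derive t (1 : R) gam v ->
  is_derive t (1 : R) (fun s => f (gam s)) (dot (G (gam t)) v).
Hypothesis cf : continuous f.
Hypothesis cG : forall v, continuous (fun x => dot (G x) v).
Hypothesis fper : forall x (q : 'rV[int]_n), (f (x + rV_int q) == 0) = (f x == 0).
Variables (b : 'rV[int]_n) (D : nat) (ts : V -> seq R).
Hypothesis ts_sorted : forall x, sorted <%R (ts x).
Hypothesis ts_size : forall x, size (ts x) = D.
Hypothesis tsP : forall x t, (t \in ts x) = (0 <= t < 1) && (f (x + t *: rV_int b) == 0).
Hypothesis Gb : forall x, f x = 0 -> dot (G x) (rV_int b) != 0.

Local Notation rootm := (root_measure cf ts_sorted ts_size tsP).

Let ratio x := gradnorm G x / `|dot (G x) (rV_int b)|.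

Let mratio : measurable_fun setT ratio.
Proof.
apply: measurable_funM; first by apply: continuous_measurable_rV; exact: continuous_gradnorm.
by apply: measurable_fun_inv_norm; apply: continuous_measurable_rV; exact: cG.
Qed.

Let ratio0 x : 0 <= ratio x.
Proof. by rewrite divr_ge0// sqrtr_ge0. Qed.

(** The candidate for the surface measure: the measure carried by the roots, with density 1 / |<n,
    b>|. *)
Definition flux_measure : {measure set V -> \bar R} := density_measure rootm mratio ratio0.

Let mZ : measurable [set x | f x = 0].
Proof.
rewrite -[X in measurable X]setTI.
exact: (continuous_measurable_rV cf measurableT (measurable_set1 0)).
Qed.

Lemma flux_measure_support : flux_measure (~` [set x | f x = 0]) = 0%E.
Proof.
apply: null_set_integral.
- exact: measurableC.
- by apply/measurable_EFinP; exact: measurable_funTS.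
- exact: root_measure_support.
Qed.

Lemma flux_measure_box x0 e s B : flux_box G (rV_int b) x0 e s B ->
  (flux_measure (ball x0 e) < +oo)%E.
Proof.
move=> [e0 s2 Gv gB]; have mb := measurable_rV_ball x0 e0.
have B0 : 0 <= B.
  have xb : ball x0 (3 * e) x0 by apply: ballxx; rewrite mulr_gt0.
  have := le_trans (sqrtr_ge0 _) (gB _ xb); rewrite pmulr_lge0//; exact: Gv.
apply: (@le_lt_trans _ _ (\int[rootm]_(x in ball x0 e) B%:E)%E).
  apply: ge0_le_integral => //.
  - by move=> x _; rewrite lee_fin.
  - by apply/measurable_EFinP; exact: measurable_funTS.
  - move=> x xb; rewrite lee_fin.
    have xb3 : ball x0 (3 * e) x by apply: le_ball xb; move: e0; lra.
    have h0 := Gv _ xb3.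
    have E : `|dot (G x) (rV_int b)| = s * dot (G x) (rV_int b).
      have s1 : `|s| = 1 by apply/eqP; rewrite -(@eqrXn2 _ 2)// expr1n -normrX s2 normr1.
      by rewrite -[LHS]mul1r -s1 -normrM ger0_norm// ltW.
    by rewrite /ratio E ler_pdivrMr//; exact: gB.
rewrite integral_cst//; apply: lte_mul_pinfty => //; exact: root_measure_ball.
Qed.

End surface_measure.

Section surface_chart.
Context {R : realType} {n : nat}.
Local Notation V := 'rV[R]_n.+1.
Variables (f : V -> R) (G : V -> V).
Hypothesis df : forall (gam : R -> V) (t : R) v, is_derive t (1 : R) gam v ->
  is_derive t (1 : R) (fun s => f (gam s)) (dot (G (gam t)) v).
Hypothesis cf : continuous f.
Hypothesis cG : forall v, continuous (fun x => dot (G x) v).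
Hypothesis fper : forall x (q : 'rV[int]_n.+1), (f (x + rV_int q) == 0) = (f x == 0).
Variables (b : 'rV[int]_n.+1) (D : nat) (ts : V -> seq R).
Hypothesis ts_sorted : forall x, sorted <%R (ts x).
Hypothesis ts_size : forall x, size (ts x) = D.
Hypothesis tsP : forall x t, (t \in ts x) = (0 <= t < 1) && (f (x + t *: rV_int b) == 0).
Hypothesis Gb : forall x, f x = 0 -> dot (G x) (rV_int b) != 0.

Let G0 x : f x = 0 -> exists j, G x 0 j != 0.
Proof.
move=> fx; apply/existsP; apply: contraNT (Gb fx); rewrite negb_exists => /forallP H.
by rewrite /dot big1// => j _; have /negPn/eqP -> := H j; rewrite mul0r.
Qed.

(** Around a zero in the chart there is a ball transversal to both [b] and the [i]-th axis. On it
    the two measures give the same integrals of test functions, as limits of one Poisson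
    sequence. *)
Lemma flux_measure_chart i V0 U g A : graph_chart [set x | f x = 0] i V0 U g ->
  measurable A -> A `<=` V0 ->
  flux_measure cf cG ts_sorted ts_size tsP A =
  (\int[lebesgue_rV n]_(y in U `&` [set y | A (@rV_insert R n.+1 i (g y) y)])
     (Num.sqrt (1 + \sum_k ('D_(delta_mx 0 k) g y) ^+ 2))%:E)%E.
Proof.
move=> chart mA AV0; rewrite -(chart_measureE chart mA).
have mZ : measurable [set x | f x = 0].
  rewrite -[X in measurable X]setTI.
  exact: (continuous_measurable_rV cf measurableT (measurable_set1 0)).
apply: (measure_eq_local mZ _ _ _ mA AV0).
- exact: flux_measure_support.
- exact: (chart_measure_support cf chart).
move=> x fx V0x; have Gi : dot (G x) (delta_mx 0 i) != 0.
  rewrite dot_delta; case: (chart) => _ _ _ E.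
  have : ([set x | f x = 0] `&` V0) x by [].
  rewrite E => -[y Uy <-]; exact: (chart_gradient_neq0 df G0 chart Uy).
have [e1 [s1 [B1 box1]]] := exists_flux_box cG Gi.
have [e2 [s2 [B2 box2]]] := exists_flux_box cG (Gb fx).
have [e3 /= e30 ballV] : exists2 e : R, 0 < e & ball x e `<=` V0.
  case: (chart) => oV _ _ _.
  have /nbhs_ballP[e /= e0 He] : nbhs x V0 by exact: open_nbhs_nbhs.
  by exists e.
pose e := Num.min e1 (Num.min e2 e3).
have e10 : 0 < e1 by case: box1.
have e20 : 0 < e2 by case: box2.
have e0 : 0 < e by rewrite !lt_min e10 e20.
have ee1 : e <= e1 by rewrite ge_min lexx.
have ee2 : e <= e2 by rewrite !ge_min lexx orbT.
have ee3 : e <= e3 by rewrite !ge_min lexx !orbT.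
have {}box1 := flux_box_le e0 ee1 box1.
have {}box2 := flux_box_le e0 ee2 box2.
have {}ballV : ball x e `<=` V0 by move=> y /(le_ball ee3)/ballV.
exists e => // A' mA' A'b _; move: A' mA' A'b.
apply: (@measure_eq_sub R n.+1 (flux_measure cf cG ts_sorted ts_size tsP) (chart_measure chart) (ball x e)).
- exact: ball_open.
(* A displacement of size [2 * e] along an axis leaves the ball, as [measure_eq_sub] requires. *)
- exists (x + (2 * e) *: delta_mx 0 i); rewrite -ball_normE /= opprD addrA subrr add0r normrN => H.
  have := le_lt_trans (ler_coord_norm _ i) H.
  by rewrite !mxE !eqxx mulr1 ger0_norm; lra.
- exact: (flux_measure_box cf cG ts_sorted ts_size tsP box2).
move=> phi cphi phi01 phib.
have mphi : measurable_fun setT (fun x => (phi x)%:E).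
  by apply/measurable_EFinP; exact: continuous_measurable_rV.
have phi0 y : (0 <= (phi y)%:E)%E by rewrite lee_fin; case/andP: (phi01 y).
have f0 := zero_set_null cf tsP.
have c1 := @chart_flux_cvg R n f G (@df) cf (@cG) (@fper) (@G0) i V0 U g chart x e s1 B1 box1 ballV phi cphi phi01 phib f0.
have c2 := @root_flux_cvg R n.+1 f G (@df) cf (@cG) (@fper) b D ts ts_sorted ts_size tsP x e s2 B2 box2 phi cphi phi01 phib.
rewrite ge0_integral_density//.
have := cvg_unique _ c1 c2 => ->//.
by apply: eq_integral => y _; rewrite -EFinM mulrA.
Qed.

End surface_chart.

Section dot_linear.
Context {R : realType} {n : nat}.
Variable w : 'rV[R]_n.

Let dot_is_linear : linear (dot w).
Proof. by move=> a u v; rewrite dotDr dotZr. Qed.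

HB.instance Definition _ := GRing.isLinear.Build R 'rV[R]_n R _ (dot w) dot_is_linear.

End dot_linear.

(** * The implicit function theorem *)

Section implicit_function.
Context {R : realType} {n : nat}.
Local Notation V := 'rV[R]_n.+1.
Variables (f : V -> R) (G : V -> V).
Hypothesis df : forall (gam : R -> V) (t : R) v, is_derive t (1 : R) gam v ->
  is_derive t (1 : R) (fun s => f (gam s)) (dot (G (gam t)) v).
Hypothesis cf : continuous f.
Hypothesis cG : forall v, continuous (fun x => dot (G x) v).
Variables (x0 : V) (i : 'I_n.+1).
Hypothesis fx0 : f x0 = 0.

Let ins t (y : 'rV[R]_n) : V := @rV_insert R n.+1 i t y.
Let pr (x : V) : 'rV[R]_n := \row_k x 0 (lift i k).
Let t0 := x0 0 i.
Let y0 := pr x0.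

Let pr_ins t y : pr (ins t y) = y.
Proof. by apply/rowP => k; rewrite !mxE liftK. Qed.

Let ins_i t y : ins t y 0 i = t.
Proof. by rewrite mxE unlift_none. Qed.

Let ins_pr (x : V) : ins (x 0 i) (pr x) = x.
Proof.
by apply/rowP => j; rewrite !mxE; case: unliftP => [k ->|-> //]; rewrite mxE.
Qed.

Let insB t t' y y' : ins t y - ins t' y' = ins (t - t') (y - y').
Proof. by apply/rowP => j; rewrite !mxE; case: unliftP => [k _|_ //]; rewrite !mxE. Qed.

Let ball_ins r t t' y y' : `|t - t'| < r -> ball y r y' -> ball (ins t y) r (ins t' y').
Proof.
move=> tr [r0 yr]; split => // a j; rewrite ord1 !mxE; case: unliftP => [k _|_]; first exact: yr.
by rewrite -ball_normE.
Qed.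

Let ball_pr r (x x' : V) : ball x r x' -> ball (pr x) r (pr x').
Proof. by move=> [r0 xr]; split => // a k; rewrite ord1 !mxE; exact: xr. Qed.

Lemma mean_value_line X X' : exists2 c : R, 0 < c < 1 &
  f X' - f X = dot (G (X + c *: (X' - X))) (X' - X).
Proof.
have dl c : is_derive c (1 : R) (fun u : R => f (X + u *: (X' - X)))
    (dot (G (X + c *: (X' - X))) (X' - X)).
  by apply: (@df (fun u => X + u *: (X' - X))); exact: is_derive_line.
have cl : continuous (fun u : R => f (X + u *: (X' - X))).
  move=> u; apply: (@continuous_comp R V R (fun t : R => X + t *: (X' - X)) f); last exact: cf.
  exact: continuous_line.
have [c /[!in_itv]/= c01 E] : exists2 c, c \in `]0, 1[%R &
    f (X + 1 *: (X' - X)) - f (X + 0 *: (X' - X)) = dot (G (X + c *: (X' - X))) (X' - X) * (1 - 0).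
  by apply: (@MVT R (fun u => f (X + u *: (X' - X)))) => //; exact: continuous_subspaceT.
exists c => //; move: E.
by rewrite scale1r scale0r addr0 (addrC X) subrK subr0 mulr1.
Qed.

Lemma ball_convex (x X X' : V) (r c : R) : 0 <= c <= 1 -> ball x r X -> ball x r X' ->
  ball x r (X + c *: (X' - X)).
Proof.
move=> c01; rewrite -!ball_normE /= => h1 h2.
rewrite (_ : x - _ = (1 - c) *: (x - X) + c *: (x - X')); last first.
  by apply/rowP => j; rewrite !mxE; ring.
apply: (le_lt_trans (ler_normD _ _)); rewrite !normrZ.
rewrite (@ger0_norm _ c) ?(@ger0_norm _ (1 - c)); [|lra|lra].
have [->|c0] := eqVneq c 0; first by rewrite subr0 mul1r mul0r addr0.
have c0' : 0 < c by rewrite lt_neqAle eq_sym c0; case/andP: c01.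
have : (1 - c) * `|x - X| <= (1 - c) * r by apply: ler_wpM2l; [lra|exact: ltW].
have : c * `|x - X'| < c * r by rewrite ltr_pM2l.
by move: (`|x - X|) (`|x - X'|) => a b; lra.
Qed.

Variables (e s B : R).
Hypothesis box : flux_box G (delta_mx 0 i) x0 e s B.
Let r := 3 * e.
Let e0 : 0 < e. Proof. by case: box. Qed.
Let er : e < r. Proof. by rewrite /r; move: e0; lra. Qed.
Let r0 : 0 < r. Proof. exact: lt_trans er. Qed.
Let Gi x : ball x0 r x -> 0 < s * G x 0 i.
Proof. by case: box => _ _ + _ xr => /(_ x xr); rewrite dot_delta. Qed.
Let Gi_neq0 x : ball x0 r x -> G x 0 i != 0.
Proof. by move=> /Gi; apply: contraTneq => ->; rewrite mulr0 ltxx. Qed.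

Let ballE t y : `|t - t0| < r -> ball y0 r y -> ball x0 r (ins t y).
Proof. by move=> tr yr; rewrite -(ins_pr x0); apply: ball_ins => //; rewrite distrC. Qed.

Let increasing t t' y : ball x0 r (ins t y) -> ball x0 r (ins t' y) -> t < t' ->
  s * f (ins t y) < s * f (ins t' y).
Proof.
move=> b1 b2 tt'; have [c c01 E] := mean_value_line (ins t y) (ins t' y).
have bc : ball x0 r (ins t y + c *: (ins t' y - ins t y)) by apply: ball_convex => //; lra.
move: bc E; set xi := ins t y + _ => bc E; rewrite -subr_gt0 -mulrBr E insB subrr dot_insert big1 => [|k _]; last by rewrite mxE mulr0.
by rewrite addr0 mulrA mulr_gt0 ?subr_gt0//; exact: Gi.
Qed.

Let t0n t : `|t - t0| < e -> `|t - t0| < r. Proof. by move=> /lt_trans; apply. Qed.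

Let sp : 0 < s * f (ins (t0 + e) y0).
Proof.
have -> : 0 = s * f (ins t0 y0) by rewrite ins_pr fx0 mulr0.
apply: increasing; rewrite ?ltrDl//; apply: ballE; try exact: ballxx.
  by rewrite subrr normr0.
by rewrite addrC addKr ger0_norm// ltW.
Qed.

Let sm : s * f (ins (t0 - e) y0) < 0.
Proof.
have -> : 0 = s * f (ins t0 y0) by rewrite ins_pr fx0 mulr0.
apply: increasing; rewrite ?gtrBl//; apply: ballE; try exact: ballxx.
  by rewrite addrC addKr normrN ger0_norm// ltW.
by rewrite subrr normr0.
Qed.

Let continuous_ins (g : 'rV[R]_n -> R) y : {for y, continuous g} ->
  {for y, continuous (fun y => ins (g y) y)}.
Proof.
move=> cg A /nbhs_ballP[d /= d0 Ad].
have cg' : g y' @[y' --> y] --> g y by exact: cg.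
have H1 : \forall y' \near y, ball (g y) d (g y') := cg' _ (nbhsx_ballx (g y) d d0).
have H2 : \forall y' \near y, ball y d y' by exact: nbhsx_ballx.
apply: filterS (filterI H1 H2) => y' [h1 h2]; apply: Ad; apply: ball_ins => //.
Qed.

Let continuous_pr : continuous pr.
Proof.
move=> x A /nbhs_ballP[d /= d0 Ad]; apply/nbhs_ballP; exists d => //= x' xx'.
by apply: Ad; exact: ball_pr.
Qed.

(** The opposite signs of [f] at heights [t0 - e] and [t0 + e] above [y0] persist above nearby
    points, which prepares the intermediate value theorem. *)
Let exists_delta : exists d, [/\ 0 < d, d <= r &
  forall y, ball y0 d y -> 0 < s * f (ins (t0 + e) y) /\ s * f (ins (t0 - e) y) < 0].
Proof.
have cc t : {for y0, continuous (fun y => s * f (ins t y))}.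
  apply: (@continuousM R _ (cst s) (fun y => f (ins t y))); first exact: cst_continuous.
  apply: (@continuous_comp _ _ _ (fun y => ins t y) f); last exact: cf.
  exact/continuous_ins/cst_continuous.
have cc' t : s * f (ins t y) @[y --> y0] --> s * f (ins t y0) by exact: cc.
have sm' : 0 < - (s * f (ins (t0 - e) y0)) by rewrite oppr_gt0.
have H1 : nbhs y0 [set y | ball (s * f (ins (t0 + e) y0)) (s * f (ins (t0 + e) y0))
    (s * f (ins (t0 + e) y))] := cc' (t0 + e) _ (nbhsx_ballx _ _ sp).
have H2 : nbhs y0 [set y | ball (s * f (ins (t0 - e) y0)) (- (s * f (ins (t0 - e) y0)))
    (s * f (ins (t0 - e) y))] := cc' (t0 - e) _ (nbhsx_ballx _ _ sm').
have [d /= d0 Hd] := (nbhs_ballP y0 _).1 (filterI H1 H2).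
have {}Hd y : ball y0 d y -> 0 < s * f (ins (t0 + e) y) /\ s * f (ins (t0 - e) y) < 0.
  move=> /Hd[]; rewrite /= -!ball_normE /= => h1 h2; split.
    by move: h1; rewrite ltr_norml; lra.
  by move: h2; rewrite ltr_norml; lra.
exists (Num.min d r); split; first by rewrite lt_min d0 r0.
- by rewrite ge_min lexx orbT.
- by move=> y yd; apply: Hd; apply: le_ball yd; rewrite ge_min lexx.
Qed.

Section graph.
Variables (d : R) (g : 'rV[R]_n -> R).
Hypotheses (d0 : 0 < d) (dr : d <= r).
Let U := ball y0 d.
Hypothesis gP : forall y, U y -> `|g y - t0| < e /\ f (ins (g y) y) = 0.

Let X y := ins (g y) y.

Let Xball y : U y -> ball x0 r (X y).
Proof. by move=> Uy; apply: ballE; [apply: t0n; have [] := gP Uy|exact: le_ball Uy]. Qed.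

(** On the graph, the opposite of the [k]-th partial derivative of the implicit function. *)
Let H k x := G x 0 (lift i k) / G x 0 i.

Let B0 : 0 <= B.
Proof.
have xb : ball x0 r x0 by exact: ballxx.
case: box => _ _ Gv gB.
have := le_trans (sqrtr_ge0 _) (gB _ xb); rewrite pmulr_lge0//; exact: Gv.
Qed.

Let HB_ k x : ball x0 r x -> `|H k x| <= B.
Proof.
move=> xb; case: box => _ s2 _ gB; have := gB _ xb; rewrite dot_delta => gx.
have h0 := Gi xb.
have s1 : `|s| = 1 by apply/eqP; rewrite -(@eqrXn2 _ 2)// expr1n -normrX s2 normr1.
have E : `|G x 0 i| = s * G x 0 i by rewrite -[LHS]mul1r -s1 -normrM ger0_norm// ltW.
rewrite /H normrM normfV E ler_pdivrMr//; apply: le_trans gx.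
rewrite -sqrtr_sqr ler_wsqrtr// /dot (bigD1 (lift i k))//= -expr2 lerDl.
by apply: sumr_ge0 => j _; rewrite -expr2 sqr_ge0.
Qed.

Let cH k x : ball x0 r x -> {for x, continuous (H k)}.
Proof.
move=> xb; have cc j : continuous (fun x => G x 0 j).
  by under eq_fun do rewrite -dot_delta; exact: cG.
apply: (@continuousM R V (fun x => G x 0 (lift i k)) (fun x => (G x 0 i)^-1)); first exact: cc.
apply: (@continuousV R V (fun x => G x 0 i)); [exact: Gi_neq0|exact: cc].
Qed.

(** [f] vanishes at both graph points, so the mean value theorem on the segment between them can be
    solved for the increment of [g]. Lipschitz continuity, differentiability and the value of the
    derivative all come from this formula. *)
Let increment y y' : U y -> U y' -> exists2 c : R, 0 <= c <= 1 &
  g y' - g y = - \sum_k H k (X y + c *: (X y' - X y)) * (y' - y) 0 k.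
Proof.
move=> Uy Uy'; have [c c01 E] := mean_value_line (X y) (X y').
have c01' : 0 <= c <= 1 by move: c01; lra.
exists c => //; have bc := ball_convex c01' (Xball Uy) (Xball Uy').
move: E; rewrite (gP Uy).2 (gP Uy').2 subrr; set xi := _ + _.
rewrite insB dot_insert => /esym/eqP; rewrite addr_eq0 => /eqP E.
apply: (mulfI (Gi_neq0 bc)); rewrite E mulrN mulr_sumr; congr (- _).
by apply: eq_bigr => k _; rewrite mulrA /H mulrCA mulfV ?mulr1// Gi_neq0.
Qed.

Let lipschitz y y' : U y -> U y' -> `|g y' - g y| <= n%:R * B * `|y' - y|.
Proof.
move=> Uy Uy'; have [c c01 ->] := increment Uy Uy'.
have bc := ball_convex c01 (Xball Uy) (Xball Uy').
rewrite normrN; apply: (le_trans (ler_norm_sum _ _ _)).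
apply: (@le_trans _ _ (\sum_(k < n) B * `|y' - y|)).
  apply: ler_sum => k _; rewrite normrM; apply: ler_pM => //; first exact: HB_.
  exact: ler_coord_norm.
by rewrite sumr_const card_ord -mulrA mulr_natl.
Qed.

Let Uopen : open U. Proof. exact: ball_open. Qed.

Let cg y : U y -> {for y, continuous g}.
Proof.
move=> Uy A /nbhs_ballP[eps /= eps0 HA].
have nB : 0 < n%:R * B + 1 by rewrite ltr_wpDl// mulr_ge0.
have eB : 0 < eps / (n%:R * B + 1) by rewrite divr_gt0.
have H2 : nbhs y U by exact: open_nbhs_nbhs.
apply: filterS (filterI (nbhsx_ballx y _ eB) H2) => y' [yy Uy']; apply: HA.
move: yy; rewrite -!ball_normE /= => yy; rewrite distrC.
apply: (le_lt_trans (lipschitz Uy Uy')); rewrite distrC.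
apply: (@le_lt_trans _ _ ((n%:R * B + 1) * `|y - y'|)).
  by rewrite ler_wpM2r// lerDl.
by rewrite -ltr_pdivlMl// mulrC.
Qed.

Let cX y : U y -> {for y, continuous X}.
Proof. by move=> /cg; exact: continuous_ins. Qed.

Let w y : 'rV[R]_n := \row_k - H k (X y).

(** The error in [increment] is governed by the oscillation of [H] between [X y] and the
    intermediate point, which tends to [X y] by continuity of the graph map. *)
Let diff_g y : U y -> g \o shift y = cst (g y) + dot (w y) +o_ 0 id.
Proof.
move=> Uy; apply/eqaddoP => eps eps0.
pose K z := \sum_k `|H k z - H k (X y)|.
have cK : {for X y, continuous K}.
  have cs (rr : seq 'I_n) : \sum_(k <- rr) `|H k z - H k (X y)| @[z --> X y] -->
      \sum_(k <- rr) `|H k (X y) - H k (X y)|.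
    elim: rr => [|k rr IH].
      by under eq_fun do rewrite big_nil; rewrite big_nil; exact: (@cst_continuous _ _ (0 : R) (X y)).
    under eq_fun do rewrite big_cons; rewrite big_cons.
    have h1 : H k z @[z --> X y] --> H k (X y) by exact: (cH (Xball Uy)).
    have h2 : `|H k z - H k (X y)| @[z --> X y] --> `|H k (X y) - H k (X y)|.
      exact: (cvg_norm (cvgB h1 (@cst_continuous _ _ (H k (X y)) (X y)))).
    exact: (cvgD h2 IH).
  exact: cs.
have K0 : K (X y) < eps by rewrite /K big1// => k _; rewrite subrr normr0.
have eK : 0 < eps - K (X y) by rewrite subr_gt0.
have cK' : K z @[z --> X y] --> K (X y) by exact: cK.
have /nbhs_ballP[rho /= rho0 Hrho'] := cK' _ (nbhsx_ballx _ _ eK).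
have Hrho z : ball (X y) rho z -> K z < eps.
  by move=> /Hrho'; rewrite /= -ball_normE /= ltr_norml; lra.
have h1 : nbhs y U by exact: open_nbhs_nbhs.
have h2 : nbhs y [set y' | ball (X y) rho (X y')] := cX Uy (nbhsx_ballx _ _ rho0).
have [q /= q0 Hq] := (nbhs_ballP y _).1 (filterI h1 h2).
apply/nbhs_ballP; exists q => //= h; rewrite -ball_normE /= sub0r normrN => hq.
have [Uh bh] : U (h + y) /\ ball (X y) rho (X (h + y)).
  by apply: Hq; rewrite -ball_normE /= opprD addrCA subrr addr0 normrN.
have [c c01 E] := increment Uy Uh.
have Hc : K (X y + c *: (X (h + y) - X y)) < eps.
  by apply: Hrho; apply: ball_convex => //; exact: ballxx.
rewrite /= addrK in E.
have -> : (g \o shift y - (cst (g y) + dot (w y))) h =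
   - \sum_k (H k (X y + c *: (X (h + y) - X y)) - H k (X y)) * h 0 k.
  transitivity (g (h + y) - g y - dot (w y) h); first by rewrite /= !fctE /= opprD addrA.
  rewrite E /dot -opprD -big_split /=; congr (- _); apply: eq_bigr => k _.
  by rewrite mxE; ring.
rewrite normrN; apply: (le_trans (ler_norm_sum _ _ _)).
apply: (@le_trans _ _ (K (X y + c *: (X (h + y) - X y)) * `|h|)).
  rewrite mulr_suml; apply: ler_sum => k _; rewrite normrM ler_wpM2l//.
  exact: ler_coord_norm.
by rewrite ler_wpM2r// ltW.
Qed.

Let diffE_g y : U y -> 'd g y = dot (w y) :> ('rV[R]_n -> R).
Proof.
move=> Uy; apply: diff_unique; first exact: dot_continuous.
exact: diff_g.
Qed.

Lemma implicit_C1 : C1_on U g.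
Proof.
have dg y : U y -> differentiable g y.
  move=> Uy; apply/diff_locallyP; rewrite diffE_g//; split; first exact: dot_continuous.
  exact: diff_g.
move=> y Uy; split; first exact: dg.
move=> k; have DE y' : U y' -> 'D_(delta_mx 0 k) g y' = - H k (X y').
  by move=> Uy'; rewrite deriveE; [rewrite diffE_g// dot_delta mxE|exact: dg].
have c1 : - H k (X y') @[y' --> y] --> - H k (X y).
  have h : {for y, continuous (H k \o X)}.
    by apply: continuous_comp; [exact: cX|exact: (cH (Xball Uy))].
  exact: (cvgN h).
suff : 'D_(delta_mx 0 k) g y' @[y' --> y] --> 'D_(delta_mx 0 k) g y by [].
rewrite DE// => A nA.
have h1 : nbhs y U by exact: open_nbhs_nbhs.
have h2 : nbhs y [set y' | A (- H k (X y'))] := c1 A nA.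
by apply: filterS (filterI h2 h1) => y' [/= + Uy']; rewrite DE.
Qed.

End graph.

Lemma implicit_chart : exists V0 U g, graph_chart [set x | f x = 0] i V0 U g /\ V0 x0.
Proof.
have [d [d0 dr Hd]] := exists_delta.
have s0 : s != 0 by case: box => _ /eqP + _ _; apply: contraTneq => ->; rewrite expr0n eq_sym oner_eq0.
have ex y : exists t, ball y0 d y -> `|t - t0| < e /\ f (ins t y) = 0.
  have [yd|] := pselect (ball y0 d y); last by exists 0.
  have [h1 h2] := Hd _ yd.
  have ct : continuous (fun t => s * f (ins t y)).
    move=> t; apply: (@continuousM R _ (cst s) (fun t => f (ins t y))); first exact: cst_continuous.
    apply: (@continuous_comp _ _ _ (fun t => ins t y) f); last exact: cf.
    move=> A /nbhs_ballP[q /= q0 Aq]; apply/nbhs_ballP; exists q => //= t' tt'.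
    by apply: Aq; apply: ball_ins; [move: tt'; rewrite -ball_normE|exact: ballxx].
  have le : t0 - e <= t0 + e by move: e0; lra.
  have cW : {within `[t0 - e, t0 + e], continuous (fun t => s * f (ins t y))}.
    exact: continuous_subspaceT.
  have hv : Num.min (s * f (ins (t0 - e) y)) (s * f (ins (t0 + e) y)) <= 0 <=
      Num.max (s * f (ins (t0 - e) y)) (s * f (ins (t0 + e) y)).
    by rewrite ge_min le_max (ltW h1) (ltW h2) orbT.
  have [c cI fc] := IVT le cW hv.
  exists c => _; have f0 : f (ins c y) = 0.
    by move/eqP: fc; rewrite mulf_eq0 (negbTE s0) => /eqP.
  split => //; move: cI; rewrite in_itv /= => /andP[c1 c2].
  have n1 : c != t0 - e by apply: contraTneq h2 => <-; rewrite f0 mulr0 ltxx.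
  have n2 : c != t0 + e by apply: contraTneq h1 => <-; rewrite f0 mulr0 ltxx.
  by move: c1 c2 n1 n2; rewrite ltr_norml !le_eqVlt eq_sym => /orP[/eqP ->|c1]; rewrite ?eqxx// => /orP[/eqP ->|c2]; rewrite ?eqxx//; lra.
have [g gP] := choice ex.
exists [set x : V | ball t0 e (x 0 i) /\ ball y0 d (pr x)], (ball y0 d : set 'rV[R]_n), g; split; last first.
  by split; [exact: ballxx|exact: ballxx].
split.
- rewrite [X in open X](_ : _ = [set x : V | ball t0 e (x 0 i)] `&` [set x | ball y0 d (pr x)])//.
  apply: openI.
    by apply: (@open_comp _ _ (fun x : V => x 0 i) (ball t0 e)); [move=> x _; exact: coord_continuous|exact: ball_open].
  by apply: (@open_comp _ _ pr (ball y0 d)); [move=> x _; exact: continuous_pr|exact: ball_open].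
- exact: ball_open.
- exact: implicit_C1.
apply/seteqP; split => [x /= [fx [xi yx]]|_ [y /= Uy <-]].
  exists (pr x) => //; have [h1 h2] := gP _ yx.
  rewrite -[RHS]ins_pr -/(ins _ _); congr ins.
  have b1 : ball x0 r (ins (g (pr x)) (pr x)) by apply: ballE; [exact: t0n|exact: le_ball yx].
  have b2 : ball x0 r (ins (x 0 i) (pr x)).
    apply: ballE; [apply: t0n; move: xi|exact: le_ball yx].
    by rewrite -ball_normE /= distrC.
  have fx' : f (ins (x 0 i) (pr x)) = 0 by rewrite ins_pr.
  have [lt|lt|//] := ltgtP (g (pr x)) (x 0 i).
    by have := increasing b1 b2 lt; rewrite h2 fx' ltxx.
  by have := increasing b2 b1 lt; rewrite h2 fx' ltxx.
have [h1 h2] := gP _ Uy; split => //; rewrite /= -/(ins _ _) ins_i pr_ins; split => //.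
by rewrite -ball_normE /= distrC.
Qed.

End implicit_function.

Lemma chart_at (R : realType) (n : nat) (f : 'rV[R]_n -> R) (G : 'rV[R]_n -> 'rV[R]_n) x i :
  (forall (gam : R -> 'rV[R]_n) (t : R) v, is_derive t (1 : R) gam v ->
     is_derive t (1 : R) (fun s => f (gam s)) (dot (G (gam t)) v)) ->
  continuous f -> (forall v, continuous (fun x => dot (G x) v)) ->
  f x = 0 -> G x 0 i != 0 ->
  exists V0 U g, graph_chart [set x | f x = 0] i V0 U g /\ V0 x.
Proof.
case: n f G x i => [|n] f G x i df cf cG fx Gi; first by case: i Gi.
have Gi' : dot (G x) (delta_mx 0 i) != 0 by rewrite dot_delta.
have [e [s [B box]]] := exists_flux_box cG Gi'.
exact: (@implicit_chart R n f G (@df) cf (@cG) x i fx e s B box).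
Qed.

(** The tangent vectors of a chart span the hyperplane orthogonal to the gradient. This pins down
    any field of unit normals up to sign, [unit_normal] only asking for orthogonality to tangent
    curves. *)
Lemma chart_normal (R : realType) (n : nat) (f : 'rV[R]_n -> R) (G : 'rV[R]_n -> 'rV[R]_n) x i v :
  (forall (gam : R -> 'rV[R]_n) (t : R) v, is_derive t (1 : R) gam v ->
     is_derive t (1 : R) (fun s => f (gam s)) (dot (G (gam t)) v)) ->
  continuous f -> (forall v, continuous (fun x => dot (G x) v)) ->
  f x = 0 -> G x 0 i != 0 -> (forall w, tangent [set x | f x = 0] x w -> dot v w = 0) ->
  exists c : R, v = c *: G x.
Proof.
case: n f G x i v => [|n] f G x i v df cf cG fx Gi Hv; first by case: i Gi.
have [V0 [U [g [chart V0x]]]] := chart_at (@df) cf (@cG) fx Gi.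
case: (chart) => _ _ _ E.
have : ([set x | f x = 0] `&` V0) x by [].
rewrite E => -[y Uy yx]; rewrite -yx in Hv Gi *.
have tan k := chart_tangent chart k Uy.
exists (v 0 i / G (rV_insert i (g y) y) 0 i); apply/rowP => j; rewrite mxE.
have [k ->|->] := unliftP i j; last by rewrite divfK.
have h1 := Hv _ (tan k); have h2 := tangent_gradient (@df) (tan k).
move: h1 h2; rewrite !dotDr !dotZr !dot_delta.
set d := 'D_ _ _ _; move: Gi; move: (G _ 0 i) (G _ 0 (lift i k)) (v 0 i) (v 0 (lift i k)) => a b c e.
move=> a0 h1 h2; have -> : e = - (d * c) by lra.
have -> : b = - (d * a) by lra.
by field.
Qed.

Lemma surface_measure_flux (R : realType) (n : nat) (f : 'rV[R]_n -> R) (G : 'rV[R]_n -> 'rV[R]_n)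
  (df : forall (gam : R -> 'rV[R]_n) (t : R) v, is_derive t (1 : R) gam v ->
     is_derive t (1 : R) (fun s => f (gam s)) (dot (G (gam t)) v))
  (cf : continuous f) (cG : forall v, continuous (fun x => dot (G x) v))
  (fper : forall x (q : 'rV[int]_n), (f (x + rV_int q) == 0) = (f x == 0))
  (b : 'rV[int]_n) (D : nat) (ts : 'rV[R]_n -> seq R)
  (ts_sorted : forall x, sorted <%R (ts x)) (ts_size : forall x, size (ts x) = D)
  (tsP : forall x t, (t \in ts x) = (0 <= t < 1) && (f (x + t *: rV_int b) == 0))
  (Gb : forall x, f x = 0 -> dot (G x) (rV_int b) != 0) :
  surface_measure [set x | f x = 0] (flux_measure cf cG ts_sorted ts_size tsP).
Proof.
split; first exact: flux_measure_support.
case: n f G df cf cG fper b ts ts_sorted ts_size tsP Gb =>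
  [|n] f G df cf cG fper b ts ts_sorted ts_size tsP Gb i V0 U g chart A mA AV0.
  by case: i chart.
exact: (flux_measure_chart (@df) cf (@cG) (@fper) ts_sorted ts_size tsP (@Gb) chart mA AV0).
Qed.

(** * Existence and formula for directed measures *)

Section directed.
Context {R : realType} {n : nat}.
Local Notation V := 'rV[R]_n.
Local Notation mu := (lebesgue_rV n).
Variables (f : V -> R) (G : V -> V).
Hypothesis df : forall (gam : R -> V) (t : R) v, is_derive t (1 : R) gam v ->
  is_derive t (1 : R) (fun s => f (gam s)) (dot (G (gam t)) v).
Hypothesis cf : continuous f.
Hypothesis cG : forall v, continuous (fun x => dot (G x) v).
Hypothesis fper : forall x (q : 'rV[int]_n), (f (x + rV_int q) == 0) = (f x == 0).
Variables (b : 'rV[int]_n) (D : nat) (ts : V -> seq R).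
Hypothesis ts_sorted : forall x, sorted <%R (ts x).
Hypothesis ts_size : forall x, size (ts x) = D.
Hypothesis tsP : forall x t, (t \in ts x) = (0 <= t < 1) && (f (x + t *: rV_int b) == 0).
Hypothesis Gb : forall x, f x = 0 -> dot (G x) (rV_int b) != 0.

Local Notation Z := [set x | f x = 0].
Local Notation flux := (flux_measure cf cG ts_sorted ts_size tsP).
Local Notation rootm := (root_measure cf ts_sorted ts_size tsP).

Let mZ : measurable Z.
Proof.
rewrite -[X in measurable X]setTI.
exact: (continuous_measurable_rV cf measurableT (measurable_set1 0)).
Qed.

Let G_neq0 x : f x = 0 -> exists j, G x 0 j != 0.
Proof.
move=> fx; apply/existsP; apply: contraNT (Gb fx); rewrite negb_exists => /forallP H.
by rewrite /dot big1// => j _; have /negPn/eqP -> := H j; rewrite mul0r.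
Qed.

Let gradnorm_gt0 x : f x = 0 -> 0 < gradnorm G x.
Proof.
move=> /G_neq0[j Gj]; rewrite sqrtr_gt0 /dot (bigD1 j)//= ltr_pwDl//.
  by rewrite -expr2 exprn_even_gt0.
by apply: sumr_ge0 => k _; rewrite -expr2 sqr_ge0.
Qed.

Let dotGG x : dot (G x) (G x) = gradnorm G x ^+ 2.
Proof. by rewrite sqr_sqrtr//; apply: sumr_ge0 => k _; rewrite -expr2 sqr_ge0. Qed.

(** The implicit function theorem provides a chart at every zero, and in a chart both measures are
    given by the same integral. *)
Lemma surface_measure_unique (sigma : {measure set V -> \bar R}) : surface_measure Z sigma ->
  forall A, measurable A -> sigma A = flux A.
Proof.
move=> [s0 sE] A mA; have [f0 fE] := surface_measure_flux (@df) cf (@cG) (@fper) ts_sorted ts_size tsP (@Gb).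
apply: (measure_eq_local mZ s0 f0 _ mA (@subsetT _ A)) => x fx _.
have [i Gi] := G_neq0 fx.
have [V0 [U [g [chart V0x]]]] := chart_at (@df) cf (@cG) fx Gi.
have oV : open V0 by case: chart.
have /nbhs_ballP[e /= e0 He] : nbhs x V0 by exact: open_nbhs_nbhs.
exists e => // A' mA' A'e _; have A'V : A' `<=` V0 by exact: subset_trans He.
rewrite (sE _ _ _ _ chart A' mA' A'V); apply/esym; exact: (fE _ _ _ _ chart A' mA' A'V).
Qed.

Lemma unit_normal_dot x v l : f x = 0 -> unit_normal Z x v ->
  `|dot v l| = `|dot (G x) l| / gradnorm G x.
Proof.
move=> fx [v1 Hv]; have [i Gi] := G_neq0 fx; have g0 := gradnorm_gt0 fx.
have [c vE] := chart_normal (@df) cf (@cG) fx Gi Hv.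
move: v1; rewrite vE dotZl dotZr dotGG mulrA -expr2 -exprMn => c1.
have cg : `|c| * gradnorm G x = 1.
  rewrite -[X in _ * X]ger0_norm ?ltW// -normrM; apply/eqP.
  by rewrite -(@eqrXn2 _ 2)// expr1n -normrX c1 normr1.
rewrite dotZl normrM; apply: (mulIf (lt0r_neq0 g0)).
by rewrite divfK ?gt_eqF// mulrAC cg mul1r.
Qed.

Lemma unit_normal_grad x : f x = 0 -> unit_normal Z x ((gradnorm G x)^-1 *: G x).
Proof.
move=> fx; have g0 := gradnorm_gt0 fx; split.
  by rewrite dotZl dotZr dotGG expr2 mulKf ?mulVf// gt_eqF.
by move=> w /(tangent_gradient (@df)) Gw; rewrite dotZl Gw mulr0.
Qed.

Variable l : V.

Definition flux_ratio x := `|dot (G x) l| / `|dot (G x) (rV_int b)|.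

Lemma measurable_flux_ratio : measurable_fun setT flux_ratio.
Proof.
apply: measurable_funM.
  by apply: measurableT_comp => //; apply: continuous_measurable_rV; exact: cG.
by apply: measurable_fun_inv_norm; apply: continuous_measurable_rV; exact: cG.
Qed.

Lemma flux_ratio_ge0 x : 0 <= flux_ratio x.
Proof. by rewrite divr_ge0. Qed.

Let nl x := `|dot (G x) l| / gradnorm G x.

Let mnl : measurable_fun setT nl.
Proof.
have -> : nl = fun x => `|dot (G x) l| * `|gradnorm G x|^-1.
  by apply/funext => x; rewrite /nl /gradnorm (ger0_norm (sqrtr_ge0 _)).
apply: measurable_funM.
  by apply: measurableT_comp => //; apply: continuous_measurable_rV; exact: cG.
by apply: measurable_fun_inv_norm; apply: continuous_measurable_rV; exact: continuous_gradnorm.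
Qed.

Let nl0 x : 0 <= nl x. Proof. by rewrite divr_ge0// sqrtr_ge0. Qed.

Lemma exists_directed_measure : exists m, directed_measure Z l m.
Proof.
have mh : measurable_fun setT (nl \_ Z).
  exact: ((measurable_restrictT _ mZ).1 (measurable_funS measurableT (@subsetT _ _) mnl)).
have h0 x : 0 <= (nl \_ Z) x by rewrite patchE; case: ifP.
exists (density_measure flux mh h0), flux, (fun x => (gradnorm G x)^-1 *: G x); split.
- exact: surface_measure_flux.
- by move=> x; exact: unit_normal_grad.
- move=> A mA; rewrite -[LHS]/(\int[flux]_(x in A) ((nl \_ Z) x)%:E)%E.
  rewrite [RHS]integral_mkcondr; apply: eq_integral => x _.
  rewrite !patchE; case: ifPn => // xZ; have fx := set_mem xZ.
  by rewrite (unit_normal_dot _ fx (unit_normal_grad fx)).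
Qed.

(** The norm of the gradient cancels between the unit normal and the density of the surface
    measure. *)
Lemma directed_measureE m : directed_measure Z l m -> forall A, measurable A ->
  m A = (\int[rootm]_(x in A `&` Z) (flux_ratio x)%:E)%E.
Proof.
move=> [sigma [N [sS NP mE]]] A mA; have mAZ : measurable (A `&` Z) by exact: measurableI.
rewrite mE// (eq_integral (fun x => (nl x)%:E)); last first.
  by move=> x /set_mem[_ fx]; rewrite (unit_normal_dot l fx (NP _ fx)).
rewrite (eq_measure_integral flux); last by move=> B mB _; exact: surface_measure_unique.
rewrite ge0_integral_density//; last 2 first.
- by apply/measurable_EFinP; exact: (measurable_funS measurableT (@subsetT _ _) mnl).
- by move=> x _; rewrite lee_fin.
apply: eq_integral => x /set_mem[_ fx]; rewrite -EFinM; congr EFin.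
have g0 := gradnorm_gt0 fx.
by rewrite /nl /flux_ratio mulrA divfK// gt_eqF.
Qed.

End directed.

Lemma unit_cube_compact (R : realType) n : exists2 A, compact A & @unit_cube R n `<=` A.
Proof.
exists [set v : 'rV[R]_n | forall i, `[0, 1]%classic (v ord0 i)].
  exact: (@rV_compact R n (fun=> `[0, 1]%classic) (fun=> @segment_compact R 0 1)).
by move=> x Cx i /=; rewrite in_itv /=; have /andP[-> /ltW ->] := Cx i.
Qed.

Section periodic_directed.
Context {R : realType} {n : nat}.
Local Notation V := 'rV[R]_n.
Local Notation mu := (lebesgue_rV n).
Variables (f : V -> R) (G : V -> V).
Hypothesis df : forall (gam : R -> V) (t : R) v, is_derive t (1 : R) gam v ->
  is_derive t (1 : R) (fun s => f (gam s)) (dot (G (gam t)) v).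
Hypothesis cf : continuous f.
Hypothesis cG : forall v, continuous (fun x => dot (G x) v).
Hypothesis fper : forall x (q : 'rV[int]_n), (f (x + rV_int q) == 0) = (f x == 0).
Hypothesis Gper : forall x (q : 'rV[int]_n) v, `|dot (G (x + rV_int q)) v| = `|dot (G x) v|.
Variables (b : 'rV[int]_n) (D : nat) (ts : V -> seq R).
Hypothesis ts_sorted : forall x, sorted <%R (ts x).
Hypothesis ts_size : forall x, size (ts x) = D.
Hypothesis tsP : forall x t, (t \in ts x) = (0 <= t < 1) && (f (x + t *: rV_int b) == 0).
Hypothesis Gb : forall x, f x = 0 -> dot (G x) (rV_int b) != 0.

Local Notation Z := [set x | f x = 0].
Local Notation rootm := (root_measure cf ts_sorted ts_size tsP).
Local Notation rm := (root_map (rV_int b) ts).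

Let mrm j : measurable_fun setT (rm j). Proof. exact: (measurable_root_map cf ts_sorted ts_size tsP). Qed.

Lemma root_map_periodic j x (q : 'rV[int]_n) : rm j (x + rV_int q) = rm j x + rV_int q.
Proof.
suff -> : rm j (x + rV_int q) = (x + rV_int q) + nth_root ts j x *: rV_int b by rewrite addrAC.
rewrite /root_map /nth_root; congr (_ + nth _ _ _ *: _).
apply: lt_sorted_eq; rewrite ?ts_sorted// => t; rewrite !tsP; congr (_ && _).
by rewrite addrAC fper.
Qed.

Let mZ : measurable Z.
Proof.
rewrite -[X in measurable X]setTI.
exact: (continuous_measurable_rV cf measurableT (measurable_set1 0)).
Qed.

Variables (l : V) (m : {measure set V -> \bar R}).
Hypothesis dm : directed_measure Z l m.

Local Notation wl := (flux_ratio G b l).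

Let mwl : measurable_fun setT wl. Proof. exact: measurable_flux_ratio. Qed.

Let wl0 x : 0 <= wl x. Proof. exact: flux_ratio_ge0. Qed.

Let wl_per x (q : 'rV[int]_n) : wl (x + rV_int q) = wl x.
Proof. by rewrite /flux_ratio !Gper. Qed.

Let mE A : measurable A -> m A = (\int[rootm]_(x in A) (wl x)%:E)%E.
Proof.
move=> mA; rewrite (@directed_measureE R n f G (@df) cf (@cG) (@fper) b D ts ts_sorted ts_size tsP (@Gb) l m dm A mA).
rewrite [RHS](ge0_negligible_integral (N := ~` Z))//.
- by rewrite setDE setCK.
- exact: measurableC.
- by apply/measurable_EFinP; exact: (measurable_funS measurableT (@subsetT _ _) mwl).
- by move=> x _; rewrite lee_fin.
- exact: root_measure_support.
Qed.

Lemma directed_null_support : exists S, [/\ closed S, mu S = 0%E & m (~` S) = 0%E].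
Proof.
exists Z; split.
- by apply: (@closed_comp _ _ f [set 0]); [move=> x _; exact: cf|exact: closed_eq].
- exact: (zero_set_null cf tsP).
- rewrite (@directed_measureE R n f G (@df) cf (@cG) (@fper) b D ts ts_sorted ts_size tsP (@Gb) l m dm _ (measurableC mZ)).
  by rewrite setICl integral_set0.
Qed.

(** On the zero set the denominator of the density does not vanish, so the density is continuous
    there, hence bounded on the compact set of zeros in [A]; the root measure is finite on balls. *)
Lemma directed_radon : radon m.
Proof.
move=> A cA; have hV : hausdorff_space V by exact: norm_hausdorff.
have clA := compact_closed hV cA.
have mA : measurable A.
  by rewrite -[A]setCK; apply: measurableC; apply: measurable_rV_open; rewrite openC.
have clZ : closed Z by apply: (@closed_comp _ _ f [set 0]); [move=> x _; exact: cf|exact: closed_eq].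
have cAZ : compact (A `&` Z).
  by apply: (subclosed_compact _ cA); [exact: closedI|exact: subIsetl].
have cwl : {within A `&` Z, continuous wl}.
  apply: continuous_in_subspaceT => x /set_mem[_ fx].
  apply: (@continuousM R V (fun x => `|dot (G x) l|) (fun x => `|dot (G x) (rV_int b)|^-1)).
    by apply: (@continuous_comp _ _ _ (fun x => dot (G x) l) (fun y : R => `|y|)); [exact: cG|exact: norm_continuous].
  apply: (@continuousV R V (fun x => `|dot (G x) (rV_int b)|)); first by rewrite normr_eq0 Gb.
  by apply: (@continuous_comp _ _ _ (fun x => dot (G x) (rV_int b)) (fun y : R => `|y|)); [exact: cG|exact: norm_continuous].
have /compact_bounded[M [_ HM]] := continuous_compact cwl cAZ.
have {}HM x : (A `&` Z) x -> wl x <= `|M| + 1.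
  move=> Ax; have lt : M < `|M| + 1 by apply: (le_lt_trans (ler_norm M)); rewrite ltrDl.
  have /(_ _) := HM _ lt (wl x); rewrite /= ger0_norm//; apply.
  by exists x.
have /compact_bounded[r [_ Hr]] := cA.
have Ar : A `<=` ball 0 (`|r| + 2).
  move=> x Ax; rewrite -ball_normE /= sub0r normrN.
  apply: (@le_lt_trans _ _ (`|r| + 1)); last by rewrite ltrD2l ltr1n.
  by apply: Hr => //; apply: (le_lt_trans (ler_norm r)); rewrite ltrDl.
have r0 : 0 < `|r| + 2 by rewrite ltr_wpDl.
rewrite (@directed_measureE R n f G (@df) cf (@cG) (@fper) b D ts ts_sorted ts_size tsP (@Gb) l m dm A mA).
have mAZ : measurable (A `&` Z) by exact: measurableI.
apply: (@le_lt_trans _ _ (\int[rootm]_(x in A `&` Z) (`|M| + 1)%:E)%E).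
  apply: ge0_le_integral => //.
  - by move=> x _; rewrite lee_fin.
  - by apply/measurable_EFinP; exact: (measurable_funS measurableT (@subsetT _ _) mwl).
rewrite integral_cst//; apply: lte_mul_pinfty => //.
apply: (@le_lt_trans _ _ (rootm (ball 0 (`|r| + 2)))); last exact: root_measure_ball.
apply: (le_measure rootm); rewrite ?inE//; first exact: measurable_rV_ball.
by move=> x [Ax _]; exact: Ar.
Qed.

Let rootE A (h : V -> R) : measurable A -> measurable_fun setT h -> (forall x, 0 <= h x) ->
  (\int[rootm]_(x in A) (h x)%:E =
   \sum_(j < D) \int[mu]_x (((fun x => (h x)%:E) \_ A) (rm j x)))%E.
Proof.
move=> mA mh h0; pose hA := (fun x => (h x)%:E) \_ A.
have mhA : measurable_fun setT hA.
  apply: ((measurable_restrictT _ mA).1).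
  by apply/measurable_EFinP; exact: (measurable_funS measurableT (@subsetT _ _) mh).
have hA0 x : (0 <= hA x)%E by rewrite /hA patchE; case: ifP => //; rewrite lee_fin.
rewrite integral_mkcond -/hA.
rewrite (ge0_integral_root_measure cf ts_sorted ts_size tsP measurableT mhA (fun x _ => hA0 x)).
by apply: eq_bigr => j _; rewrite preimage_setT.
Qed.

Lemma directed_periodic : periodic_measure m.
Proof.
move=> q A mA; pose Aq : set V := [set x + rV_int q | x in A].
have AqE x : Aq (x + rV_int q) <-> A x.
  by split => [[y Ay /addIr <-]|Ax] //; exists x.
have mAq : measurable Aq.
  rewrite [X in measurable X](_ : _ = setT `&` (fun x => x + - rV_int q) @^-1` A).
    exact: (measurable_rV_shift (- rV_int q) measurableT mA).
  rewrite setTI; apply/seteqP; split => [_ [y Ay <-]|x /= Ax] /=; first by rewrite addrK.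
  by exists (x - rV_int q) => //; rewrite subrK.
rewrite !mE// !rootE//; apply: eq_bigr => j _.
rewrite -(ge0_integral_rV_shift (rV_int q)).
- apply: eq_integral => x _; rewrite root_map_periodic !patchE wl_per.
  have -> : (rm j x + rV_int q \in Aq) = (rm j x \in A); last by [].
  by apply/idP/idP => /set_mem/AqE/mem_set.
- apply: measurableT_comp => //; apply: ((measurable_restrictT _ mAq).1).
  by apply/measurable_EFinP; exact: (measurable_funS measurableT (@subsetT _ _) mwl).
- by move=> x; rewrite patchE; case: ifP => //; rewrite lee_fin.
Qed.

Let cube := @unit_cube R n.
Let mC : measurable cube. Proof. exact: measurable_unit_cube. Qed.

(** A root reached from [x] may leave the cube that contains [x]; periodicity and
    [integral_cube_unfold] bring the domain back to the cube, separately for each root. *)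
Let cube_int (h : V -> R) : measurable_fun setT h -> (forall x, 0 <= h x) ->
  (forall x (q : 'rV[int]_n), h (x + rV_int q) = h x) ->
  (\int[m]_(x in cube) (h x)%:E = \int[mu]_(x in cube) (\sum_(j < D) h (rm j x) * wl (rm j x))%:E)%E.
Proof.
move=> mh h0 hper.
have mhC : measurable_fun cube (fun x => (h x)%:E).
  by apply/measurable_EFinP; exact: (measurable_funS measurableT (@subsetT _ _) mh).
rewrite (eq_measure_integral (density_measure rootm mwl wl0)); last by move=> B mB _; exact: mE.
rewrite ge0_integral_density//; last by move=> x _; rewrite lee_fin.
have mhw : measurable_fun setT (fun x => (h x * wl x)%:E).
  by apply/measurable_EFinP; exact: measurable_funM.
have hw0 x : 0 <= h x * wl x by rewrite mulr_ge0.
rewrite (eq_integral (fun x => (h x * wl x)%:E)) => [|x _]; last by rewrite EFinM.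
rewrite ge0_integral_root_measure//; last 2 first.
- exact: (measurable_funS measurableT (@subsetT _ _) mhw).
- by move=> x _; rewrite lee_fin.
under [RHS]eq_integral do rewrite -sumEFin.
rewrite ge0_integral_sum//; last 2 first.
- by move=> j; apply: (measurable_funS measurableT (@subsetT _ _)); exact: (measurableT_comp mhw (mrm j)).
- by move=> j x _; rewrite lee_fin.
apply: eq_bigr => j _.
apply: (integral_cube_unfold (mrm j) (root_map_periodic j) mhw).
- by move=> x; rewrite lee_fin.
- by move=> x q; rewrite hper wl_per.
Qed.

Let mfin : (m cube < +oo)%E.
Proof.
have [A cA CA] := @unit_cube_compact R n.
apply: le_lt_trans (directed_radon cA); apply: (le_measure m); rewrite ?inE//.
rewrite -[A]setCK; apply: measurableC; apply: measurable_rV_open; rewrite openC.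
by apply: compact_closed => //; exact: norm_hausdorff.
Qed.

(** The change of variables [cube_int] is for non-negative functions: it is applied to 1 and to
    [1 + g], and the two finite results are subtracted. *)
Lemma directed_fourier0 (g : V -> R) : measurable_fun setT g -> (forall x, `|g x| <= 1) ->
  (forall x (q : 'rV[int]_n), g (x + rV_int q) = g x) ->
  mu.-integrable cube (fun x => (\sum_(j < D) g (rm j x) * wl (rm j x))%:E) ->
  (\int[mu]_(x in cube) (\sum_(j < D) g (rm j x) * wl (rm j x))%:E = 0)%E ->
  (\int[m]_(x in cube) (g x)%:E = 0)%E.
Proof.
move=> mg g1 gper iT T0.
pose W x := \sum_(j < D) 1 * wl (rm j x).
have mW : measurable_fun setT W.
  by apply: measurable_sum => j; apply: measurable_funM => //; exact: measurableT_comp.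
have W0 x : 0 <= W x by apply: sumr_ge0 => j _; rewrite mul1r.
have E1 := @cube_int (fun=> 1) (measurable_cst _) (fun=> ler01) (fun _ _ => erefl).
rewrite integral_cst// mul1e in E1.
have iW : mu.-integrable cube (fun x => (W x)%:E).
  apply/integrableP; split.
    by apply/measurable_EFinP; exact: (measurable_funS measurableT (@subsetT _ _) mW).
  rewrite (eq_integral (fun x => (W x)%:E)) => [|x _]; last by rewrite /= ger0_norm.
  by rewrite /W -E1.
have m1g : measurable_fun setT (fun x => 1 + g x) by exact: measurable_funD.
have g0 x : 0 <= 1 + g x by have := g1 x; rewrite ler_norml; lra.
have E2 := cube_int m1g g0 (fun x q => congr1 (+%R 1) (gper x q)).
have i1 : m.-integrable cube (fun=> 1%:E).
  apply/integrableP; split; first exact: measurable_cst.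
  rewrite (eq_integral (cst 1%E)) => [|x _]; last by rewrite /= normr1.
  by rewrite integral_cst// mul1e.
have ig : m.-integrable cube (fun x => (g x)%:E).
  apply: (le_integrable mC _ _ i1).
    by apply/measurable_EFinP; exact: (measurable_funS measurableT (@subsetT _ _) mg).
  by move=> x _; rewrite /= lee_fin normr1.
move: E2; under eq_integral do rewrite EFinD.
rewrite integralD// integral_cst// mul1e.
rewrite [X in _ = X -> _](eq_integral (fun x => ((W x)%:E + (\sum_(j < D) g (rm j x) * wl (rm j x))%:E)%E)); last first.
  by move=> x _; rewrite -EFinD; congr EFin; rewrite /W -big_split /=; apply: eq_bigr => j _; rewrite mulrDl.
rewrite integralD// T0 adde0 -E1.
have : m cube \is a fin_num by rewrite ge0_fin_numE.
case: (m cube) => // r _; case: (integral _ _ _) => //= u [] /eqP.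
by rewrite -subr_eq0 addrAC subrr add0r => /eqP ->.
Qed.

End periodic_directed.

(** * Construction of the cone *)

Section generic_direction.
Local Open Scope complex_scope.
Context {R : realType} {n : nat}.
Local Notation V := 'rV[R]_n.

Lemma norm_rV_le (x : V) (c : R) : 0 <= c -> (forall j, `|x 0 j| <= c) -> `|x| <= c.
Proof.
move=> c0 xc; rewrite [leLHS]/Num.norm /= mx_normrE.
by apply: bigmax_le => // -[a j] _ /=; rewrite ord1.
Qed.

Lemma norm_delta_le (j : 'I_n) : `|rV_int (delta_mx 0 j) : V| <= 1.
Proof.
apply: norm_rV_le => // k; rewrite !mxE.
by case: (_ && _) => /=; rewrite ?normr1 ?normr0.
Qed.

Lemma idot_delta (q : 'rV[int]_n) j : idot q (delta_mx 0 j) = q 0 j.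
Proof.
rewrite /idot (bigD1 j)//= big1 => [|k kj]; first by rewrite !mxE !eqxx mulr1 addr0.
by rewrite !mxE /= (negbTE kj) mulr0.
Qed.

Lemma idotDr (q a b : 'rV[int]_n) : idot q (a + b) = idot q a + idot q b.
Proof. by rewrite /idot -big_split; apply: eq_bigr => j _; rewrite mxE mulrDr. Qed.

Lemma idotZr (q a : 'rV[int]_n) (N : int) : idot q (N *: a) = N * idot q a.
Proof. by rewrite /idot mulr_sumr; apply: eq_bigr => j _; rewrite mxE mulrCA. Qed.

Lemma idotBl (q q' a : 'rV[int]_n) : idot (q - q') a = idot q a - idot q' a.
Proof.
by rewrite /idot -sumrB; apply: eq_bigr => j _; rewrite !mxE mulrBl.
Qed.

Lemma rV_intZ (N : int) (a : 'rV[int]_n) : (rV_int (N *: a) : V) = N%:~R *: rV_int a.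
Proof. by apply/rowP => j; rewrite !mxE intrM. Qed.

Variable K : set V.
Hypothesis coneK : cone K.
Hypothesis openK : open K.

Let scale_ball (a : R) x e y : 0 < a -> ball x e `<=` K -> ball (a *: x) (a * e) y -> K y.
Proof.
move=> a0 xe axy; have -> : y = a *: (a^-1 *: y).
  by rewrite scalerA mulfV ?scale1r// gt_eqF.
apply/(coneK _ a0).1/xe; move: axy; rewrite -!ball_normE /= => axy.
rewrite -(ltr_pM2l a0) -[X in X * `|_|](ger0_norm (ltW a0)) -normrZ.
by rewrite scalerBr scalerA mulfV ?scale1r// gt_eqF.
Qed.

Lemma integer_direction : K !=set0 ->
  exists b : 'rV[int]_n, exists2 e : R, 0 < e & ball (rV_int b) e `<=` K.
Proof.
move=> [y Ky]; have /nbhs_ballP[d /= d0 yd] : nbhs y K by exact: open_nbhs_nbhs.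
(* Scaling by [M] turns the radius [d] into 2, rounding the coordinates moves the centre by at most
   1, and a ball of radius 1 remains. *)
pose M : R := 2 / d.
have M0 : 0 < M by rewrite divr_gt0.
exists (\row_j Num.floor (M * y 0 j)), 1 => // z bz.
have Md : M * d = 2 by rewrite /M divfK ?gt_eqF.
apply: (scale_ball M0 yd); rewrite Md.
move: bz; rewrite -!ball_normE /= => bz.
rewrite (_ : M *: y - z = (M *: y - rV_int (\row_j Num.floor (M * y 0 j))) +
   (rV_int (\row_j Num.floor (M * y 0 j)) - z)); last by rewrite addrA subrK.
apply: (le_lt_trans (ler_normD _ _)).
suff : `|M *: y - rV_int (\row_j Num.floor (M * y 0 j))| <= 1 by move: bz; lra.
apply: norm_rV_le => // j; rewrite !mxE.
have h1 := floor_le_tmp (M * y 0 j); have h2 := floorD1_gt (M * y 0 j).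
by rewrite intrD1 in h2; rewrite ger0_norm; lra.
Qed.

(** When [b] is orthogonal to the new vector [q], it is replaced by [L b + e_j] with [q 0 j != 0].
    The product with [q] becomes [q 0 j], and a large [L] protects the products that were already
    nonzero. *)
Lemma generic_direction (Q : seq 'rV[int]_n) : K !=set0 -> (forall q, q \in Q -> q != 0) ->
  exists b : 'rV[int]_n, (exists2 e : R, 0 < e & ball (rV_int b) e `<=` K) /\
    forall q, q \in Q -> idot q b != 0.
Proof.
move=> K0; elim: Q => [_|q Q IH Q0].
  by have [b [e e0 be]] := integer_direction K0; exists b; split => //; exists e.
have [|b [[e e0 be] bQ]] := IH; first by move=> r rQ; apply: Q0; rewrite inE rQ orbT.
have [qb|qb] := eqVneq (idot q b) 0; last first.
  exists b; split; first by exists e.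
  by move=> r; rewrite inE => /orP[/eqP ->|/bQ].
have [j qj] : exists j, q 0 j != 0.
  apply/existsP; apply: contraNT (Q0 q (mem_head _ _)); rewrite negb_exists => /forallP h.
  by apply/eqP/rowP => j; rewrite mxE; apply/eqP; have := h j; rewrite negbK.
(* The first part exceeds every [|r 0 j|], so that adding it cannot cancel a nonzero multiple of
   [L]; the second gives [L e > 2], so that moving by [e_j] uses less than half of the scaled
   radius. *)
pose L := (\sum_(r <- Q) absz (r 0%R j) + Num.bound (2 / e))%N.+1.
have L0 : 0 < L%:R :> R by rewrite ltr0n.
have Le : 2 < L%:R * e.
  rewrite -ltr_pdivrMr//; apply: (lt_le_trans (archi_boundP _)); first by rewrite divr_ge0// ltW.
  by rewrite ler_nat /L -addnS (leq_trans _ (leq_addl _ _)).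
have LQ r : r \in Q -> (absz (r 0%R j) < L)%N.
  by move=> rQ; rewrite /L ltnS (big_rem r)//= -addnA leq_addr.
exists (L%:Z *: b + delta_mx 0 j); split.
  exists (L%:R * e / 2); first by rewrite divr_gt0// mulr_gt0.
  move=> z; rewrite -ball_normE /= => bz.
  apply: (scale_ball L0 be); rewrite -ball_normE /=.
  rewrite (_ : _ - z = (rV_int (L%:Z *: b + delta_mx 0 j) - z) - rV_int (delta_mx 0 j)); last first.
    by rewrite rV_intD rV_intZ; apply/rowP => k; rewrite !mxE; ring.
  apply: (le_lt_trans (ler_normB _ _)); have := norm_delta_le j; move: bz Le; lra.
move=> r; rewrite inE idotDr idotZr idot_delta => /orP[/eqP ->|rQ].
  by rewrite qb mulr0 add0r.
have r0 := bQ _ rQ; have rL := LQ _ rQ; apply/negP; rewrite addr_eq0 => /eqP E.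
have := congr1 absz E; rewrite abszN abszM absz_nat => E'.
by move: rL; rewrite -E' ltnNge leq_pmulr// absz_gt0.
Qed.

End generic_direction.

Lemma seq_argmax (T : eqType) (F : T -> int) (s : seq T) : s != [::] ->
  exists2 x, x \in s & forall y, y \in s -> F y <= F x.
Proof.
elim: s => // x s IH _; have [->|s0] := eqVneq s [::].
  by exists x; rewrite ?mem_head// => y; rewrite inE => /eqP ->.
have [y ys Hy] := IH s0; have [xy|yx] := leP (F x) (F y).
  exists y; first by rewrite inE ys orbT.
  by move=> z; rewrite inE => /orP[/eqP ->|/Hy].
exists x; first exact: mem_head.
by move=> z; rewrite inE => /orP[/eqP ->//|/Hy h]; exact: le_trans (ltW yx).
Qed.

Section direction_cone.
Local Open Scope complex_scope.
Context {R : realType} {n : nat}.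
Local Notation V := 'rV[R]_n.
Variables (b0 : 'rV[int]_n) (e : R) (N : nat).
Hypothesis e0 : 0 < e.
Hypothesis Ne : 2 < N%:R * e.
Hypothesis N2 : (1 < N)%N.
Hypothesis b00 : forall j, b0 0 j != 0.

(** The cone over the ball of radius [e] around [b0]. It is convex, whereas the given open cone need
    not be. *)
Definition dir_cone : set V := [set y | exists2 s : R, 0 < s & `|y - s *: rV_int b0| < s * e].

Lemma dir_coneZ (t : R) x : 0 < t -> dir_cone x -> dir_cone (t *: x).
Proof.
move=> t0 [s s0 H]; exists (t * s); first by rewrite mulr_gt0.
by rewrite -scalerA -scalerBr normrZ ger0_norm ?ltW// -mulrA ltr_pM2l.
Qed.

Lemma dir_coneD x y : dir_cone x -> dir_cone y -> dir_cone (x + y).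
Proof.
move=> [s s0 H] [t t0 H']; exists (s + t); first by rewrite addr_gt0.
rewrite scalerDl opprD addrACA mulrDl.
by apply: (le_lt_trans (ler_normD _ _)); exact: ltrD.
Qed.

Lemma dir_cone_sub (K : set V) : cone K -> ball (rV_int b0) e `<=` K -> dir_cone `<=` K.
Proof.
move=> cK bK y [s s0 H]; have -> : y = s *: (s^-1 *: y).
  by rewrite scalerA mulfV ?scale1r// gt_eqF.
apply/(cK _ _ s0).1/bK; rewrite -ball_normE /= distrC.
rewrite -(ltr_pM2l s0) -[X in X * `|_|](ger0_norm (ltW s0)) -normrZ.
by rewrite scalerBr scalerA mulfV ?scale1r// gt_eqF.
Qed.

(* [N * b0] is far inside the cone, so its translates by small vectors remain in it. *)
Definition dir (i : 'I_n) : 'rV[int]_n := N%:Z *: b0 + delta_mx 0 i.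

Let N0 : 0 < N%:R :> R. Proof. by rewrite ltr0n ltnW. Qed.

Lemma dir_cone_near (q : 'rV[int]_n) : `|rV_int q : V| <= 2 -> dir_cone (rV_int (N%:Z *: b0 + q)).
Proof.
move=> q2; exists N%:R => //; rewrite rV_intD rV_intZ addrAC subrr add0r.
exact: le_lt_trans Ne.
Qed.

Let beta : R := \sum_j rV_int b0 0 j.
(** The determinant of the matrix with rows [dir i], which is the identity plus a matrix of rank
    one. *)
Let kap : R := 1 + N%:R * beta.

(** [kap] is an integer congruent to 1 modulo [N], and [N > 1]. *)
Let kap0 : kap != 0.
Proof.
have -> : kap = (1 + N%:Z * \sum_j b0 0 j)%:~R.
  rewrite intrD intrM /kap /beta; congr (_ + _ * _).
  by rewrite rmorph_sum; apply: eq_bigr => j _; rewrite mxE.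
rewrite intr_eq0; apply/negP => /eqP E.
have : (N %| 1)%N by have := dvdz_mulr (\sum_j b0 0 j) (dvdzz N%:Z); rewrite (_ : N%:Z * _ = -1); [|lia].
by rewrite dvdn1 => /eqP N1; move: N2; rewrite N1.
Qed.

Definition dcone : set V := [set x | forall i, 0 <= dot x (rV_int (dir i))].

Let dotdir (x : V) i : dot x (rV_int (dir i)) = N%:R * dot x (rV_int b0) + x 0 i.
Proof.
rewrite rV_intD rV_intZ dotDr dotZr; congr (_ + _).
have -> : rV_int (delta_mx 0 i) = delta_mx 0 i :> V.
  by apply/rowP => j; rewrite !mxE; case: (_ && _).
by rewrite dot_delta.
Qed.

(** The basis dual to the [dir i], from the explicit inverse of a rank-one perturbation of the
    identity. *)
Let ddir (i : 'I_n) : V := delta_mx 0 i - (N%:R * rV_int b0 0 i / kap) *: const_mx 1.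

Let lam (l : V) i := dot l (ddir i).

Let lamE l i : lam l i = l 0 i - N%:R * rV_int b0 0 i / kap * \sum_j l 0 j.
Proof.
rewrite /lam /ddir dotDr dotNr dotZr dot_delta; congr (_ - _ * _).
by apply: eq_bigr => j _; rewrite mxE mulr1.
Qed.

Let dirE k j : (rV_int (dir k) : V) 0 j = N%:R * rV_int b0 0 j + (j == k)%:R.
Proof. by rewrite !mxE intrD intrM /=; case: (j == k). Qed.

Let lam_decomp (l : V) : l = \sum_i lam l i *: rV_int (dir i).
Proof.
have sl : \sum_i lam l i = (\sum_j l 0 j) / kap.
  under eq_bigr do rewrite lamE.
  have X : \sum_i N%:R * rV_int b0 0 i / kap = (kap - 1) / kap.
    by rewrite -mulr_suml -mulr_sumr -/beta; congr (_ / _); rewrite /kap addrC addKr.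
  rewrite sumrB -mulr_suml X.
  have F (k t : R) : k != 0 -> t - (k - 1) / k * t = t / k by move=> k0; field.
  exact: F.
apply/rowP => j; rewrite summxE.
under eq_bigr do rewrite mxE dirE mulrDr.
have S1 : \sum_i lam l i * (j == i)%:R = lam l j.
  by rewrite (bigD1 j)//= eqxx mulr1 big1 ?addr0// => k; rewrite eq_sym => /negbTE ->; rewrite mulr0.
rewrite big_split /= S1 -mulr_suml sl lamE.
have F (k t u w m : R) : k != 0 -> u = t / k * (m * w) + (u - m * w / k * t) by move=> k0; field.
exact: F.
Qed.

Let dir_dual i k : dot (rV_int (dir k)) (ddir i) = (i == k)%:R.
Proof.
rewrite -/(lam _ i) lamE.
have -> : \sum_j (rV_int (dir k) : V) 0 j = kap.
  under eq_bigr do rewrite dirE.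
  have S1 : \sum_(j < n) (j == k)%:R = 1 :> R.
    by rewrite (bigD1 k)//= eqxx big1 ?addr0// => j /negbTE ->.
  by rewrite big_split /= S1 -mulr_sumr addrC.
by rewrite divfK// dirE [X in X - _]addrC addrK.
Qed.

Let dcone_cone : cone dcone.
Proof.
move=> x a a0; split => H i; have := H i; rewrite dotZl; first by move=> h; rewrite mulr_ge0// ltW.
by rewrite pmulr_rge0.
Qed.

Let dcone_convex : @convex_set R V dcone.
Proof.
move=> x y t /set_mem Hx /set_mem Hy; apply/mem_set => i.
rewrite /= dotDl !dotZl addr_ge0// mulr_ge0//.
by rewrite subr_ge0 le1.
Qed.

Let dcone_closed : closed dcone.
Proof.
rewrite (_ : dcone = \bigcap_(i in [set: 'I_n]) [set x | 0 <= dot x (rV_int (dir i))]); last first.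
  by apply/seteqP; split => [x Hx i _|x Hx i]; [exact: Hx|exact: (Hx i I)].
apply: closed_bigI => i _.
apply: (@closed_comp _ _ (fun x : V => dot x (rV_int (dir i))) [set y | 0 <= y]); last exact: closed_ge.
by move=> x _; under eq_fun do rewrite dotC; exact: dot_continuous.
Qed.

Let open_pos (w : 'I_n -> V) : open [set x : V | forall i, 0 < dot x (w i)].
Proof.
rewrite [X in open X](_ : _ = \big[setI/setT]_(i < n) [set x : V | 0 < dot x (w i)]).
  apply: (big_ind (@open V)); [exact: openT|exact: openI|move=> i _].
  apply: (@open_comp _ _ (fun x : V => dot x (w i)) [set y | 0 < y]); last exact: open_gt.
  by move=> x _; under eq_fun do rewrite dotC; exact: dot_continuous.
rewrite -bigcap_seq; apply/seteqP; split => [x Hx i _|x Hx i]; first exact: Hx.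
by apply: (Hx i); rewrite /= mem_index_enum.
Qed.

Lemma dcone_proper : proper_cone dcone.
Proof.
split; [exact: dcone_cone|exact: dcone_convex|exact: dcone_closed| |].
(* [b0] itself is interior: its product with [dir i] is N |b0|^2 + b0_i, and for a nonzero integer
   coordinate |b0_i| is at most its square, hence at most |b0|^2. *)
- exists (rV_int b0); have Ob i : 0 < dot (rV_int b0 : V) (rV_int (dir i)).
    rewrite dotdir.
    set u : R := (rV_int b0 : V) 0 i; set d := dot _ _.
    have bi : 0 < u ^+ 2 by rewrite exprn_even_gt0//= /u mxE intr_eq0 b00.
    have d2 : u ^+ 2 <= d.
      rewrite /d /dot (bigD1 i)//= expr2 lerDl; apply: sumr_ge0 => j _.
      by rewrite -expr2 sqr_ge0.
    have a1 : `|u| <= u ^+ 2.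
      rewrite /u mxE -rmorphXn /= -intr_norm ler_int.
      have -> : b0 0 i ^+ 2 = `|b0 0 i| * `|b0 0 i| by rewrite -normrM -expr2 ger0_norm// sqr_ge0.
      by rewrite ler_peMr// -gtz0_ge1 normr_gt0.
    have hn : - u <= `|u| by rewrite -normrN ler_norm.
    have Nd : 2 * d <= N%:R * d.
      by rewrite ler_pM2r ?ler_nat//; exact: lt_le_trans d2.
    by move: bi d2 a1 hn Nd; move: (u ^+ 2) (`|u|) (N%:R * d) => s a t; lra.
  apply: (@filterS _ _ _ [set x : V | forall i, 0 < dot x (rV_int (dir i))]).
    by move=> x Ox i; apply: ltW; exact: Ox.
  by apply: open_nbhs_nbhs; split; [exact: open_pos|exact: Ob].
(* The sum of the directions is non-negative on the cone. If it vanishes at [x], all products with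
   the [dir i] do, hence x = - N <x, b0> (1, ..., 1), and pairing with [b0] gives <x, b0> kap =
   0. *)
- exists (\sum_i rV_int (dir i)) => x Cx x0.
  have E : dot (\sum_i rV_int (dir i)) x = \sum_i dot x (rV_int (dir i)).
    by rewrite dotC; elim/big_rec2: _ => [|i u w _ <-]; rewrite ?dot0r// dotDr.
  rewrite E lt_neqAle sumr_ge0 ?andbT; last by move=> i _; exact: Cx.
  apply: contra x0 => /eqP/esym/eqP; rewrite psumr_eq0; last by move=> i _; exact: Cx.
  move=> /allP H; have {}H i : N%:R * dot x (rV_int b0) + x 0 i = 0.
    by apply/eqP; rewrite -dotdir; apply: H; rewrite mem_index_enum.
  have xE i : x 0 i = - (N%:R * dot x (rV_int b0)) by have := H i; lra.
  have : dot x (rV_int b0) * kap = 0.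
    have : dot x (rV_int b0) = - (N%:R * dot x (rV_int b0)) * beta.
      rewrite {1}/dot /beta mulr_sumr; apply: eq_bigr => i _; by rewrite {1}xE.
    by rewrite /kap; move: (dot _ _) => d; lra.
  move=> /eqP; rewrite mulf_eq0 (negbTE kap0) orbF => /eqP d0.
  by apply/eqP/rowP => i; rewrite xE d0 mulr0 oppr0 mxE.
Qed.

(** An interior point of the dual cone stays in it after subtracting a small multiple of [dir i];
    testing against [ddir i], which lies in [dcone], shows that its [i]-th coordinate in the basis
    of directions is positive. *)
Let dual_interiorE : interior (dual_cone dcone) = [set l | forall i, 0 < lam l i].
Proof.
apply/seteqP; split => [l|l Hl].
  move=> /nbhs_ballP[r /= r0 lr] i.
  pose t := r / (2 * (1 + `|rV_int (dir i) : V|)).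
  have d0 : 0 < 2 * (1 + `|rV_int (dir i) : V|) by rewrite mulr_gt0// ltr_pwDl.
  have t0 : 0 < t by rewrite divr_gt0.
  have : dual_cone dcone (l - t *: rV_int (dir i)).
    apply: lr; rewrite -ball_normE /= opprB addrC subrK normrZ ger0_norm ?(ltW t0)//.
    rewrite /t mulrAC ltr_pdivrMr//.
    by have := normr_ge0 (rV_int (dir i) : V); move: (`|_|) => u u0; nra.
  move=> /(_ (ddir i)); rewrite dotDl dotNl dotZl dir_dual eqxx mulr1 -/(lam l i) => H.
  have : 0 <= lam l i - t by apply: H => k; rewrite dotC dir_dual.
  by rewrite subr_ge0; exact: lt_le_trans.
apply: (@filterS _ _ _ [set l : V | forall i, 0 < lam l i]); last first.
  by apply: open_nbhs_nbhs; split => //; exact: open_pos.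
move=> {Hl}l Hl x Cx; rewrite [l]lam_decomp.
have -> : dot (\sum_i lam l i *: rV_int (dir i)) x = \sum_i lam l i * dot x (rV_int (dir i)).
  rewrite dotC; elim/big_rec2: _ => [|i u w _ <-]; first by rewrite dot0r.
  by rewrite dotDr dotZr.
by apply: sumr_ge0 => i _; rewrite mulr_ge0// ltW.
Qed.

Lemma dcone_dual_cone : cone (interior (dual_cone dcone)).
Proof.
rewrite dual_interiorE => l a a0; split => H i; have := H i; rewrite /lam dotZl.
  by move=> h; rewrite mulr_gt0.
by rewrite pmulr_rgt0.
Qed.

Lemma dcone_dual_neq0 : interior (dual_cone dcone) !=set0.
Proof.
rewrite dual_interiorE; exists (\sum_i rV_int (dir i)) => k; rewrite /lam.
have -> : dot (\sum_i rV_int (dir i)) (ddir k) = \sum_i dot (rV_int (dir i)) (ddir k).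
  rewrite dotC; elim/big_rec2: _ => [|i u w _ <-]; first by rewrite dot0r.
  by rewrite dotDr [dot (ddir k) _]dotC.
rewrite (bigD1 k)//= dir_dual eqxx big1 ?addr0// => i ik.
by rewrite dir_dual eq_sym (negbTE ik).
Qed.

Lemma dcone_dual_decomp l : interior (dual_cone dcone) l ->
  exists2 c : 'I_n -> R, forall i, 0 < c i & l = \sum_i c i *: rV_int (dir i).
Proof. by rewrite dual_interiorE => H; exists (lam l); [exact: H|exact: lam_decomp]. Qed.

Lemma dir_cone_dir i : dir_cone (rV_int (dir i)).
Proof.
apply: dir_cone_near; apply: le_trans (norm_delta_le i) _; by rewrite ler1n.
Qed.

Lemma dcone_dual_sub : interior (dual_cone dcone) `<=` dir_cone.
Proof.
move=> l /dcone_dual_decomp[c c0 ->].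
(* In dimension 0 the sum is empty, so membership of the zero vector is checked directly. *)
case: (pickP (@predT 'I_n)) => [i0 _|no]; last first.
  exists 1 => //; rewrite mul1r; apply: le_lt_trans e0.
  by apply: norm_rV_le => // j; have := no j.
have H (r : seq 'I_n) w : dir_cone w -> dir_cone (w + \sum_(i <- r) c i *: rV_int (dir i)).
  elim: r w => [|i r IH] w Kw; first by rewrite big_nil addr0.
  rewrite big_cons addrA; apply: IH; apply: dir_coneD => //.
  by apply: dir_coneZ => //; exact: dir_cone_dir.
rewrite (bigD1 i0)//= -big_filter; apply: H; apply: dir_coneZ => //; exact: dir_cone_dir.
Qed.

End direction_cone.

(** * The Fourier coefficients of directed measures *)

Section lee_yang_surface.
Local Open Scope complex_scope.
Context {R : realType} {n : nat}.
Local Notation V := 'rV[R]_n.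
Variables (p : laurent R n) (K : set V).
Hypothesis KZ : forall (t : R) x, 0 < t -> K x -> K (t *: x).
Hypothesis KD : forall x y, K x -> K y -> K (x + y).
Hypothesis pK : forall z : 'rV[R[i]]_n,
  K (map_mx (@complex.Re R) z) \/ K (- map_mx (@complex.Re R) z) ->
  laurent_eval p (map_mx cexp z) != 0.
Variables (ap am : 'rV[int]_n).
Hypotheses (aps : ap \in finsupp p) (ams : am \in finsupp p).
Hypothesis preg : regular p.
Variable c : R[i].
Hypothesis c1 : `|c| = 1.
Hypothesis hform_real : forall x, complex.Im (hform p ap am c x) = 0.

Local Notation f := (rform p ap am c).
Local Notation G := (rgrad p ap am c).
Local Notation good := (good_dir p K ap am).

Lemma expi_dot_int (a q : 'rV[int]_n) : expi (dot (rV_int a : V) (rV_int q)) = 1.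
Proof. by rewrite dot_rV_int expiZ. Qed.

Lemma tsum_periodic x (q : 'rV[int]_n) : tsum p (x + rV_int q) = tsum p x.
Proof.
by apply: eq_bigr => a _; rewrite /lcoef dotDr expiD expi_dot_int mulr1.
Qed.

Lemma rform_zero_periodic x (q : 'rV[int]_n) : (f (x + rV_int q) == 0) = (f x == 0).
Proof. by rewrite !rform_eq0// tsum_periodic. Qed.

Lemma Sigma_rform : Sigma p = [set x | f x = 0].
Proof.
apply/seteqP; split => x /= => [|/eqP].
  rewrite /Sigma /= laurent_evalE => h; apply/eqP; rewrite rform_eq0//.
  by rewrite -/(tsum p x) in h; apply/eqP.
by rewrite rform_eq0// /Sigma /= laurent_evalE => /eqP.
Qed.

(** The midpoint [wmid] is only half-integral, so an integer translation may change the sign of the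
    real form and of its gradient; the absolute value removes it. *)
Lemma rgrad_periodic x (q : 'rV[int]_n) v : `|dot (G (x + rV_int q)) v| = `|dot (G x) v|.
Proof.
pose w := dot (wmid ap am : V) (rV_int q).
have hq : hgrad p ap am c (x + rV_int q) v = expi (- w) * hgrad p ap am c x v.
  rewrite mulr_sumr; apply: eq_bigr => a _.
  have -> : expi (dot (cfreq ap am a) (x + rV_int q)) = expi (dot (cfreq ap am a) x) * expi (- w).
    rewrite dotDr expiD; congr (_ * _).
    by rewrite /cfreq dotDl dotNl expiD expi_dot_int mul1r.
  by move: (expi _) (expi _) => u u'; ring.
have ww : expi (- w) * expi (- w) = 1.
  rewrite -expiD (_ : - w + - w = (- idot (ap + am) q)%:~R) ?expiZ//.
  by rewrite intrN -dot_rV_int rV_intD /w /wmid dotZl; lra.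
rewrite -!Re_hgrad hq; have /eqP : expi (- w) ^+ 2 = 1 ^+ 2 by rewrite expr1n expr2.
rewrite eqf_sqr => /orP[] /eqP ->; first by rewrite mul1r.
by rewrite mulN1r; case: (hgrad _ _ _ _ _ _) => u u' /=; rewrite normrN.
Qed.

Let unit x : R[i] := c * expi (- dot (wmid ap am) x) * (0 +i* (2 * pi)).

Let unit_neq0 x : unit x != 0.
Proof.
rewrite /unit mulf_neq0//; first rewrite mulf_neq0//.
- by rewrite -normr_eq0 c1 oner_eq0.
- exact: expi_neq0.
by rewrite eq_complex /= negb_and orbC mulf_neq0// gt_eqF// pi_gt0.
Qed.

Let tsum0 x : f x = 0 -> tsum p x = 0.
Proof. by move=> /eqP; rewrite rform_eq0// => /eqP. Qed.

Let GE x v : f x = 0 -> (dot (G x) v)%:C = unit x * gsum p x v.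
Proof. by move=> /tsum0 Fx; exact: rgradE. Qed.

Lemma rgrad_good_neq0 b x : good b -> f x = 0 -> dot (G x) (rV_int b) != 0.
Proof.
move=> bg fx; have := gsum_neq0 KZ KD pK bg preg (tsum0 fx).
apply: contra_neq => E; have := GE (rV_int b) fx; rewrite E => /esym/eqP.
by rewrite mulf_eq0 (negbTE (unit_neq0 x)) => /eqP.
Qed.

(** Opposite signs would give a positive [kap] for which the relation in [lee_yang_transversal]
    holds between [b] and [b'], forcing [gsum] to vanish along [b']. *)
Lemma rgrad_good_sign b b' x : good b -> good b' -> f x = 0 ->
  0 < dot (G x) (rV_int b) * dot (G x) (rV_int b').
Proof.
move=> bg bg' fx; have n1 := rgrad_good_neq0 bg fx; have n2 := rgrad_good_neq0 bg' fx.
rewrite ltNge; apply/negP => le0.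
pose kap := - (dot (G x) (rV_int b) / dot (G x) (rV_int b')).
have kap0 : 0 < kap.
  have uw : dot (G x) (rV_int b) * dot (G x) (rV_int b') < 0 by rewrite lt_neqAle mulf_neq0.
  have F (u w : R) : w != 0 -> u * w < 0 -> 0 < - (u / w).
    move=> w0 uw0; have -> : - (u / w) = (- (u * w)) / w ^+ 2 by field.
    by rewrite divr_gt0 ?oppr_gt0// exprn_even_gt0.
  exact: F.
have E : gsum p x (rV_int b) = - (kap%:C * gsum p x (rV_int b')).
  apply: (mulfI (unit_neq0 x)); rewrite -GE// mulrN mulrCA -GE// -rmorphM -rmorphN /=.
  by congr (_%:C); rewrite /kap mulNr opprK divfK.
case: (bg) (bg') => Kb _ _ _ [Kb' _ _ _].
have := gsum_neq0 KZ KD pK bg' preg (tsum0 fx); rewrite gsum_int => /eqP; apply.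
apply: (lee_yang_transversal KZ KD pK kap0 Kb Kb' (tsum0 fx)).
by rewrite -!gsum_int.
Qed.

Lemma good_roots b : good b -> exists ts : V -> seq R,
  [/\ forall x, sorted <%R (ts x), forall x, size (ts x) = dirdeg ap am b,
      forall x t, (t \in ts x) = (0 <= t < 1) && (f (x + t *: rV_int b) == 0) &
      forall x, dirpoly p am b x = lcoef p x ap *: \prod_(t <- ts x) ('X - (expi t)%:P)].
Proof.
move=> bg; have /choice[ts Hts] := dir_zeros KZ KD pK aps ams bg preg.
exists ts; split => x; have [h1 h2 h3 h4] := Hts x => //.
by move=> t; rewrite h3 rform_eq0.
Qed.

Lemma directed_lighthouse (b : 'rV[int]_n) (I : finType) (bs : I -> 'rV[int]_n) (C : set V) :
  proper_cone C -> good b -> (forall i, good (bs i)) ->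
  (forall x, C x <-> forall i, 0 <= dot x (rV_int (bs i))) ->
  forall l : V, (exists2 lam : I -> R, forall i, 0 < lam i & l = \sum_i lam i *: rV_int (bs i)) ->
  forall m, directed_measure (Sigma p) l m -> lighthouse m C.
Proof.
move=> Cp bg bsg CE l [lam lam0 lE] m; rewrite Sigma_rform => dm.
have df gam t v := @is_derive_rform R n p ap am c gam t v.
have cf := @continuous_rform R n p ap am c.
have cG := @continuous_rgrad R n p ap am c.
have fper := rform_zero_periodic; have Gper := rgrad_periodic.
have [ts [ts_sorted ts_size tsP _]] := good_roots bg.
have Gb x := @rgrad_good_neq0 b x bg.
split => //.
- exact: (@directed_radon R n f G df cf cG fper b _ ts ts_sorted ts_size tsP Gb l m dm).
- exact: (@directed_periodic R n f G df cf cG fper Gper b _ ts ts_sorted ts_size tsP Gb l m dm).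
- exact: (@directed_null_support R n f G df cf cG fper b _ ts ts_sorted ts_size tsP Gb l m dm).
move=> k; apply: contraPP => /not_orP[Ck CNk].
have [i ki] : exists i, idot k (bs i) < 0.
  apply: contrapT => /forallNP h; apply: Ck; apply/CE => i.
  by rewrite dot_rV_int ler0z leNgt; apply/negP; exact: h.
(* The direction is now adapted to [k]: the same measure is described by its roots along [bs i],
   where [<k, bs i> < 0]. *)
have {ts ts_sorted ts_size tsP Gb} [ts [ts_sorted ts_size tsP ts_poly]] := good_roots (bsg i).
have Gb x := @rgrad_good_neq0 (bs i) x (bsg i).
pose Cn (q : 'rV[int]_n) := C (rV_int q).
have Cn0 : Cn 0 by apply/CE => j; rewrite dot_rV_int /idot big1// => s _; rewrite mxE mul0r.
have CnD q q' : Cn q -> Cn q' -> Cn (q + q').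
  by move=> /CE h /CE h'; apply/CE => j; rewrite rV_intD dotDl addr_ge0.
have Cnap a : a \in finsupp p -> Cn (ap - a).
  move=> asupp; apply/CE => j; rewrite dot_rV_int ler0z idotBl subr_ge0.
  by case: (bsg j) => _ _ + _ => /(_ a asupp); case: eqVneq => [->//|_ /(_ isT)/ltW].
have ts_rt x t : (t \in ts x) = (0 <= t < 1) && (tsum p (x + t *: rV_int (bs i)) == 0).
  by rewrite tsP rform_eq0.
pose D := dirdeg ap am (bs i).
pose e (x : V) := expi (- dot (rV_int k) x).
pose T x := \sum_(j < D) e (root_map (rV_int (bs i)) ts j x) *
  (flux_ratio G (bs i) l (root_map (rV_int (bs i)) ts j x))%:C.
have T_trig : trig_poly (fun q => Cn (- k - q)) T.
  have := ratio_sum_trig KZ KD pK aps ams preg (bsg i) ts_sorted ts_size ts_rt ts_poly Cn0 CnD Cnap l ki.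
  apply: trig_poly_ext => x; rewrite (big_nth 0) ts_size big_mkord; apply: eq_bigr => j _.
  have [_ fx] := nth_rootP ts_size tsP x (ltn_ord j).
  rewrite -/(nth_root ts j x) -/(root_map (rV_int (bs i)) ts j x) /e; congr (_ * _).
  set y := root_map _ _ _ _ in fx *.
  have Gly : 0 <= dot (G y) l * dot (G y) (rV_int (bs i)).
    have -> : dot (G y) l = \sum_s lam s * dot (G y) (rV_int (bs s)).
      rewrite lE; elim/big_rec2: _ => [|s u w _ <-]; first by rewrite dot0r.
      by rewrite dotDr dotZr.
    rewrite mulr_suml; apply: sumr_ge0 => s _; rewrite -mulrA mulr_ge0 ?(ltW (lam0 s))//.
    exact/ltW/rgrad_good_sign.
  have -> : flux_ratio G (bs i) l y = dot (G y) l / dot (G y) (rV_int (bs i)).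
    rewrite /flux_ratio -normfV -normrM ger0_norm//.
    have -> : dot (G y) l / dot (G y) (rV_int (bs i)) =
        (dot (G y) l * dot (G y) (rV_int (bs i))) / dot (G y) (rV_int (bs i)) ^+ 2.
      by have := Gb _ fx; move: (dot _ _) (dot _ _) => u w w0; field.
    by rewrite divr_ge0// sqr_ge0.
  rewrite rmorphM fmorphV /= !GE// invfM mulrACA mulfV ?mul1r//.
(* The frequency 0 would require [- k] to lie in [C]. *)
have QN0 : ~ Cn (- k - 0) by rewrite subr0 /Cn rV_intN.
have Re_T x : complex.Re (T x) = \sum_(j < D) complex.Re (e (root_map (rV_int (bs i)) ts j x)) *
  flux_ratio G (bs i) l (root_map (rV_int (bs i)) ts j x) by rewrite cRe_sum_real.
(* The imaginary part is the real part of - i T, another trigonometric polynomial with the same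
   frequencies. *)
have Im_T x : complex.Re (- (0 +i* 1) * T x) =
  \sum_(j < D) complex.Im (e (root_map (rV_int (bs i)) ts j x)) *
  flux_ratio G (bs i) l (root_map (rV_int (bs i)) ts j x).
  by rewrite -cIm_sum_real -/(T x); case: (T x) => u w /=; ring.
have [i1 z1] := integral_trig_poly QN0 T_trig.
have [i2 z2] := integral_trig_poly QN0 (trig_polyZ (- (0 +i* 1)) T_trig).
have e_per x (q : 'rV[int]_n) : e (x + rV_int q) = e x.
  by rewrite /e dotDr opprD expiD [X in _ * X]expiN expi_dot_int invr1 mulr1.
have eE x : e x = cos (2 * pi * - dot (rV_int k) x) +i* sin (2 * pi * - dot (rV_int k) x).
  by rewrite /e expiE.
have ca : continuous (fun x : V => 2 * pi * - dot (rV_int k) x).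
  move=> x; apply: (@continuousM R V (cst (2 * pi)) (fun x => - dot (rV_int k) x)).
    exact: cst_continuous.
  by apply: continuousN; exact: dot_continuous.
have key (g : V -> R) : (g = fun x => complex.Re (e x)) \/ (g = fun x => complex.Im (e x)) ->
  (\int[m]_(x in unit_cube) (g x)%:E = 0)%E.
  move=> Hg.
  have mg : measurable_fun setT g.
    apply: continuous_measurable_rV; case: Hg => ->; under eq_fun do rewrite eE /=.
      by move=> x; apply: (@continuous_comp V R R _ cos); [exact: ca|exact: continuous_cos].
    by move=> x; apply: (@continuous_comp V R R _ sin); [exact: ca|exact: continuous_sin].
  have g1 x : `|g x| <= 1.
    case: Hg => ->; rewrite eE /= ler_norml; first by rewrite cos_geN1 cos_le1.
    by rewrite sin_geN1 sin_le1.
  have gper x (q : 'rV[int]_n) : g (x + rV_int q) = g x by case: Hg => ->; rewrite e_per.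
  apply: (@directed_fourier0 R n f G df cf cG fper Gper (bs i) D ts ts_sorted ts_size tsP Gb l m dm g mg g1 gper).
    by case: Hg => ->; [under eq_fun do rewrite -Re_T|under eq_fun do rewrite -Im_T].
  by case: Hg => ->; [under eq_integral do rewrite -Re_T|under eq_integral do rewrite -Im_T].
apply/negP; rewrite negbK /fourier_coef /Rintegral.
have eF x : cexp (0 +i* (- (2 * pi * dot (rV_int k) x))) = e x.
  by rewrite /e /expi mulrN.
under eq_integral do rewrite eF.
rewrite key; last by left.
under eq_integral do rewrite eF.
by rewrite key//; right.
Qed.

Lemma good_directed_measure b l : good b -> exists m, directed_measure (Sigma p) l m.
Proof.
move=> bg; rewrite Sigma_rform.
have df gam t v := @is_derive_rform R n p ap am c gam t v.
have [ts [ts_sorted ts_size tsP _]] := good_roots bg.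
have Gb x := @rgrad_good_neq0 b x bg.
exact: (@exists_directed_measure R n f G df (@continuous_rform R n p ap am c)
  (@continuous_rgrad R n p ap am c) rform_zero_periodic b _ ts ts_sorted ts_size tsP Gb l).
Qed.

End lee_yang_surface.

Lemma int_gap (N u w x y : int) : N <= u - w -> y - x < N -> w + y < u + x.
Proof. lia. Qed.

Theorem theorem2p2 (R : realType) (n : nat) (p : laurent R n) :
  regular p -> essentially_lee_yang p ->
  exists C : set 'rV[R]_n,
    [/\ proper_cone C,
        essentially_lee_yang_wrt p (interior (dual_cone C)) &
        forall l : 'rV[R]_n, interior (dual_cone C) l ->
          (exists m : {measure set 'rV[R]_n -> \bar R},
             directed_measure (Sigma p) l m) /\
          (forall m : {measure set 'rV[R]_n -> \bar R},
             directed_measure (Sigma p) l m -> lighthouse m C)].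
Proof.
move=> preg [K0 [cK0 oK0 K0n pK0]].
pose supp : seq 'rV[int]_n := finsupp p.
have supp0 : supp != [::].
  have [y Ky] := K0n; apply: contraTneq isT => E.
  have := pK0 (map_mx (real_complex R) y); rewrite /laurent_eval -/supp E big_nil eqxx.
  move=> H; suff : false by []; apply: H; left.
  by rewrite (_ : map_mx _ _ = y)//; apply/rowP => j; rewrite !mxE.
(* Differences of exponents make the exponents distinct along [b0], so that the maximum and the
   minimum are strict; the basis vectors make all coordinates of [b0] nonzero, as [dcone_proper]
   requires. *)
pose Q : seq 'rV[int]_n := [seq a - a' | a <- supp, a' <- supp] ++ [seq delta_mx 0 j | j <- enum 'I_n].
have [b0 [[e e0 be] bQ]] := @generic_direction R n K0 cK0 oK0 [seq q <- Q | q != 0] K0n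
  (fun q => ltac:(by rewrite mem_filter => /andP[])).
have bsupp a a' : a \in supp -> a' \in supp -> a != a' -> idot a b0 != idot a' b0.
  move=> sa sa' aa'; rewrite -subr_eq0 -idotBl; apply: bQ.
  rewrite mem_filter subr_eq0 aa' mem_cat; apply/orP; left.
  by apply/allpairsP; exists (a, a').
have b00 j : b0 0 j != 0.
  have := bQ (delta_mx 0 j); rewrite mem_filter.
  have -> : idot (delta_mx 0 j) b0 = b0 0 j.
    by rewrite -idot_delta /idot; apply: eq_bigr => i _; rewrite mulrC.
  apply; apply/andP; split.
    by apply/eqP => /rowP/(_ j); rewrite !mxE !eqxx.
  by rewrite mem_cat; apply/orP; right; apply/map_f; rewrite mem_enum.
have [ap aps Hap] := seq_argmax (fun a => idot a b0) supp0.
have [am ams Ham] := seq_argmax (fun a => - idot a b0) supp0.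
(* [N > 1] makes the directions independent, [N e > 2] keeps vectors within distance 2 of [N b0] in
   the cone, and the last bound prevents a basis vector from reversing an order of exponents, where
   [N b0] creates gaps of at least [N]. *)
have [N [N2 Ne NS]] : exists N : nat, [/\ (1 < N)%N, 2 < N%:R * e &
    forall a a' j, a \in supp -> a' \in supp -> a' 0 j - a 0 j < N%:Z].
  pose S := (\sum_(a <- supp) \sum_(a' <- supp) \sum_j absz (a' 0%R j - a 0%R j)%R)%N.
  exists (S + Num.bound (2 / e)).+2; split => [//||a a' j sa sa'].
    rewrite -ltr_pdivrMr//; apply: (lt_le_trans (archi_boundP _)); first by rewrite divr_ge0// ltW.
    by rewrite ler_nat; apply: leqW; apply: leqW; exact: leq_addl.
  apply: le_lt_trans (ler_norm _) _; rewrite -abszE ltz_nat.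
  rewrite ltnS (leq_trans _ (leqnSn _))// (leq_trans _ (leq_addr _ _))//.
  rewrite /S (big_rem a)//= (leq_trans _ (leq_addr _ _))// (big_rem a')//=.
  by rewrite (leq_trans _ (leq_addr _ _))// (bigD1 j)//= leq_addr.
pose K : set 'rV[R]_n := dir_cone b0 e.
have KK0 : K `<=` K0 by exact: dir_cone_sub.
have KZ (t : R) x : 0 < t -> K x -> K (t *: x) by exact: dir_coneZ.
have KD x y : K x -> K y -> K (x + y) by exact: dir_coneD.
have pK z : K (map_mx (@complex.Re R) z) \/ K (- map_mx (@complex.Re R) z) ->
    laurent_eval p (map_mx cexp z) != 0.
  by move=> [/KK0 h|/KK0 h]; apply: pK0; [left|right].
have Knear q : `|rV_int q : 'rV[R]_n| <= 2 -> K (rV_int (N%:Z *: b0 + q)) by exact: dir_cone_near.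
have dl j := @norm_delta_le R n j.
(* A perturbation that preserves the order of the exponents along [b0] keeps [ap] and [am] extreme.
   All directions thus share this pair, and with it the same real form. *)
have extremal q : (forall a a', a \in supp -> a' \in supp -> idot a' b0 < idot a b0 ->
    idot a' (N%:Z *: b0 + q) < idot a (N%:Z *: b0 + q)) ->
    `|rV_int q : 'rV[R]_n| <= 1 -> good_dir p K ap am (N%:Z *: b0 + q).
  move=> Hq q1; split.
  - by apply: Knear; apply: le_trans q1 _; rewrite ler1n.
  - move=> j; rewrite -!addrA; split; apply: Knear; rewrite rV_intD.
      by apply: (le_trans (ler_normD _ _)); have := dl j; move: q1; lra.
    by rewrite rV_intN; apply: (le_trans (ler_normB _ _)); have := dl j; move: q1; lra.
  - move=> a asupp aap; apply: Hq => //.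
    by rewrite lt_neqAle (bsupp _ _ asupp aps aap) Hap.
  - move=> a asupp aam; apply: Hq => //.
    by rewrite lt_neqAle eq_sym (bsupp _ _ asupp ams aam) -lerN2 Ham.
have good_base : good_dir p K ap am (N%:Z *: b0 + 0).
  apply: extremal => [a a' sa sa' h|].
    by rewrite addr0 !idotZr ltr_pM2l// ltz_nat ltnW.
  by rewrite (_ : rV_int 0 = 0) ?normr0//; apply/rowP => j; rewrite !mxE.
have good_dirs i : good_dir p K ap am (dir b0 N i).
  apply: extremal => [a a' sa sa' h|]; last exact: dl.
  rewrite !idotDr !idotZr !idot_delta.
  have h1 : 1 <= idot a b0 - idot a' b0 by rewrite -gtz0_ge1 subr_gt0.
  have h2 : N%:Z <= N%:Z * (idot a b0 - idot a' b0) by rewrite ler_peMr.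
  by rewrite mulrBr in h2; exact: int_gap h2 (NS _ _ i sa sa').
have [c c1 creal] := hform_unit KZ pK aps ams good_base.
pose C : set 'rV[R]_n := dcone b0 N.
have Cp : proper_cone C by exact: (dcone_proper e0 Ne N2 b00).
have CK : interior (dual_cone C) `<=` K by exact: (dcone_dual_sub e0 Ne N2).
exists C; split => //.
- split; [exact: (@dcone_dual_cone R n b0 e N e0 Ne N2)|exact: open_interior|exact: (@dcone_dual_neq0 R n b0 e N e0 Ne N2)|].
  by move=> z [/CK h|/CK h]; apply: pK; [left|right].
- move=> l Cl; split; first exact: (good_directed_measure KZ KD pK aps ams preg c1 creal l good_base).
  move=> m dm; apply: (directed_lighthouse KZ KD pK aps ams preg c1 creal Cp good_base good_dirs _ _ dm).
    by [].
  exact: (dcone_dual_decomp e0 Ne N2 Cl).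
Qed.
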